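(* Let $f(x,y)=(x+\alpha,\,y+x+\beta)$, with $\alpha\in\mathbb R\setminus\mathbb Q$ and $\beta\in\mathbb R$, be any uniquely ergodic skew-shift on $\mathbb T^2$. Let $s>3$ and let $\phi\in\pi^*L^2(\mathbb T)^\perp\cap W^s(\mathbb T^2)$. If $\phi$ is a measurable coboundary for $f$, i.e. $\phi=u\circ f-u$ almost everywhere for some measurable function $u$ on $\mathbb T^2$, then $\phi$ belongs to the kernel of all $f$-invariant distributions, and the transfer function satisfies $u\in W^t(\mathbb T^2)$ for all $t<s-1$.
   Context: $\mathbb T=\mathbb R/\mathbb Z$, $\mathbb T^2=\mathbb R^2/\mathbb Z^2$, $\pi:\mathbb T^2\to\mathbb T$, $\pi(x,y)=x$. $\pi^*L^2(\mathbb T)=\{\psi\circ\pi:\psi\in L^2(\mathbb T)\}$ is a closed subspace of $L^2(\mathbb T^2)$, and $\pi^*L^2(\mathbb T)^\perp$ is its orthogonal complement, i.e. the functions $\phi\in L^2(\mathbb T^2)$ with $\int_{\mathbb T}\phi(x,y)\,dy=0$ for a.e. $x$. $W^s(\mathbb T^2)$ is the Sobolev space of functions $\Phi=\sum_{(m,n)\in\mathbb Z^2}\Phi_{m,n}e^{2\pi i(mx+ny)}$ with $\|\Phi\|_s^2=\sum_{(m,n)}(1+m^2+n^2)^s|\Phi_{m,n}|^2<\infty$, and $W^{-s}(\mathbb T^2)$ is its dual. An $f$-invariant distribution is a distribution $D$ with $D(\psi\circ f)=D(\psi)$ for all smooth $\psi$; since $\phi\in W^s(\mathbb T^2)$, ''kernel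 of all $f$-invariant distributions'' means $D(\phi)=0$ for every $f$-invariant $D\in W^{-s}(\mathbb T^2)$. On $\pi^*L^2(\mathbb T)^\perp$ the relevant ones are, for $n\in\mathbb Z\setminus\{0\}$ and $m\in\mathbb Z_{|n|}$ (residues mod $|n|$, represented by integers), the distributions $D_{(m,n)}$ given on $e_{a,b}(x,y)=e^{2\pi i(ax+by)}$ by $D_{(m,n)}(e_{a,b})=e^{-2\pi i[(\alpha m+\beta n)j+\alpha n\binom j2]}$ if $(a,b)=(m+jn,n)$ for some $j\in\mathbb Z$, and $0$ otherwise, where $\binom j2=j(j-1)/2$; they lie in $W^{-r}(\mathbb T^2)$ for all $r>1/2$. *)

(* Defs.v *)
From HB Require Import structures.
From mathcomp Require Export all_boot all_order all_algebra.
From mathcomp Require Export all_classical all_reals all_analysis.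
From mathcomp Require Export complex.

Set Implicit Arguments.
Unset Strict Implicit.
Unset Printing Implicit Defensive.

Export Order.TTheory GRing.Theory Num.Theory.
Export numFieldNormedType.Exports.

Local Open Scope classical_set_scope.
Local Open Scope ring_scope.
Local Open Scope complex_scope.

Section Torus.
Context {R : realType}.

(* Functions on T = R/Z and on T^2 = R^2/Z^2 are represented by their 1-periodic
   lifts; integrals and null sets are taken on the fundamental domains [0, 1)
   and [0, 1)^2, on which Lebesgue measure is the Haar probability measure. *)
Definition periodic1 (g : R -> R[i]) : Prop := forall x, g (x + 1) = g x.

Definition periodic2 (g : R * R -> R[i]) : Prop :=
  forall x y, g (x + 1, y) = g (x, y) /\ g (x, y + 1) = g (x, y).

Definition unit_interval : set R := `[0, 1[.

Definition unit_square : set (R * R) := unit_interval `*` unit_interval.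

(* measurableTypeR R is R with the Borel sigma-algebra on which the library
   defines lebesgue_measure. *)
Definition leb1 : {measure set (measurableTypeR R) -> \bar R} :=
  @lebesgue_measure R.

Definition leb2 :
    {measure set (measurableTypeR R * measurableTypeR R) -> \bar R} :=
  (@lebesgue_measure R \x @lebesgue_measure R)%E.

Definition cmeasurable d (T : measurableType d) (g : T -> R[i]) : Prop :=
  measurable_fun setT (fun z => complex.Re (g z)) /\
  measurable_fun setT (fun z => complex.Im (g z)).

Definition cmeasurable1 (g : R -> R[i]) : Prop :=
  @cmeasurable _ (measurableTypeR R) g.

Definition cmeasurable2 (g : R * R -> R[i]) : Prop :=
  @cmeasurable _ (measurableTypeR R * measurableTypeR R)%type g.

Definition torus_int (g : R * R -> R[i]) : R[i] :=
  (\int[leb2]_(z in unit_square) complex.Re (g z))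
  +i* (\int[leb2]_(z in unit_square) complex.Im (g z)).

(* Elements of L^2(T) and L^2(T^2), up to a.e. equality. *)
Definition L2T (g : R -> R[i]) : Prop :=
  [/\ periodic1 g, cmeasurable1 g &
      (\int[leb1]_(x in unit_interval) (Normc.normc (g x) ^+ 2)%:E < +oo)%E].

Definition L2T2 (g : R * R -> R[i]) : Prop :=
  [/\ periodic2 g, cmeasurable2 g &
      (\int[leb2]_(z in unit_square) (Normc.normc (g z) ^+ 2)%:E < +oo)%E].

Definition L2_inner (g h : R * R -> R[i]) : R[i] :=
  torus_int (fun z => g z * conjc (h z)).

Definition orth_pullback (g : R * R -> R[i]) : Prop :=
  L2T2 g /\ forall psi : R -> R[i], L2T psi -> L2_inner g (psi \o fst) = 0.

Definition fchar (a b : int) (z : R * R) : R[i] :=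
  let t := 2 * pi * (a%:~R * z.1 + b%:~R * z.2) in cos t +i* sin t.

Definition fcoef (g : R * R -> R[i]) (a b : int) : R[i] :=
  L2_inner g (fchar a b).

Definition sobolev_sqnorm (s : R) (g : R * R -> R[i]) : \bar R :=
  \esum_(k in [set: int * int])
    ((1 + k.1%:~R ^+ 2 + k.2%:~R ^+ 2) `^ s
      * Normc.normc (fcoef g k.1 k.2) ^+ 2)%:E.

(* For s < 0 these are only the elements of W^s represented by an L^2 function;
   for s >= 0 this is all of W^s. *)
Definition sobolev (s : R) (g : R * R -> R[i]) : Prop :=
  L2T2 g /\ (sobolev_sqnorm s g < +oo)%E.

Definition sobolev_norm (s : R) (g : R * R -> R[i]) : R :=
  Num.sqrt (fine (sobolev_sqnorm s g)).

(* D is in W^{-s} = (W^s)^*, for s >= 0: only the values of D on W^s matter, and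
   boundedness makes D compatible with a.e. equality. *)
Definition sobolev_dual (s : R) (D : (R * R -> R[i]) -> R[i]) : Prop :=
  (forall (c : R[i]) (g h : R * R -> R[i]), sobolev s g -> sobolev s h ->
      D (fun z => c * g z + h z) = c * D g + D h) /\
  (exists M : R, forall g : R * R -> R[i], sobolev s g ->
      Normc.normc (D g) <= M * sobolev_norm s g).

Definition partial (i : bool) (g : R * R -> R) : R * R -> R :=
  fun z => 'D_(if i then (0, 1) else (1, 0)) g z.

(* C^oo: all iterated partial derivatives are (Frechet) differentiable. *)
Definition smooth_real (g : R * R -> R) : Prop :=
  forall (l : seq bool) (z : R * R), differentiable (foldr partial g l) z.

Definition smooth_torus (g : R * R -> R[i]) : Prop :=
  [/\ periodic2 g, smooth_real (fun z => complex.Re (g z)) &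
      smooth_real (fun z => complex.Im (g z))].

Definition skew_shift (alpha beta : R) (z : R * R) : R * R :=
  (z.1 + alpha, z.2 + z.1 + beta).

Definition invariant_distribution (f : R * R -> R * R)
    (D : (R * R -> R[i]) -> R[i]) : Prop :=
  forall psi : R * R -> R[i], smooth_torus psi -> D (psi \o f) = D psi.

Definition measurable_transfer (f : R * R -> R * R)
    (phi u : R * R -> R[i]) : Prop :=
  [/\ periodic2 u, cmeasurable2 u &
      {ae leb2, forall z, unit_square z -> phi z = u (f z) - u z}].

End Torus.

(* Main.v *)
(* Write [c] for the Fourier coefficients of [phi]. The row of index [n <> 0] is
   split by the skew-shift into chains [a + j n], and the invariant distribution
   attached to a chain is the sum of its coefficients gauged by the phases
   [theta]. The main point is that a measurable solution forces these sums to
   vanish. Along the denominators of Dirichlet approximations of [alpha], a Weyl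
   sum estimate gives [E |S_N phi|^4 = O (N^2)] for the Birkhoff sums, while a
   nonzero gauged sum bounds [E |S_N phi|^2] below by a multiple of [N], by
   Bessel; but [S_N phi = u o f^N - u] is bounded in probability, and these three
   facts are incompatible. Once the sums vanish, the tails of a chain in either
   direction yield the same solution [w] of the cohomological equation on
   coefficients; using the tail that runs away from 0, Cauchy-Schwarz gives [w] in [W^t] for
   [t < s - 1]. By uniqueness of Fourier coefficients and ergodicity, [u] is the
   series with coefficients [w] up to a constant. For an invariant distribution
   [D], the identity [c = w o f - w] makes each row of [D phi] telescope to 0. *)

Require Import Defs.
From HB Require Import structures.
From mathcomp Require Import ring lra zify measurable_realfun.

Set Implicit Arguments.
Unset Strict Implicit.
Unset Printing Implicit Defensive.

Import Normc.

Local Open Scope classical_set_scope.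
Local Open Scope ring_scope.
Local Open Scope complex_scope.

(** * Complex numbers and Weyl sums *)

Section ComplexNumbers.
Context {R : realType}.
Implicit Types (z w : R[i]) (x y : R).

(** A merely measurable [u] has no Fourier coefficients, so the obstructions cannot be read off the
    equation and are reached through the distribution of the Birkhoff sums. By the Paley-Zygmund
    principle, second moments of order [N] and fourth moments [O(N^2)] force [|S_N phi|] to be of
    order [sqrt N] on a set of measure bounded below. The obstacle is the fourth moment for an
    arbitrary irrational [alpha]: differencing the quadratic phases leads to geometric sums at the
    points [h n alpha], which can be badly distributed. Taking [N] to be half a denominator [q] with
    [|q alpha - p| <= 1/q] makes [q] consecutive multiples of [alpha] a perturbation of those of
    [p/q], where orthogonality is exact and no logarithm is lost. One such [N] serves all characters
    at the cost of a factor [|n|], whence the condition that the sum of [|c(a,n)| (1 + |n|)]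
    converges. No small divisors appear: the row [n = 0] is empty by orthogonality to pullbacks, and
    on the other rows the solution is a tail of a chain. *)

Lemma ReD z w : complex.Re (z + w) = complex.Re z + complex.Re w.
Proof. by case: z w => [a b] [c d]. Qed.

Lemma ImD z w : complex.Im (z + w) = complex.Im z + complex.Im w.
Proof. by case: z w => [a b] [c d]. Qed.

Lemma ReN z : complex.Re (- z) = - complex.Re z. Proof. by case: z. Qed.

Lemma ImN z : complex.Im (- z) = - complex.Im z. Proof. by case: z. Qed.

Lemma ReB z w : complex.Re (z - w) = complex.Re z - complex.Re w.
Proof. by rewrite ReD ReN. Qed.

Lemma ImB z w : complex.Im (z - w) = complex.Im z - complex.Im w.
Proof. by rewrite ImD ImN. Qed.

Lemma ReM z w : complex.Re (z * w) =
  complex.Re z * complex.Re w - complex.Im z * complex.Im w.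
Proof. by case: z w => [a b] [c d]. Qed.

Lemma ImM z w : complex.Im (z * w) =
  complex.Re z * complex.Im w + complex.Im z * complex.Re w.
Proof. by case: z w => [a b] [c d]. Qed.

Lemma ReJ z : complex.Re (conjc z) = complex.Re z. Proof. by case: z. Qed.

Lemma ImJ z : complex.Im (conjc z) = - complex.Im z. Proof. by case: z. Qed.

Lemma conjcM z w : conjc (z * w) = conjc z * conjc w.
Proof. exact: rmorphM. Qed.

Lemma conjc_sum (I : Type) (r : seq I) (P : pred I) (F : I -> R[i]) :
  conjc (\sum_(i <- r | P i) F i) = \sum_(i <- r | P i) conjc (F i).
Proof. exact: rmorph_sum. Qed.

Lemma complex_ext z w : complex.Re z = complex.Re w ->
  complex.Im z = complex.Im w -> z = w.
Proof. by case: z w => [a b] [c d] /= -> ->. Qed.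

Lemma normc_ge0 z : 0 <= normc z.
Proof. by case: z => a b /=; rewrite sqrtr_ge0. Qed.

Lemma sqr_normcE z : normc z ^+ 2 = complex.Re z ^+ 2 + complex.Im z ^+ 2.
Proof. by case: z => a b /=; rewrite sqr_sqrtr// addr_ge0// sqr_ge0. Qed.

Lemma mulcJ z : z * conjc z = (normc z ^+ 2)%:C.
Proof.
by apply: complex_ext; rewrite ?ReM ?ImM ReJ ImJ /= ?sqr_normcE; ring.
Qed.

Lemma normcJ z : normc (conjc z) = normc z.
Proof. by case: z => a b /=; rewrite sqrrN. Qed.

Lemma normc_real x : normc x%:C = `|x|.
Proof. by rewrite /= expr0n/= addr0 sqrtr_sqr. Qed.

Lemma normc_distC z w : normc (z - w) = normc (w - z).
Proof. by rewrite -normcN opprB. Qed.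

Lemma le_normcB z w : normc (z - w) <= normc z + normc w.
Proof. by rewrite (le_trans (le_normcD _ _))// normcN. Qed.

Lemma le_normc_sub z w : normc z - normc w <= normc (z - w).
Proof. by rewrite lerBlDr (le_trans _ (le_normcD _ _))// subrK. Qed.

Lemma le_normc_sum (I : Type) (r : seq I) (P : pred I) (F : I -> R[i]) :
  normc (\sum_(i <- r | P i) F i) <= \sum_(i <- r | P i) normc (F i).
Proof.
apply: (big_rec2 (fun a b => normc a <= b)) => [|i b a _ h].
  by rewrite normc0.
rewrite (le_trans (le_normcD _ _))//.
by rewrite lerD2l.
Qed.

Lemma normr_Re_le z : `|complex.Re z| <= normc z.
Proof.
by rewrite -[leLHS]sqrtr_sqr; case: z => a b /=; apply: ler_wsqrtr; rewrite lerDl sqr_ge0.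
Qed.

Lemma normr_Im_le z : `|complex.Im z| <= normc z.
Proof.
by rewrite -[leLHS]sqrtr_sqr; case: z => a b /=; apply: ler_wsqrtr; rewrite lerDr sqr_ge0.
Qed.

Lemma normc_le_ReIm z : normc z <= `|complex.Re z| + `|complex.Im z|.
Proof.
rewrite -(@ler_pXn2r _ 2)// ?nnegrE ?normc_ge0 ?addr_ge0// sqr_normcE.
rewrite sqrrD !real_normK ?num_real// -addrA lerD2l lerDr.
by rewrite mulrn_wge0// mulr_ge0.
Qed.

Lemma normc_eq0 z : (normc z == 0) = (z == 0).
Proof. by apply/eqP/eqP => [/eq0_normc//|->]; rewrite normc0. Qed.

Lemma normc_gt0 z : z != 0 -> 0 < normc z.
Proof. by rewrite lt0r normc_ge0 andbT normc_eq0. Qed.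

Lemma normc_eq0_small z : (forall e, 0 < e -> normc z <= e) -> z = 0.
Proof.
move=> h; apply: eq0_normc; apply/eqP; rewrite eq_le normc_ge0 andbT.
by apply/ler_addgt0Pl => e e0; rewrite addr0 h.
Qed.

End ComplexNumbers.

Section Exponential.
Context {R : realType}.
Implicit Types x y : R.

Definition ex x : R[i] := cos (2 * pi * x) +i* sin (2 * pi * x).

Lemma exD x y : ex (x + y) = ex x * ex y.
Proof.
apply: complex_ext; rewrite ?ReM ?ImM /= mulrDr ?cosD ?sinD //.
by rewrite addrC.
Qed.

Lemma ex0 : ex 0 = 1.
Proof. by rewrite /ex mulr0 cos0 sin0. Qed.

Lemma exN x : ex (- x) = conjc (ex x).
Proof. by rewrite /ex mulrN cosN sinN. Qed.

Lemma normc_ex x : normc (ex x) = 1.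
Proof. by rewrite /= cos2Dsin2 sqrtr1. Qed.

Lemma exB x y : ex (x - y) = ex x * conjc (ex y).
Proof. by rewrite exD exN. Qed.

Lemma exMn x n : ex (n%:R * x) = ex x ^+ n.
Proof.
elim: n => [|n IH]; first by rewrite mul0r ex0 expr0.
by rewrite -addn1 natrD mulrDl mul1r exD IH exprD expr1.
Qed.

Lemma ex_nat n : ex n%:R = 1.
Proof.
rewrite -[n%:R]mulr1 exMn /ex mulr1 mulrC mulr_natr cos2pi sin2pi.
by rewrite (_ : 1 +i* 0 = 1) ?expr1n.
Qed.

Lemma ex_int (n : int) : ex n%:~R = 1.
Proof.
case: n => n; first exact: ex_nat.
by rewrite NegzE mulrNz exN -pmulrn ex_nat conjc1.
Qed.

Lemma exDint x (n : int) : ex (x + n%:~R) = ex x.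
Proof. by rewrite exD ex_int mulr1. Qed.

Lemma normc_sub1_ex x : normc (ex x - 1) = 2 * `|sin (pi * x)|.
Proof.
apply: (@pexpIrn _ 2) => //; rewrite ?nnegrE ?normc_ge0 ?mulr_ge0//.
cbv beta; rewrite exprMn real_normK ?num_real//.
rewrite sqr_normcE ReB ImB /= subr0 (_ : 2 * pi * x = (pi * x) *+ 2); last by ring.
rewrite cos_mulr2n sin_mulr2n.
have := sin2cos2 (pi * x); set s := sin _; set c := cos _ => h.
have -> : c ^+ 2 *+ 2 - 1 - 1 = - (2 * s ^+ 2) by rewrite h; ring.
have -> : 2 ^+ 2 * s ^+ 2 = 4 * s ^+ 2 * (c ^+ 2 + s ^+ 2).
  by rewrite h; ring.
ring.
Qed.

Lemma ex_eq1 x : ex x = 1 -> exists n : int, x = n%:~R.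
Proof.
move=> ex1; exists (Num.floor x); apply/eqP; rewrite eq_sym -subr_eq0.
set y := _ - x; have hy : ex (- y) = 1.
  by rewrite opprB -mulrNz exDint.
have /andP[] := floor_itv x; rewrite intrD1 => h1 h2.
have y0 : 0 <= - y by rewrite opprB subr_ge0.
have y1 : - y < 1 by rewrite opprB; lra.
have : normc (ex (- y) - 1) = 0 by rewrite hy subrr normc0.
rewrite normc_sub1_ex => /eqP; rewrite mulf_eq0 pnatr_eq0/= normr_eq0.
apply: contraLR => yn0; rewrite gt_eqF// sin_gt0_pi//.
have := pi_gt0 R => pi0.
have y0' : 0 < - y by rewrite lt0r oppr_eq0 yn0.
by rewrite mulr_gt0//= -[ltRHS]mulr1 ltr_pM2l.
Qed.

Lemma normr_sin_le x : `|sin x| <= `|x|.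
Proof.
wlog x0 : x / 0 < x.
  move=> h; have [xgt0|xlt0|<-] := ltgtP 0 x; last by rewrite sin0.
    exact: h.
  by rewrite -(normrN (sin x)) -(normrN x) -sinN h// oppr_gt0.
have d (y : R) : is_derive y 1 (@sin R) (cos y) by exact: is_derive_sin.
have [|c _] := @MVT R sin cos 0 x x0 (fun y _ => d y).
  by apply: continuous_subspaceT => y; exact: continuous_sin.
rewrite sin0 !subr0 => ->; rewrite normrM -[leRHS]mul1r.
by rewrite ler_wpM2r// cos_max.
Qed.

Lemma normc_sub1_ex_le x : normc (ex x - 1) <= 2 * pi * `|x|.
Proof.
rewrite normc_sub1_ex -mulrA ler_pM2l//.
by rewrite (le_trans (normr_sin_le _))// normrM (ger0_norm (pi_ge0 R)).
Qed.

End Exponential.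

Section FiniteSums.
Context {R : realType}.

Lemma sum_nat_mul (V : zmodType) (F : nat -> V) (m q : nat) :
  \sum_(k < m * q) F k = \sum_(b < m) \sum_(i < q) F (b * q + i)%N.
Proof.
elim: m => [|m IH]; first by rewrite mul0n !big_ord0.
rewrite big_ord_recr/= -IH -(big_mkord xpredT F) -(big_mkord xpredT F).
rewrite (@big_cat_nat _ _ _ (m * q))//= ?leq_mul//; congr (_ + _).
rewrite mulSn -{1}(add0n (m * q)%N) big_addn addnK big_mkord.
by apply: eq_bigr => i _; rewrite addnC.
Qed.

Lemma ler_sum_widen (F : nat -> R) (m n : nat) : (m <= n)%N ->
  (forall k, 0 <= F k) -> \sum_(k < m) F k <= \sum_(k < n) F k.
Proof.
move=> mn F0; rewrite -(big_mkord xpredT F) -(big_mkord xpredT F).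
by rewrite [leRHS](@big_cat_nat _ _ _ m)//= lerDl sumr_ge0.
Qed.

Lemma ler_sum_shift (F : nat -> R) (L N : nat) :
  (forall k, 0 <= F k) -> \sum_(k < N) F (L + k)%N <= \sum_(k < L + N) F k.
Proof. by move=> F0; rewrite big_split_ord/= lerDr sumr_ge0. Qed.

Lemma ler_sum_dilate (F : nat -> R) (M N : nat) : (0 < M)%N ->
  (forall k, 0 <= F k) -> \sum_(h < N) F (M * h)%N <= \sum_(k < M * N) F k.
Proof.
move=> M0 F0; rewrite mulnC sum_nat_mul; apply: ler_sum => h _.
case: M M0 => // M _; rewrite big_ord_recl/= addn0 mulnC lerDl sumr_ge0//.
Qed.

(** Cauchy-Schwarz against the constant 1, from the nonnegativity of the double sum of
    [(x i - x j) ^+ 2]. *)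
Lemma sqr_sum_le (n : nat) (x : 'I_n -> R) :
  (\sum_i x i) ^+ 2 <= n%:R * \sum_i x i ^+ 2.
Proof.
have : 0 <= \sum_i \sum_j (x i - x j) ^+ 2.
  by apply: sumr_ge0 => i _; apply: sumr_ge0 => j _; exact: sqr_ge0.
have -> : \sum_i \sum_j (x i - x j) ^+ 2 =
    2 * (n%:R * \sum_i x i ^+ 2 - (\sum_i x i) ^+ 2).
  transitivity (\sum_i (n%:R * x i ^+ 2 + \sum_j x j ^+ 2
      - 2 * (x i * \sum_j x j))).
    apply: eq_bigr => i _; rewrite 2!mulr_sumr -[n in n%:R]card_ord -sumr_const.
    rewrite mulr_suml -big_split -sumrB; apply: eq_bigr => j _ /=; ring.
  rewrite sumrB big_split/= -!mulr_sumr -mulr_suml sumr_const card_ord.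
  by rewrite -[X in _ + X - _]mulr_natl; ring.
lra.
Qed.

Lemma sqrD_le (x y : R) : (x + y) ^+ 2 <= 2 * (x ^+ 2 + y ^+ 2).
Proof. by have := sqr_ge0 (x - y); rewrite sqrrB sqrrD; lra. Qed.

End FiniteSums.

(** * Quadratic means of Dirichlet kernels along arithmetic progressions *)

Section DirichletKernel.
Context {R : realType}.
Implicit Types (y d : R).

Definition Dk (L : nat) y : R[i] := \sum_(l < L) ex (l%:R * y).

Lemma DkD L L' y : Dk (L + L') y = Dk L y + ex (L%:R * y) * Dk L' y.
Proof.
rewrite /Dk big_split_ord/=; congr (_ + _); rewrite big_distrr/=.
by apply: eq_bigr => l _; rewrite natrD mulrDl exD.
Qed.

Lemma DkS L y : Dk L.+1 y = Dk L y + ex (L%:R * y).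
Proof. by rewrite /Dk big_ord_recr. Qed.

Lemma normc_DkN L y : normc (Dk L (- y)) = normc (Dk L y).
Proof.
rewrite -(normcJ (Dk L y)) /Dk rmorph_sum; congr normc.
by apply: eq_bigr => l _; rewrite mulrN exN.
Qed.

(** Up to the phase [ex (L'%:R * y)], [Dk L y] is the difference of the kernels of lengths [L' + L]
    and [L']. *)
Lemma sqr_Dk_le L L' y : normc (Dk L y) ^+ 2 <=
  2 * (normc (Dk (L' + L) y) ^+ 2 + normc (Dk L' y) ^+ 2).
Proof.
apply: le_trans (sqrD_le _ _).
rewrite ler_pXn2r ?nnegrE ?addr_ge0 ?normc_ge0//.
rewrite (le_trans _ (le_normcB _ _))// DkD addrC addKr.
by rewrite normcM normc_ex mul1r.
Qed.

(** The previous inequality is averaged over the shifts [j < N]. A kernel of one length is traded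
    for a mean over all lengths below [2 * N]; in the Weyl sum below the length depends on the
    summation index, and this decouples the two. *)
Lemma Dk_average L N y : (L <= N)%N ->
  N%:R * normc (Dk L y) ^+ 2 <= 4 * \sum_(j < 2 * N) normc (Dk j y) ^+ 2.
Proof.
move=> LN; pose F j := normc (Dk j y) ^+ 2; have F0 j : 0 <= F j by exact: sqr_ge0.
have -> : N%:R * normc (Dk L y) ^+ 2 = \sum_(j < N) F L.
  by rewrite sumr_const card_ord mulr_natl.
have h1 : \sum_(j < N) F (L + j)%N <= \sum_(j < 2 * N) F j.
  by apply: le_trans (ler_sum_shift _ _ F0) _; apply: ler_sum_widen => //; lia.
have h2 : \sum_(j < N) F j <= \sum_(j < 2 * N) F j.
  by apply: ler_sum_widen => //; lia.
suff : \sum_(j < N) F L <= 2 * (\sum_(j < N) F (L + j)%N + \sum_(j < N) F j).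
  by rewrite -/(F _); move: h1 h2; lra.
rewrite -big_split mulr_sumr/=; apply: ler_sum => j _.
by rewrite addnC; exact: sqr_Dk_le.
Qed.

Lemma sum_unity_root (z : R[i]) q : z ^+ q = 1 -> z != 1 -> \sum_(i < q) z ^+ i = 0.
Proof.
move=> zq z1; apply: (@mulfI _ (z - 1)); first by rewrite subr_eq0.
by rewrite mulr0 -subrX1 zq subrr.
Qed.

(** Parseval on Z/q: for [l, l' < j <= q] the difference [l - l'] is smaller than [q] in absolute
    value, so by coprimality [(l - l') p / q] is an integer only on the diagonal, and the
    off-diagonal sums of roots of unity vanish. *)
Lemma Dk_parseval (x : R) (p : int) (q j : nat) : (0 < q)%N ->
  coprimez p q -> (j <= q)%N ->
  \sum_(i < q) normc (Dk j (x + i%:R * (p%:~R / q%:R))) ^+ 2 = q%:R * j%:R.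
Proof.
move=> q0 pq jq; have q0' : q%:R != 0 :> R by rewrite pnatr_eq0 -lt0n.
apply: (@complexI R); rewrite rmorph_sum/=.
under eq_bigr => i _.
  rewrite -mulcJ /Dk rmorph_sum big_distrlr/=; over.
rewrite exchange_big/=.
under eq_bigr => l _.
  rewrite exchange_big/=.
  under eq_bigr => l' _.
    under eq_bigr => i _.
      rewrite -exB (_ : _ - _ = (l%:R - l'%:R) * x +
        i%:R * ((l%:R - l'%:R) * (p%:~R / q%:R))); last by ring.
      rewrite exD exMn; over.
    rewrite -mulr_sumr.
    rewrite (_ : _ * _ = if l == l' then q%:R else 0); first over.
    case: eqVneq => [->|ll'].
      rewrite subrr !mul0r ex0 mul1r.
      under eq_bigr do rewrite expr1n.
      by rewrite sumr_const card_ord.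
    rewrite sum_unity_root ?mulr0//.
      rewrite -exMn mulrC -mulrA mulfVK//.
      rewrite (_ : _ * _ = ((l%:Z - l'%:Z) * p)%:~R) ?ex_int//.
      by rewrite rmorphM rmorphB.
    apply/negP => /eqP/ex_eq1[n]; move/(congr1 ( *%R^~ q%:R)).
    rewrite mulrA mulfVK// => h.
    have {}h : (l%:Z - l'%:Z) * p = n * q%:Z.
      by apply: (@intr_inj R); rewrite !rmorphM rmorphB.
    have /dvdzP[m hm] : (q%:Z %| l%:Z - l'%:Z)%Z.
      by rewrite -(@Gauss_dvdzl _ _ p) 1?coprimez_sym// h dvdz_mull.
    have := ltn_ord l; have := ltn_ord l'; move/eqP: ll' => ll'.
    have : l <> l' :> nat by move=> e; apply: ll'; exact: val_inj.
    by have [m0|m0|m0] := ltrgtP m 0; nia.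
  over.
rewrite (eq_bigr (fun=> q%:R)) => [|l _]; last first.
  by under eq_bigr do rewrite eq_sym; rewrite -big_mkcond big_pred1_eq.
by rewrite sumr_const card_ord rmorphM/= !rmorph_nat mulr_natr.
Qed.

(** Summation by parts: the displaced kernel is controlled by the kernels at [y] of all lengths up
    to [L], with coefficients that are small with [d]. *)
Lemma Dk_abel L y d : Dk L (y + d) = ex (L%:R * d) * Dk L y -
  \sum_(l < L) (ex (l.+1%:R * d) - ex (l%:R * d)) * Dk l.+1 y.
Proof.
elim: L => [|L IH]; first by rewrite /Dk !big_ord0 mulr0 subr0.
by rewrite DkS IH big_ord_recr/= DkS mulrDr exD; ring.
Qed.

Lemma sqr_Dk_perturb L y d : normc (Dk L (y + d)) ^+ 2 <=
  2 * (normc (Dk L y) ^+ 2 +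
       (2 * pi * `|d|) ^+ 2 * (L%:R * \sum_(l < L) normc (Dk l.+1 y) ^+ 2)).
Proof.
pose S := 2 * pi * `|d| * \sum_(l < L) normc (Dk l.+1 y).
have d0 : 0 <= 2 * pi * `|d| by rewrite !mulr_ge0// pi_ge0.
have S0 : 0 <= S by rewrite mulr_ge0// sumr_ge0// => l _; exact: normc_ge0.
have h : normc (Dk L (y + d)) <= normc (Dk L y) + S.
  rewrite Dk_abel (le_trans (le_normcB _ _))// normcM normc_ex mul1r lerD2l.
  rewrite (le_trans (le_normc_sum _ _ _))// /S mulr_sumr; apply: ler_sum => l _.
  rewrite normcM ler_wpM2r ?normc_ge0// -natr1 mulrDl mul1r exD.
  rewrite -[X in _ - X]mulr1 -mulrBr normcM normc_ex mul1r.
  exact: normc_sub1_ex_le.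
apply: (@le_trans _ _ ((normc (Dk L y) + S) ^+ 2)).
  by rewrite ler_pXn2r ?nnegrE ?addr_ge0 ?normc_ge0.
apply: le_trans (sqrD_le _ _) _; rewrite ler_pM2l// lerD2l /S exprMn.
by rewrite ler_wpM2l ?sqr_ge0// sqr_sum_le.
Qed.

(** In [Dk_block] the exact means contribute 2 and the perturbation [2 * (2 pi) ^ 2 = 8 pi ^ 2],
    both times [q ^ 2]. *)
Definition Kd : R := 2 + 8 * pi ^+ 2.

Lemma Kd_ge0 : 0 <= Kd.
Proof. by rewrite addr_ge0// mulr_ge0// sqr_ge0. Qed.

(** Since [al] is within [1 / q ^ 2] of [p / q], the [i]-th point is within [1 / q] of
    [x + i p / q]. A displacement of that size only costs a constant, because kernels of length at
    most [q] vary slowly at scale [1 / q]. *)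
Lemma Dk_block (al x : R) (p : int) (q j : nat) : (0 < q)%N ->
  coprimez p q -> (j <= q)%N -> `|q%:R * al - p%:~R| <= q%:R^-1 ->
  \sum_(i < q) normc (Dk j (x + i%:R * al)) ^+ 2 <= Kd * q%:R ^+ 2.
Proof.
move=> q0 pq jq hal; have q0' : 0 < q%:R :> R by rewrite ltr0n.
have jq' : j%:R <= q%:R :> R by rewrite ler_nat.
pose y (i : nat) : R := x + i%:R * (p%:~R / q%:R).
pose d (i : nat) : R := i%:R * (al - p%:~R / q%:R).
have hd (i : 'I_q) : (2 * pi * `|d i|) ^+ 2 <= 4 * pi ^+ 2 / q%:R ^+ 2.
  have : `|d i| <= q%:R^-1.
    rewrite normrM (_ : al - _ = (q%:R * al - p%:~R) / q%:R); last first.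
      by rewrite mulrBl mulrAC mulfV ?mul1r// gt_eqF.
    rewrite normrM normfV (ger0_norm (ler0n _ i)) (ger0_norm (ler0n _ q)).
    apply: (@le_trans _ _ (q%:R * (q%:R^-1 / q%:R))).
      rewrite ler_pM ?mulr_ge0 ?invr_ge0 ?ler0n//; first by rewrite ler_nat ltnW.
      by rewrite ler_wpM2r ?invr_ge0.
    by rewrite mulrA mulfV ?mul1r// gt_eqF.
  move=> hdi; rewrite !exprMn -exprVn (_ : 2 ^+ 2 = 4); last by ring.
  rewrite ler_wpM2l ?mulr_ge0 ?pi_ge0 ?sqr_ge0//.
  by rewrite ler_pXn2r ?nnegrE ?invr_ge0 ?ler0n.
have -> : \sum_(i < q) normc (Dk j (x + i%:R * al)) ^+ 2 =
    \sum_(i < q) normc (Dk j (y i + d i)) ^+ 2.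
  apply: eq_bigr => i _; rewrite (_ : y i + d i = x + i%:R * al)//.
  by rewrite /y /d; ring.
pose T (i : 'I_q) := normc (Dk j (y i)) ^+ 2 +
  4 * pi ^+ 2 / q%:R ^+ 2 * (j%:R * \sum_(l < j) normc (Dk l.+1 (y i)) ^+ 2).
apply: (@le_trans _ _ (\sum_(i < q) 2 * T i)).
  apply: ler_sum => i _; apply: le_trans (sqr_Dk_perturb _ _ _) _.
  rewrite ler_pM2l// lerD2l ler_wpM2r// mulr_ge0// sumr_ge0// => l _.
  exact: sqr_ge0.
rewrite -mulr_sumr big_split/= Dk_parseval// -!mulr_sumr exchange_big/=.
under eq_bigr => l _ do rewrite Dk_parseval// ?(leq_trans _ jq)//.
have hs : \sum_(l < j) q%:R * l.+1%:R <= q%:R ^+ 3 :> R.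
  apply: (@le_trans _ _ (\sum_(l < j) q%:R ^+ 2)).
    apply: ler_sum => l _; rewrite expr2 ler_pM2l// ler_nat.
    by rewrite (leq_trans _ jq).
  by rewrite sumr_const card_ord -[_ *+ j]mulr_natr [leRHS]exprSr ler_wpM2l// sqr_ge0.
have hs2 : j%:R * (\sum_(l < j) q%:R * l.+1%:R) <= q%:R ^+ 4 :> R.
  by rewrite exprS ler_pM// sumr_ge0// => l _; rewrite mulr_ge0.
have hs3 : 4 * pi ^+ 2 / q%:R ^+ 2 * (j%:R * \sum_(l < j) q%:R * l.+1%:R) <=
    4 * pi ^+ 2 * q%:R ^+ 2 :> R.
  rewrite -(mulrA _ _ (_ * _)) ler_wpM2l// ?mulr_ge0 ?pi_ge0 ?sqr_ge0//.
  by rewrite ler_pdivrMl ?exprn_gt0// -exprD.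
have hs4 : q%:R * j%:R <= q%:R ^+ 2 :> R by rewrite expr2 ler_pM2l.
by rewrite /Kd mulrDl; move: hs3 hs4; lra.
Qed.

(** The condition [2 * N <= q] keeps all lengths produced by [Dk_average] below [q]. For a fixed
    length the points [M * h] lie among the first [M * q] integers, which form [M] blocks of length
    [q]: this is the origin of the factor [M]. *)
Lemma Weyl_sum_bound (al : R) (p : int) (q N M : nat) : (0 < M)%N -> (0 < N)%N ->
  (2 * N <= q)%N -> coprimez p q -> `|q%:R * al - p%:~R| <= q%:R^-1 ->
  \sum_(h < N) normc (Dk (N - h) (M%:R * h%:R * al)) ^+ 2
    <= 8 * M%:R * Kd * q%:R ^+ 2.
Proof.
move=> M0 N0 Nq pq hal; have q0 : (0 < q)%N by lia.
have N0' : 0 < N%:R :> R by rewrite ltr0n.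
have col (j : nat) : (j <= q)%N ->
    \sum_(h < N) normc (Dk j (M%:R * h%:R * al)) ^+ 2 <= M%:R * (Kd * q%:R ^+ 2).
  move=> jq; pose F (k : nat) := normc (Dk j (k%:R * al)) ^+ 2.
  have F0 k : 0 <= F k by exact: sqr_ge0.
  under eq_bigr do rewrite -natrM -/(F _).
  apply: le_trans (ler_sum_dilate _ M0 F0) _.
  apply: le_trans (@ler_sum_widen _ F _ (M * q) _ F0) _; first by rewrite leq_mul2l; lia.
  have -> : M%:R * (Kd * q%:R ^+ 2) = \sum_(b < M) (Kd * q%:R ^+ 2) :> R.
    by rewrite sumr_const card_ord mulr_natl.
  rewrite sum_nat_mul; apply: ler_sum => b _.
  under eq_bigr do rewrite /F natrD mulrDl.
  exact: Dk_block hal.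
rewrite -(ler_pM2l N0') mulr_sumr.
apply: (@le_trans _ _ (\sum_(h < N)
    4 * \sum_(j < 2 * N) normc (Dk j (M%:R * h%:R * al)) ^+ 2)).
  by apply: ler_sum => h _; apply: Dk_average; exact: leq_subr.
rewrite -mulr_sumr exchange_big/=.
apply: (@le_trans _ _ (4 * \sum_(j < 2 * N) M%:R * (Kd * q%:R ^+ 2))).
  rewrite ler_pM2l//; apply: ler_sum => j _; apply: col.
  by rewrite ltnW// (leq_trans _ Nq).
rewrite sumr_const card_ord -[_ *+ (2 * N)]mulr_natl natrM le_eqVlt.
by apply/orP; left; apply/eqP; ring.
Qed.

End DirichletKernel.

(** * Rational approximation of an irrational number *)

Section DirichletApproximation.
Context {R : realType}.
Implicit Types al : R.

Lemma irrational_natmul al (q : nat) (p : int) : irrational al -> (0 < q)%N ->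
  q%:R * al <> p%:~R.
Proof.
move=> ial q0 h; apply: ial.
have q0' : q%:R != 0 :> R by rewrite pnatr_eq0 -lt0n.
exists (p%:Q / q%:Q) => //; rewrite fmorph_div/= !ratr_int.
by apply: (mulfI q0'); rewrite h mulrC mulfVK.
Qed.

Lemma int_distance_gt0 (x : R) : (forall p : int, x <> p%:~R) ->
  exists2 d : R, 0 < d & forall p : int, d <= `|x - p%:~R|.
Proof.
move=> hx; have /andP[h1 h2] := floor_itv x; rewrite intrD1 in h2.
set n := Num.floor x in h1 h2; have {}h1 : n%:~R < x.
  by rewrite lt_neqAle h1 andbT; apply/eqP => e; apply: (hx n).
exists (Num.min (x - n%:~R) (n%:~R + 1 - x)).
  by rewrite lt_min !subr_gt0 h1 h2.
move=> p; rewrite ge_min; have [pn|np] := leP p n.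
  by apply/orP; left; rewrite (le_trans _ (ler_norm _))// lerD2l lerN2 ler_int.
apply/orP; right; rewrite distrC (le_trans _ (ler_norm _))// lerD2r.
by rewrite -intrD1 ler_int; lia.
Qed.

(** Only finitely many [q] are concerned, so the minimum of the individual distances works; it
    forces good approximations to have large denominators. *)
Lemma int_distance_bounded al (B : nat) : irrational al ->
  exists2 d : R, 0 < d & forall (q : nat) (p : int), (0 < q < B)%N ->
    d <= `|q%:R * al - p%:~R|.
Proof.
move=> ial; elim: B => [|B [d d0 hd]]; first by exists 1 => // q p; lia.
have [->|B0] := posnP B; first by exists 1 => // q p; lia.
have [d' d'0 hd'] := int_distance_gt0 (fun p => irrational_natmul (p := p) ial B0).
exists (Num.min d d') => [|q p]; first by rewrite lt_min d0.
case/andP=> q0; rewrite ltnS leq_eqVlt => /orP[/eqP->|qB].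
  by rewrite ge_min hd' orbT.
by rewrite ge_min hd ?q0.
Qed.

(** Two of the [Q + 1] fractional parts of [k al], [k <= Q], fall into the same of [Q] intervals of
    length [1 / Q]. *)
Lemma Dirichlet_pigeonhole al (Q : nat) : (0 < Q)%N ->
  exists q (p : int), [/\ (0 < q <= Q)%N & `|q%:R * al - p%:~R| < Q%:R^-1].
Proof.
move=> Q0; have Q0' : 0 < Q%:R :> R by rewrite ltr0n.
pose fr (k : nat) : R := k%:R * al - (Num.floor (k%:R * al))%:~R.
have fr0 k : 0 <= fr k by rewrite subr_ge0 ge_floor.
have fr1 k : fr k < 1.
  by rewrite ltrBlDl -[1]/(1%:~R) -intrD; have /andP[] := floor_itv (k%:R * al).
have tr0 k : Q%:R * fr k \is Num.nneg by rewrite nnegrE mulr_ge0.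
have trQ (k : nat) : (Num.truncn (Q%:R * fr k) < Q)%N.
  by rewrite truncn_lt_nat ?mulr_ge0// -[ltRHS]mulr1 ltr_pM2l.
pose g (k : 'I_Q.+1) : 'I_Q := Ordinal (trQ k).
have /injectivePn[k [k' kk' gkk']] : ~~ injectiveb g.
  apply/negP; by move=> /injectiveP/leq_card; rewrite !card_ord ltnn.
wlog kk : k k' kk' gkk' / (k < k')%N.
  move=> h; have [k'k|k'k|e] := ltngtP k k'.
  - exact: (h k k').
  - by apply: (h k' k) => //; rewrite eq_sym.
  - by move/eqP: kk' => []; exact: val_inj.
have {}gkk' : Num.truncn (Q%:R * fr k) = Num.truncn (Q%:R * fr k').
  by move/(congr1 val): gkk'.
exists (k' - k)%N, (Num.floor (k'%:R * al) - Num.floor (k%:R * al)).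
split; first by have := ltn_ord k'; lia.
have /andP[a1 a2] := truncn_itv (tr0 k).
have /andP[b1 b2] := truncn_itv (tr0 k').
rewrite natrB 1?ltnW// (_ : _ - _ = fr k' - fr k); last first.
  by rewrite /fr intrB; ring.
rewrite -(ltr_pM2l Q0') mulfV ?gt_eqF// -[X in X * _]gtr0_norm// -normrM mulrBr.
rewrite -gkk' in b1 b2; rewrite -natr1 in a2 b2.
by rewrite ltr_norml; apply/andP; split; lra.
Qed.

Lemma Dirichlet_approximation al (B : nat) : irrational al ->
  exists q (p : int), [/\ (B <= q)%N, (0 < q)%N, coprimez p q &
    `|q%:R * al - p%:~R| <= q%:R^-1].
Proof.
move=> ial; have [d d0 hd] := int_distance_bounded B ial.
pose Q := (Num.truncn d^-1).+1; have Q0 : (0 < Q)%N by [].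
have Qd : Q%:R^-1 < d.
  rewrite -[ltRHS]invrK ltf_pV2 ?posrE ?invr_gt0//.
  have d1 : 0 <= d^-1 by rewrite invr_ge0 ltW.
  by have /andP[] := truncn_itv d1.
have [q [p [/andP[q0 qQ] hq]]] := Dirichlet_pigeonhole al Q0.
(* The pair is reduced to lowest terms. Division by [g] shrinks the error by [g] while the
   admissible error [1 / q'] grows, and the lower bound [d] still forces [B <= q']. *)
pose g := gcdn `|p| q; have g0 : (0 < g)%N by rewrite gcdn_gt0 q0 orbT.
have g0' : 1 <= g%:R :> R by rewrite ler1n.
have [q' Eq] : exists q', q = (q' * g)%N by apply/dvdnP; exact: dvdn_gcdr.
have [p' Ep] : exists p' : int, p = p' * g%:Z.
  by apply/dvdzP; rewrite dvdzE; exact: dvdn_gcdl.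
have q'0 : (0 < q')%N by move: q0; rewrite Eq muln_gt0 => /andP[].
have hq' : g%:R * `|q'%:R * al - p'%:~R| < Q%:R^-1 :> R.
  rewrite -[g%:R]gtr0_norm ?(lt_le_trans _ g0')// -normrM.
  by move: hq; rewrite Eq Ep natrM rmorphM/= -pmulrn; congr (`|_| < _); ring.
exists q', p'; split => //.
- rewrite leqNgt; apply/negP => q'B; have := hd q' p'; rewrite q'0 q'B => /(_ isT).
  have := normr_ge0 (q'%:R * al - p'%:~R); nra.
- have := coprimez_sym; rewrite /coprimez /gcdz => _.
  suff : (g * gcdn `|p'| q')%N = (g * 1)%N.
    by move/eqP; rewrite eqn_pmul2l// => /eqP ->.
  by rewrite muln1 muln_gcdr {3}/g Eq Ep abszM /= mulnC (mulnC q').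
- have : Q%:R^-1 <= (g%:R * q'%:R)^-1 :> R.
    rewrite lef_pV2 ?posrE ?mulr_gt0 ?ltr0n// -natrM ler_nat.
    by rewrite mulnC -Eq.
  rewrite invfM => h.
  rewrite -(ler_pM2l (lt_le_trans ltr01 g0')) (le_trans (ltW hq'))//.
  rewrite (le_trans h)// ler_wpM2r ?invr_ge0// (le_trans _ g0')//.
  by rewrite invf_le1 ?(lt_le_trans _ g0').
Qed.

End DirichletApproximation.

(** * Integration on the torus *)

Section TorusIntegral.
Context {R : realType}.

Local Notation T2 := (measurableTypeR R * measurableTypeR R)%type.

Definition rmeasurable (h : R * R -> R) : Prop :=
  measurable_fun [set: T2] (h : T2 -> R).

Definition rint (h : R * R -> R) : Prop :=
  (@leb2 R).-integrable unit_square (EFin \o h).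

Definition E (h : R * R -> R) : R := \int[leb2]_(z in unit_square) h z.

Lemma measurable_unit_square : measurable (unit_square : set T2).
Proof. by apply: measurableX; exact: measurable_itv. Qed.
Hint Resolve measurable_unit_square : core.

Lemma leb2_unit_square : leb2 (@unit_square R) = 1%E.
Proof.
rewrite /leb2 /unit_square.
rewrite [LHS]product_measure1E; try exact: measurable_itv.
have h : lebesgue_measure (@unit_interval R) = 1%E.
  by rewrite /unit_interval lebesgue_measure_itv/= lte_fin ltr01 oppr0 adde0.
by rewrite -[RHS]mule1; congr (_ * _)%E; exact: h.
Qed.

(** Exceptional sets are null within the fundamental square; for periodic functions this is the
    notion on the torus. *)
Definition aet (P : R * R -> Prop) : Prop :=
  {ae leb2, forall z, unit_square z -> P z}.

Lemma leb2_ae_filter : Filter (nbhs (almost_everywhere (@leb2 R))).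
Proof. exact: ae_filter_ringOfSetsType. Qed.

Lemma aetS (P Q : R * R -> Prop) : (forall z, P z -> Q z) -> aet P -> aet Q.
Proof.
by move=> PQ; apply: (@filterS _ _ leb2_ae_filter) => z h zS; exact/PQ/h.
Qed.

Lemma aetI (P Q : R * R -> Prop) : aet P -> aet Q -> aet (fun z => P z /\ Q z).
Proof.
move=> aP aQ.
apply: (@filterS _ _ leb2_ae_filter) (@filterI _ _ leb2_ae_filter _ _ aP aQ).
by move=> z [h k] zS; split; [exact: h|exact: k].
Qed.

Lemma rint_bounded (h : R * R -> R) (M : R) : rmeasurable h ->
  (forall z, `|h z| <= M) -> rint h.
Proof.
move=> mh hM; apply: measurable_bounded_integrable => //.
- by rewrite leb2_unit_square ltry.
- by apply: measurable_funS mh.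
- exists M; split; first by rewrite num_real.
  by move=> x Mx z _ /=; rewrite (le_trans (hM z))// ltW.
Qed.

Lemma rint_cst (c : R) : rint (fun=> c).
Proof. by apply: (@rint_bounded _ `|c|) => //; exact: measurable_cst. Qed.

Lemma eq_rint h k : (forall z, unit_square z -> h z = k z) -> rint h -> rint k.
Proof.
move=> hk; apply: eq_integrable => // z /set_mem zS.
by rewrite /= hk.
Qed.

Lemma rintD h k : rint h -> rint k -> rint (fun z => h z + k z).
Proof.
move=> ih ik; have := integrableD measurable_unit_square ih ik.
by apply: eq_integrable.
Qed.

Lemma rintZ c h : rint h -> rint (fun z => c * h z).
Proof.
move=> ih; have := integrableZl measurable_unit_square c ih.
by apply: eq_integrable => // z _; rewrite /= EFinM.
Qed.

Lemma rintN h : rint h -> rint (fun z => - h z).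
Proof. by move=> /(rintZ (-1)); apply: eq_rint => z _; rewrite mulN1r. Qed.

Lemma rintB h k : rint h -> rint k -> rint (fun z => h z - k z).
Proof. by move=> ih /rintN; exact: rintD. Qed.

Lemma rint_norm h : rint h -> rint (fun z => `|h z|).
Proof. by move=> ih; apply: integrable_norm. Qed.

Lemma rint_dom (h k : R * R -> R) : rmeasurable h ->
  (forall z, `|h z| <= k z) -> rint k -> rint h.
Proof.
move=> mh hk ik; apply: (le_integrable _ _ _ ik) => //.
  by apply/measurable_EFinP; apply: measurable_funS mh.
by move=> z _ /=; rewrite lee_fin (le_trans (hk z))// ler_norm.
Qed.

Lemma rintM_bounded (h k : R * R -> R) (M : R) : rmeasurable h -> rmeasurable k ->
  (forall z, `|k z| <= M) -> rint h -> rint (fun z => h z * k z).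
Proof.
move=> mh mk kM ih; apply: (@rint_dom _ (fun z => M * `|h z|)).
- exact: measurable_funM.
- by move=> z; rewrite normrM mulrC ler_wpM2r.
- by apply: rintZ; exact: rint_norm.
Qed.

Lemma rint_sum (I : Type) (r : seq I) (F : I -> R * R -> R) :
  (forall i, rint (F i)) -> rint (fun z => \sum_(i <- r) F i z).
Proof.
move=> iF; elim: r => [|i r IH].
  by apply: eq_rint (rint_cst 0) => z _; rewrite big_nil.
by apply: eq_rint (rintD (iF i) IH) => z _; rewrite big_cons.
Qed.

Lemma eq_E h k : (forall z, unit_square z -> h z = k z) -> E h = E k.
Proof. by move=> hk; apply: eq_Rintegral => z /set_mem zS; exact: hk. Qed.

Lemma ED h k : rint h -> rint k -> E (fun z => h z + k z) = E h + E k.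
Proof. by move=> ih ik; exact: RintegralD. Qed.

Lemma EZ c h : rint h -> E (fun z => c * h z) = c * E h.
Proof. by move=> ih; exact: RintegralZl. Qed.

Lemma EN h : rint h -> E (fun z => - h z) = - E h.
Proof.
by move=> ih; rewrite -mulN1r -EZ//; apply: eq_E => z _; rewrite mulN1r.
Qed.

Lemma EB h k : rint h -> rint k -> E (fun z => h z - k z) = E h - E k.
Proof. by move=> ih ik; rewrite ED ?EN//; exact: rintN. Qed.

Lemma E_cst c : E (fun=> c) = c.
Proof. by rewrite /E Rintegral_cst// leb2_unit_square mulr1. Qed.

Lemma E_ge0 h : (forall z, 0 <= h z) -> 0 <= E h.
Proof. by move=> h0; exact: Rintegral_ge0. Qed.

Lemma le_E h k : rint h -> rint k -> (forall z, h z <= k z) -> E h <= E k.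
Proof. by move=> ih ik hk; apply: le_Rintegral => // z _. Qed.

Lemma E_sum (I : Type) (r : seq I) (F : I -> R * R -> R) :
  (forall i, rint (F i)) -> E (fun z => \sum_(i <- r) F i z) = \sum_(i <- r) E (F i).
Proof.
move=> iF; elim: r => [|i r IH].
  by rewrite big_nil -[RHS](E_cst 0); apply: eq_E => z _; rewrite big_nil.
rewrite big_cons -IH -ED//; last exact: rint_sum.
by apply: eq_E => z _; rewrite big_cons.
Qed.

Lemma E_norm_le h (M : R) : rmeasurable h -> (forall z, `|h z| <= M) -> `|E h| <= M.
Proof.
move=> mh hM; have ih := rint_bounded mh hM.
rewrite (le_trans (le_normr_Rintegral measurable_unit_square ih))//.
rewrite -[leRHS]E_cst; apply: le_E => //; [exact: rint_norm|exact: rint_cst].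
Qed.

Lemma ae_eq_E h k : rmeasurable h -> rmeasurable k ->
  aet (fun z => h z = k z) -> E h = E k.
Proof.
move=> mh mk hk; congr fine; apply: ae_eq_integral => //.
- by apply/measurable_EFinP; apply: measurable_funS mh.
- by apply/measurable_EFinP; apply: measurable_funS mk.
- by apply: aetS hk => z ->.
Qed.

(** [le_E] compares pointwise, so [h] is replaced by the minimum of [h] and [k], which agrees with
    it almost everywhere. *)
Lemma ae_le_E h k : rint h -> rint k -> rmeasurable h -> rmeasurable k ->
  aet (fun z => h z <= k z) -> E h <= E k.
Proof.
move=> ih ik mh mk hk; pose h' z := Num.min (h z) (k z).
have mh' : rmeasurable h' by exact: measurable_minr.
have -> : E h = E h'.
  apply: ae_eq_E => //; apply: aetS hk => z hz.
  by rewrite /h' min_l.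
apply: le_E => // [|z]; last by rewrite ge_min lexx orbT.
apply: (@rint_dom _ (fun z => `|h z| + `|k z|)) => //.
  move=> z; rewrite /h'; case: (leP (h z) (k z)) => _.
    by rewrite lerDl.
  by rewrite lerDr.
by apply: rintD; exact: rint_norm.
Qed.

Definition cint (g : R * R -> R[i]) : Prop :=
  [/\ cmeasurable2 g, rint (fun z => complex.Re (g z)) &
      rint (fun z => complex.Im (g z))].

(** This class is closed under sums, products and conjugation, and multiplication by its members
    preserves [cint]. *)
Definition cbnd (g : R * R -> R[i]) : Prop :=
  cmeasurable2 g /\ exists M : R, forall z, normc (g z) <= M.

Lemma cmeasurable2_cst c : cmeasurable2 (fun=> c : R[i]).
Proof. by split; exact: measurable_cst. Qed.

Lemma cmeasurable2D g h : cmeasurable2 g -> cmeasurable2 h ->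
  @cmeasurable2 R (fun z => g z + h z).
Proof.
move=> [g1 g2] [h1 h2]; split.
  by under eq_fun do rewrite ReD; exact: measurable_funD.
by under eq_fun do rewrite ImD; exact: measurable_funD.
Qed.

Lemma cmeasurable2M g h : cmeasurable2 g -> cmeasurable2 h ->
  @cmeasurable2 R (fun z => g z * h z).
Proof.
move=> [g1 g2] [h1 h2]; split.
  by under eq_fun do rewrite ReM; apply: measurable_funB; exact: measurable_funM.
by under eq_fun do rewrite ImM; apply: measurable_funD; exact: measurable_funM.
Qed.

Lemma cmeasurable2Z c g : cmeasurable2 g -> @cmeasurable2 R (fun z => c * g z).
Proof. by apply: cmeasurable2M; exact: cmeasurable2_cst. Qed.

Lemma cmeasurable2N g : cmeasurable2 g -> @cmeasurable2 R (fun z => - g z).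
Proof. by move=> /(cmeasurable2Z (-1)); under eq_fun do rewrite mulN1r. Qed.

Lemma cmeasurable2B g h : cmeasurable2 g -> cmeasurable2 h ->
  @cmeasurable2 R (fun z => g z - h z).
Proof. by move=> mg /cmeasurable2N; exact: cmeasurable2D. Qed.

Lemma cmeasurable2J g : cmeasurable2 g -> @cmeasurable2 R (fun z => conjc (g z)).
Proof.
move=> [g1 g2]; split; first by under eq_fun do rewrite ReJ.
by under eq_fun do rewrite ImJ; exact: measurable_funN.
Qed.

Lemma rmeasurable_sqr_normc g : cmeasurable2 g ->
  rmeasurable (fun z => normc (g z) ^+ 2).
Proof.
move=> [g1 g2]; rewrite /rmeasurable; under eq_fun do rewrite sqr_normcE.
by apply: measurable_funD; exact: measurable_funX.
Qed.

Lemma rmeasurable_normc g : cmeasurable2 g -> rmeasurable (fun z => normc (g z)).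
Proof.
move=> /rmeasurable_sqr_normc mg; rewrite /rmeasurable.
have := measurableT_comp (@measurable_powR R 2^-1) mg.
congr measurable_fun; apply/funext => z /=.
by rewrite -powR_mulrn ?normc_ge0// -powRrM mulfV// powRr1// normc_ge0.
Qed.

Lemma cbndD g h : cbnd g -> cbnd h -> cbnd (fun z => g z + h z).
Proof.
move=> [mg [M gM]] [mh [K hK]]; split; first exact: cmeasurable2D.
by exists (M + K) => z; rewrite (le_trans (le_normcD _ _))// lerD.
Qed.

Lemma cbndM g h : cbnd g -> cbnd h -> cbnd (fun z => g z * h z).
Proof.
move=> [mg [M gM]] [mh [K hK]]; split; first exact: cmeasurable2M.
by exists (M * K) => z; rewrite normcM ler_pM// normc_ge0.
Qed.

Lemma cbnd_cst c : cbnd (fun=> c).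
Proof. by split; [exact: cmeasurable2_cst|exists (normc c)]. Qed.

Lemma cbndJ g : cbnd g -> cbnd (fun z => conjc (g z)).
Proof.
move=> [mg [M gM]]; split; first exact: cmeasurable2J.
by exists M => z; rewrite normcJ.
Qed.

Lemma cbndZ c g : cbnd g -> cbnd (fun z => c * g z).
Proof. by apply: cbndM; exact: cbnd_cst. Qed.

Lemma cbndN g : cbnd g -> cbnd (fun z => - g z).
Proof. by move=> /(cbndZ (-1)); under eq_fun do rewrite mulN1r. Qed.

Lemma cbndB g h : cbnd g -> cbnd h -> cbnd (fun z => g z - h z).
Proof. by move=> bg /cbndN; exact: cbndD. Qed.

Lemma cbnd_sum (I : Type) (r : seq I) (F : I -> R * R -> R[i]) :
  (forall i, cbnd (F i)) -> cbnd (fun z => \sum_(i <- r) F i z).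
Proof.
move=> mF; elim: r => [|i r IH].
  by under eq_fun do rewrite big_nil; exact: cbnd_cst.
by under eq_fun do rewrite big_cons; exact: cbndD.
Qed.

Lemma cbnd_cint g : cbnd g -> cint g.
Proof.
move=> [[m1 m2] [M gM]]; split => //; apply: (@rint_bounded _ M) => // z.
  by rewrite (le_trans (normr_Re_le _)).
by rewrite (le_trans (normr_Im_le _)).
Qed.

Lemma cbnd_rint_normX g n : cbnd g -> rint (fun z => normc (g z) ^+ n).
Proof.
move=> [mg [M gM]]; apply: (@rint_bounded _ (M ^+ n)).
  by apply: measurable_funX; exact: rmeasurable_normc.
move=> z; have M0 : 0 <= M by exact: le_trans (normc_ge0 _) (gM z).
rewrite ger0_norm ?exprn_ge0 ?normc_ge0//.
by rewrite lerXn2r ?nnegrE ?normc_ge0.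
Qed.

Lemma cintD g h : cint g -> cint h -> cint (fun z => g z + h z).
Proof.
move=> [m1 r1 i1] [m2 r2 i2]; split; first exact: cmeasurable2D.
  by apply: eq_rint (rintD r1 r2) => z _; rewrite ReD.
by apply: eq_rint (rintD i1 i2) => z _; rewrite ImD.
Qed.

Lemma cintM g p : cint g -> cbnd p -> cint (fun z => g z * p z).
Proof.
move=> [[m1 m1'] r1 i1] [[m2 m2'] [M pM]]; split; first exact: cmeasurable2M.
  apply: eq_rint (_ : rint (fun z => complex.Re (g z) * complex.Re (p z) -
    complex.Im (g z) * complex.Im (p z))) => [z _|]; first by rewrite ReM.
  apply: rintB; apply: (@rintM_bounded _ _ M) => // z.
    by rewrite (le_trans (normr_Re_le _)).
  by rewrite (le_trans (normr_Im_le _)).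
apply: eq_rint (_ : rint (fun z => complex.Re (g z) * complex.Im (p z) +
  complex.Im (g z) * complex.Re (p z))) => [z _|]; first by rewrite ImM.
apply: rintD; apply: (@rintM_bounded _ _ M) => // z.
  by rewrite (le_trans (normr_Im_le _)).
by rewrite (le_trans (normr_Re_le _)).
Qed.

Lemma cintZ c g : cint g -> cint (fun z => c * g z).
Proof.
move=> ig; have := cintM ig (cbnd_cst c); rewrite (_ : (fun=> _) = fun z => c * g z)//.
by apply/funext => z; rewrite mulrC.
Qed.

Lemma cintN g : cint g -> cint (fun z => - g z).
Proof. by move=> /(cintZ (-1)); under eq_fun do rewrite mulN1r. Qed.

Lemma cintB g h : cint g -> cint h -> cint (fun z => g z - h z).
Proof. by move=> ig /cintN; exact: cintD. Qed.

(** The square has measure 1, so square integrability gives integrability through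
    [x <= x ^ 2 + 1]. *)
Lemma cint_L2 g : L2T2 g -> cint g.
Proof.
move=> [_ mg gfin]; have [m1 m2] := mg.
have i2 : rint (fun z => normc (g z) ^+ 2).
  apply/integrableP; split.
    apply/measurable_EFinP; apply: measurable_funS (rmeasurable_sqr_normc mg) => //.
  under eq_integral => z _ do rewrite /= ger0_norm ?sqr_ge0//.
  exact: gfin.
have i3 : rint (fun z => normc (g z) ^+ 2 + 1) by apply: rintD => //; exact: rint_cst.
have bd z : normc (g z) <= normc (g z) ^+ 2 + 1.
  have := normc_ge0 (g z); set x := normc _ => x0; nra.
split => //; apply: rint_dom i3 => // z; rewrite (le_trans _ (bd z))//.
  exact: normr_Re_le.
exact: normr_Im_le.
Qed.

Lemma torus_intE g : torus_int g =
  E (fun z => complex.Re (g z)) +i* E (fun z => complex.Im (g z)).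
Proof. by []. Qed.

Lemma eq_torus_int g h : (forall z, unit_square z -> g z = h z) ->
  torus_int g = torus_int h :> R[i].
Proof.
by move=> gh; rewrite !torus_intE; congr (_ +i* _); apply: eq_E => z zS; rewrite gh.
Qed.

Lemma torus_intD g h : cint g -> cint h ->
  torus_int (fun z => g z + h z) = torus_int g + torus_int h.
Proof.
move=> [_ r1 i1] [_ r2 i2]; rewrite !torus_intE.
under eq_E => z _ do rewrite ReD.
under [X in _ +i* X]eq_E => z _ do rewrite ImD.
by rewrite ED// ED.
Qed.

Lemma torus_intZ c g : cint g -> torus_int (fun z => c * g z) = c * torus_int g.
Proof.
move=> [_ r1 i1]; rewrite !torus_intE.
under eq_E => z _ do rewrite ReM.
under [X in _ +i* X]eq_E => z _ do rewrite ImM.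
rewrite EB ?ED; try exact: rintZ.
by rewrite !EZ//; apply: complex_ext; rewrite ?ReM ?ImM.
Qed.

Lemma torus_intN g : cint g -> torus_int (fun z => - g z) = - torus_int g.
Proof.
move=> ig; rewrite -mulN1r -torus_intZ//.
by apply: eq_torus_int => z _; rewrite mulN1r.
Qed.

Lemma torus_intB g h : cint g -> cint h ->
  torus_int (fun z => g z - h z) = torus_int g - torus_int h.
Proof. by move=> ig ih; rewrite torus_intD ?torus_intN//; exact: cintN. Qed.

Lemma torus_int_cst c : torus_int (fun=> c : R[i]) = c.
Proof. by rewrite torus_intE !E_cst; apply: complex_ext. Qed.

Lemma cint_sum (I : Type) (r : seq I) (F : I -> R * R -> R[i]) :
  (forall i, cint (F i)) -> cint (fun z => \sum_(i <- r) F i z).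
Proof.
move=> mF; elim: r => [|i r IH].
  by under eq_fun do rewrite big_nil; apply: cbnd_cint; exact: cbnd_cst.
by under eq_fun do rewrite big_cons; exact: cintD.
Qed.

Lemma torus_int_sum (I : Type) (r : seq I) (F : I -> R * R -> R[i]) :
  (forall i, cint (F i)) ->
  torus_int (fun z => \sum_(i <- r) F i z) = \sum_(i <- r) torus_int (F i).
Proof.
move=> iF; elim: r => [|i r IH].
  rewrite big_nil -[RHS](torus_int_cst 0).
  by apply: eq_torus_int => z _; rewrite big_nil.
rewrite big_cons -IH -torus_intD//; last exact: cint_sum.
by apply: eq_torus_int => z _; rewrite big_cons.
Qed.

Lemma ae_eq_torus_int g h : cmeasurable2 g -> cmeasurable2 h ->
  aet (fun z => g z = h z) ->
  torus_int g = torus_int h :> R[i].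
Proof.
move=> [g1 g2] [h1 h2] gh; rewrite !torus_intE; congr (_ +i* _); apply: ae_eq_E => //.
  by apply: aetS gh => z ->.
by apply: aetS gh => z ->.
Qed.

(** The factor 2 comes from bounding real and imaginary parts separately; only smallness for small
    [M] matters later. *)
Lemma normc_torus_int_le g (M : R) : cmeasurable2 g -> (forall z, normc (g z) <= M) ->
  normc (torus_int g) <= 2 * M.
Proof.
move=> [m1 m2] gM; rewrite (le_trans (normc_le_ReIm _))//= mulr_natl mulr2n lerD//.
  by apply: E_norm_le => // z; rewrite (le_trans (normr_Re_le _)).
by apply: E_norm_le => // z; rewrite (le_trans (normr_Im_le _)).
Qed.

End TorusIntegral.
#[global] Hint Resolve measurable_unit_square : core.

(** * Invariance of the torus integral under skew-shifts *)

Section ShiftInvariance.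
Context {R : realType}.

Local Notation T1 := (measurableTypeR R).
Local Notation T2 := (measurableTypeR R * measurableTypeR R)%type.
Local Notation mu := (@lebesgue_measure R).
Local Notation I01 := (@unit_interval R).

Lemma measurable_shift (c : R) : measurable_fun [set: T1] (fun x : T1 => x + c : T1).
Proof. by apply: measurable_funD => //; exact: measurable_cst. Qed.

Lemma preimage_shift_co (a b c : R) :
  (fun x : T1 => x + c : T1) @^-1` `[a, b[%classic = `[a - c, b - c[%classic.
Proof.
by apply/seteqP; split => x /=; rewrite !in_itv/= lerBlDr ltrBrDr.
Qed.

Lemma lebesgue_measure_shift (c : R) (A : set T1) : measurable A ->
  pushforward mu (fun x : T1 => x + c : T1) A = mu A.
Proof.
move=> mA; have mc := measurable_shift c.
pose nu := pushforward mu (fun x : T1 => x + c : T1).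
apply/esym.
have := @lebesgue_measure_unique R
  (measure_function_pushforward__canonical__measure_function_Measure mu mc).
apply => //= _ [[a b]] _ <-.
rewrite /pushforward (_ : _ @^-1` _ = `]a - c, b - c]%classic); last first.
  by apply/seteqP; split => x /=; rewrite !in_itv/= ltrBlDr lerBrDr.
rewrite !lebesgue_measure_itv/= !lte_fin ltrD2r.
by case: ifPn => // _; rewrite -!EFinD; congr _%:E; ring.
Qed.

Lemma integral_shift (c : R) (D : set T1) (h : T1 -> \bar R) : measurable D ->
  measurable_fun [set: T1] h -> (forall x, 0 <= h x)%E ->
  (\int[mu]_(y in D) h y =
   \int[mu]_(x in (fun x : T1 => (x + c)%R : T1) @^-1` D) h (x + c : R)%R)%E.
Proof.
move=> mD mh h0; have mc := measurable_shift c.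
have -> : (\int[mu]_(y in D) h y =
    \int[pushforward mu (fun x : T1 => (x + c)%R : T1)]_(y in D) h y)%E.
  apply: (@eq_measure_integral _ _ _ D
    (measure_function_pushforward__canonical__measure_function_Measure mu mc)).
  by move=> A mA _; apply/esym; exact: lebesgue_measure_shift.
rewrite (@ge0_integral_pushforward _ _ _ _ _ _ mc)//.
exact: measurable_funS mh.
Qed.

Lemma measurable_I01 : measurable (I01 : set T1).
Proof. exact: measurable_itv. Qed.
Hint Resolve measurable_I01 : core.

Lemma periodic_int (T : Type) (h : R -> T) (n : int) : (forall x, h (x + 1) = h x) ->
  forall x, h (x + n%:~R) = h x.
Proof.
move=> hp; have pos (k : nat) x : h (x + k%:R) = h x.
  by elim: k x => [|k IH] x; rewrite ?addr0// -natr1 addrA hp IH.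
case: n => k x; first exact: pos.
by rewrite NegzE mulrNz -[in RHS](subrK k.+1%:~R x) -pmulrn pos.
Qed.

(** Periodicity reduces [c] to its fractional part [r]; the piece of the translated interval over
    [[1, 1 + r)] then moves back to [[0, r)]. *)
Lemma integral_periodic_shift (c : R) (h : T1 -> \bar R) :
  measurable_fun [set: T1] h -> (forall x, 0 <= h x)%E ->
  (forall x, h (x + 1)%R = h x) ->
  (\int[mu]_(x in I01) h (x + c)%R = \int[mu]_(x in I01) h x)%E.
Proof.
move=> mh h0 hp.
pose n := Num.floor c; pose r := c - n%:~R.
have r0 : 0 <= r by rewrite subr_ge0 ge_floor.
have r1 : r < 1 by rewrite /r ltrBlDl -[1]/(1%:~R) -intrD; have /andP[] := floor_itv c.
have mhr : measurable_fun [set: T1] (fun x : T1 => h (x + r)%R).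
  by apply: (measurableT_comp mh); exact: measurable_shift.
have mI (a b : R) : measurable (`[a, b[%classic : set T1) by exact: measurable_itv.
transitivity (\int[mu]_(x in I01) h (x + r)%R)%E.
  apply: eq_integral => x _; rewrite -(periodic_int (- n) hp (x + c)).
  by rewrite mulrNz addrA.
have -> : (\int[mu]_(x in I01) h (x + r)%R = \int[mu]_(x in `[r, (1 + r)%R[) h x)%E.
  rewrite [RHS](@integral_shift r _ h (mI _ _) mh h0).
  by rewrite preimage_shift_co subrr addrK.
have -> : `[r, 1 + r[%classic = `[r, 1[%classic `|` `[1, 1 + r[%classic :> set R.
  apply/seteqP; split => x /=; rewrite !in_itv/=.
    by case: (ltP x 1) => x1 /andP[-> h2]; [left|right].
  by case=> /andP[? ?]; apply/andP; split; lra.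
rewrite [LHS]ge0_integral_setU//; last 2 first.
- exact: measurable_funS mh.
- apply/disj_setPS => x [] /=; rewrite !in_itv/= => /andP[_ x1] /andP[x1' _].
  by move: (lt_le_trans x1 x1'); rewrite ltxx.
have -> : (\int[mu]_(x in `[1%R, (1 + r)%R[) h x = \int[mu]_(x in `[0%R, r[) h x)%E.
  rewrite [LHS](@integral_shift 1 _ h (mI _ _) mh h0) preimage_shift_co subrr addrC addKr.
  by apply: eq_integral => x _; rewrite hp.
have -> : I01 = `[0, r[%classic `|` `[r, 1[%classic.
  apply/seteqP; split => x /=; rewrite ?in_itv/=.
    by rewrite /unit_interval/= in_itv/=; case: (ltP x r) => xr /andP[-> ->]; [left|right].
  by rewrite /unit_interval/= in_itv/= => -[] /andP[? ?]; apply/andP; split; lra.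
rewrite [RHS]ge0_integral_setU//; last 2 first.
- exact: measurable_funS mh.
- apply/disj_setPS => x [] /=; rewrite !in_itv/= => /andP[_ x1] /andP[x1' _].
  by move: (lt_le_trans x1 x1'); rewrite ltxx.
by rewrite addeC.
Qed.

Lemma integral_square_tonelli (g : T2 -> \bar R) : measurable_fun [set: T2] g ->
  (forall z, 0 <= g z)%E ->
  (\int[leb2]_(z in unit_square) g z =
   \int[mu]_(x in I01) \int[mu]_(y in I01) g (x, y))%E.
Proof.
move=> mg g0; rewrite integral_mkcond.
rewrite [LHS]fubini_tonelli1; last 2 first.
- by apply/(measurable_restrictT _ measurable_unit_square); exact: measurable_funS mg.
- by move=> z; apply: erestrict_ge0.
rewrite [RHS]integral_mkcond; apply: eq_integral => x _.
rewrite /fubini_F patchE; case: ifPn => xI.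
  rewrite [RHS]integral_mkcond; apply: eq_integral => y _; rewrite !patchE.
  rewrite (_ : ((x, y) \in unit_square) = (y \in I01))//.
  by apply/idP/idP; rewrite !inE; [case|split => //]; rewrite ?inE in xI.
rewrite (eq_integral (cst 0%E)) ?integral0// => y _; rewrite patchE.
case: ifPn => //; rewrite inE => -[/= xI' _].
by move: xI; rewrite notin_setE.
Qed.

Lemma measurable_skew_shift (al be : R) :
  measurable_fun [set: T2] (skew_shift al be : T2 -> T2).
Proof.
apply/measurable_fun_pairP; split => /=.
  exact: (measurable_funD measurable_fst (measurable_cst _)).
apply: (measurable_funD _ (measurable_cst _)).
exact: (measurable_funD measurable_snd measurable_fst).
Qed.

(** In the iterated integral the inner variable undergoes, for fixed [x], a translation by [x + be],
    and the outer one a translation by [al]. *)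
Lemma integral_skew_shift (al be : R) (g : T2 -> \bar R) :
  measurable_fun [set: T2] g -> (forall z, 0 <= g z)%E ->
  (forall x y, g (x + 1, y) = g (x, y) /\ g (x, y + 1) = g (x, y)) ->
  (\int[leb2]_(z in unit_square) g (skew_shift al be z) =
   \int[leb2]_(z in unit_square) g z)%E.
Proof.
move=> mg g0 gp.
have msec x : measurable_fun [set: T1] (fun y : T1 => g (x, y)).
  by apply: measurableT_comp => //; exact: measurable_pair1.
rewrite [LHS]integral_square_tonelli//; last first.
  exact: (measurableT_comp mg (measurable_skew_shift al be)).
rewrite [RHS](integral_square_tonelli mg g0).
pose G (x : T1) := (\int[mu]_(y in I01) g (x, y))%E.
have mG : measurable_fun [set: T1] G.
  rewrite (_ : G = fubini_F mu (g \_ (setT `*` I01))).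
    apply: measurable_fun_fubini_tonelli_F => /=.
      have mT : measurable ([set: T1] `*` I01 : set T2) by exact: measurableX.
      by apply/(measurable_restrictT _ mT); exact: measurable_funS mg.
    by move=> z; apply: erestrict_ge0.
  apply/funext => x; rewrite /G /fubini_F [LHS]integral_mkcond.
  apply: eq_integral => y _; rewrite !patchE.
  rewrite (_ : ((x, y) \in setT `*` I01) = (y \in I01))//.
  by apply/idP/idP; rewrite !inE => //; case.
transitivity (\int[mu]_(x in I01) G (x + al)%R)%E.
  apply: eq_integral => x _; rewrite /skew_shift/=.
  rewrite /G -(@integral_periodic_shift (x + be) (fun y => g (x + al, y)))//.
    by apply: eq_integral => y _; rewrite addrA.
  by move=> y; case: (gp (x + al) y).
apply: integral_periodic_shift => //.
  by move=> x; exact: integral_ge0.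
by move=> x; apply: eq_integral => y _; case: (gp x y).
Qed.

Lemma E_skew_shift (al be : R) (h : R * R -> R) : rmeasurable h ->
  (forall x y, h (x + 1, y) = h (x, y) /\ h (x, y + 1) = h (x, y)) ->
  E (h \o skew_shift al be) = E h.
Proof.
move=> mh hp; congr fine; have mhE := proj2 (measurable_EFinP _ _) mh.
rewrite [LHS]integralE [RHS]integralE; congr (_ - _)%E.
  transitivity (\int[leb2]_(z in unit_square) (EFin \o h)^\+ (skew_shift al be z))%E.
    by apply: eq_integral => z _; rewrite !funeposE.
  apply: integral_skew_shift => //.
    exact: measurable_funepos.
  by move=> x y; rewrite !funeposE/=; case: (hp x y) => -> ->.
transitivity (\int[leb2]_(z in unit_square) (EFin \o h)^\- (skew_shift al be z))%E.
  by apply: eq_integral => z _; rewrite !funenegE.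
apply: integral_skew_shift => //.
  exact: measurable_funeneg.
by move=> x y; rewrite !funenegE/=; case: (hp x y) => -> ->.
Qed.

Lemma cmeasurable2_skew_shift (al be : R) g : cmeasurable2 g ->
  @cmeasurable2 R (g \o skew_shift al be).
Proof.
move=> [g1 g2]; split.
  exact: (measurableT_comp g1 (measurable_skew_shift al be)).
exact: (measurableT_comp g2 (measurable_skew_shift al be)).
Qed.

Lemma torus_int_skew_shift (al be : R) g : cmeasurable2 g -> periodic2 g ->
  torus_int (g \o skew_shift al be) = torus_int g :> R[i].
Proof.
move=> [g1 g2] gp; rewrite !torus_intE; congr (_ +i* _).
  apply: (@E_skew_shift al be (fun z => complex.Re (g z))) => // x y.
  by case: (gp x y) => -> ->.
apply: (@E_skew_shift al be (fun z => complex.Im (g z))) => // x y.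
by case: (gp x y) => -> ->.
Qed.

Lemma periodic2_skew_shift (al be : R) (T : Type) (g : R * R -> T) :
  (forall x y, g (x + 1, y) = g (x, y) /\ g (x, y + 1) = g (x, y)) ->
  forall x y, (g \o skew_shift al be) (x + 1, y) = (g \o skew_shift al be) (x, y) /\
    (g \o skew_shift al be) (x, y + 1) = (g \o skew_shift al be) (x, y).
Proof.
move=> gp x y; rewrite /= /skew_shift/=; split.
  rewrite [x + 1 + al]addrAC (gp _ _).1 [y + _]addrA [_ + 1 + be]addrAC.
  by rewrite (gp _ _).2.
by rewrite [y + 1 + x]addrAC [_ + 1 + be]addrAC (gp _ _).2.
Qed.

End ShiftInvariance.

(** * Fourier coefficients *)

Section Characters.
Context {R : realType}.
Local Notation T2 := (measurableTypeR R * measurableTypeR R)%type.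
Implicit Types (z : R * R) (a b : int).

Lemma fcharE a b z : fchar a b z = ex (a%:~R * z.1 + b%:~R * z.2) :> R[i].
Proof. by []. Qed.

Lemma fcharM a b (c d : int) z : fchar a b z * fchar c d z = fchar (a + c) (b + d) z :> R[i].
Proof. by rewrite !fcharE -exD !intrD; congr ex; ring. Qed.

Lemma fcharJ a b z : conjc (fchar a b z) = fchar (- a) (- b) z :> R[i].
Proof. by rewrite !fcharE -exN !intrN; congr ex; ring. Qed.

Lemma fchar0 z : fchar 0 0 z = 1 :> R[i].
Proof. by rewrite fcharE !mul0r addr0 ex0. Qed.

Lemma normc_fchar a b z : normc (fchar a b z : R[i]) = 1.
Proof. by rewrite fcharE normc_ex. Qed.

Lemma periodic2_fchar a b : periodic2 (fchar a b : R * R -> R[i]).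
Proof.
move=> x y; rewrite !fcharE /= !mulrDr !mulr1; split.
  by rewrite addrAC exDint.
by rewrite addrA exDint.
Qed.

Lemma cmeasurable2_fchar a b : cmeasurable2 (fchar a b : R * R -> R[i]).
Proof.
have mt : measurable_fun [set: T2]
    (fun z : T2 => 2 * pi * (a%:~R * z.1 + b%:~R * z.2) : R).
  apply: (measurable_funM (measurable_cst _)); apply: measurable_funD.
    exact: (measurable_funM (measurable_cst _) measurable_fst).
  exact: (measurable_funM (measurable_cst _) measurable_snd).
split.
  have mc := continuous_measurable_fun (@continuous_cos R).
  exact: (measurableT_comp mc mt).
have ms := continuous_measurable_fun (@continuous_sin R).
exact: (measurableT_comp ms mt).
Qed.

Lemma cbnd_fchar a b : cbnd (fchar a b : R * R -> R[i]).
Proof.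
by split; [exact: cmeasurable2_fchar|exists 1 => z; rewrite normc_fchar].
Qed.

Lemma fchar_skew_shift (al be : R) a b z : fchar a b (skew_shift al be z) =
  ex (a%:~R * al + b%:~R * be) * fchar (a + b) b z.
Proof. by rewrite !fcharE /= -exD intrD; congr ex; ring. Qed.

Lemma ex_half : ex (2^-1 : R) = -1.
Proof.
by rewrite /ex mulrAC mulfV// mul1r cospi sinpi; apply: complex_ext; rewrite /= ?oppr0.
Qed.

(** No trigonometric integral is computed: the parameters of the skew-shift are free in the
    invariance [inv], and a choice producing the phase [ex 2^-1 = -1] shows the integral of a
    nontrivial character to be its own opposite. *)
Lemma torus_int_fchar a b :
  torus_int (fchar a b) = (if (a == 0) && (b == 0) then 1 else 0) :> R[i].
Proof.
have inv (al be : R) (a' b' : int) : torus_int (fchar a' b') =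
    ex (a'%:~R * al + b'%:~R * be) * torus_int (fchar (a' + b') b').
  rewrite -(torus_int_skew_shift al be); last 2 first.
  - exact: cmeasurable2_fchar.
  - exact: periodic2_fchar.
  rewrite -torus_intZ; last exact/cbnd_cint/cbnd_fchar.
  by apply: eq_torus_int => z _; rewrite /comp fchar_skew_shift.
have neg (x : R[i]) : x = - x -> x = 0.
  move=> /eqP; rewrite -subr_eq0 opprK -mulr2n mulrn_eq0/= => /eqP; exact.
have [b0|b0] := eqVneq b 0; last first.
  rewrite andbF; apply: neg.
  rewrite {1}(inv 0 (2^-1 / b%:~R)) mulr0 add0r mulrCA mulfV ?intr_eq0// mulr1.
  by rewrite ex_half mulN1r (inv 0 0 a b) !mulr0 addr0 ex0 mul1r.
rewrite andbT b0; have [->|a0] := eqVneq a 0.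
  by rewrite -[RHS]torus_int_cst; apply: eq_torus_int => z _; rewrite fchar0.
apply: neg; rewrite {1}(inv (2^-1 / a%:~R) 0) mul0r addr0 mulrCA mulfV ?intr_eq0//.
by rewrite mulr1 ex_half mulN1r addr0.
Qed.

Lemma fcoefE (g : R * R -> R[i]) a b :
  fcoef g a b = torus_int (fun z => g z * fchar (- a) (- b) z).
Proof.
by rewrite /fcoef /L2_inner; apply: eq_torus_int => z _; rewrite fcharJ.
Qed.

Lemma fcoefD (g h : R * R -> R[i]) a b : cint g -> cint h ->
  fcoef (fun z => g z + h z) a b = fcoef g a b + fcoef h a b.
Proof.
move=> ig ih; rewrite !fcoefE -torus_intD; try exact: (cintM _ (cbnd_fchar _ _)).
by apply: eq_torus_int => z _; rewrite mulrDl.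
Qed.

Lemma fcoefZ (c : R[i]) (g : R * R -> R[i]) a b : cint g ->
  fcoef (fun z => c * g z) a b = c * fcoef g a b.
Proof.
move=> ig; rewrite !fcoefE -torus_intZ; last exact: (cintM ig (cbnd_fchar _ _)).
by apply: eq_torus_int => z _; rewrite mulrA.
Qed.

Lemma fcoefB (g h : R * R -> R[i]) a b : cint g -> cint h ->
  fcoef (fun z => g z - h z) a b = fcoef g a b - fcoef h a b.
Proof.
move=> ig ih; rewrite !fcoefE -torus_intB; try exact: (cintM _ (cbnd_fchar _ _)).
by apply: eq_torus_int => z _; rewrite mulrBl.
Qed.

Lemma fcoef_sum (I : Type) (r : seq I) (F : I -> R * R -> R[i]) a b :
  (forall i, cint (F i)) ->
  fcoef (fun z => \sum_(i <- r) F i z) a b = \sum_(i <- r) fcoef (F i) a b.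
Proof.
move=> iF; rewrite fcoefE; under eq_bigr do rewrite fcoefE.
rewrite -torus_int_sum => [|i]; last exact: (cintM (iF i) (cbnd_fchar _ _)).
by apply: eq_torus_int => z _; rewrite mulr_suml.
Qed.

Lemma fcoef_fchar a b (c d : int) :
  fcoef (fchar a b) c d = (if (a == c) && (b == d) then 1 else 0) :> R[i].
Proof.
rewrite fcoefE -(subr_eq0 a c) -(subr_eq0 b d) -torus_int_fchar.
by apply: eq_torus_int => z _; rewrite fcharM.
Qed.

Lemma fcoef_cst (C : R[i]) a b :
  fcoef (fun=> C) a b = if (a, b) == (0, 0) then C else 0.
Proof.
transitivity (fcoef (fun z => C * fchar 0 0 z) a b).
  by congr fcoef; apply/funext => z; rewrite fchar0 mulr1.
rewrite fcoefZ; last exact/cbnd_cint/cbnd_fchar.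
rewrite fcoef_fchar xpair_eqE ![0 == _]eq_sym.
by case: ifP; rewrite ?mulr1 ?mulr0.
Qed.

Lemma fcoef_fcharM (g : R * R -> R[i]) a b (c d : int) :
  fcoef (fun z => g z * fchar a b z) c d = fcoef g (c - a) (d - b).
Proof.
rewrite !fcoefE; apply: eq_torus_int => z _.
by rewrite -mulrA fcharM !opprB.
Qed.

Lemma ae_eq_fcoef (g h : R * R -> R[i]) a b : cmeasurable2 g -> cmeasurable2 h ->
  aet (fun z => g z = h z) -> fcoef g a b = fcoef h a b.
Proof.
move=> mg mh gh; rewrite !fcoefE; apply: ae_eq_torus_int.
- by apply: cmeasurable2M => //; exact: cmeasurable2_fchar.
- by apply: cmeasurable2M => //; exact: cmeasurable2_fchar.
- by apply: aetS gh => z ->.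
Qed.

Lemma normc_fcoef_le (g : R * R -> R[i]) (M : R) a b : cmeasurable2 g ->
  (forall z, normc (g z) <= M) -> normc (fcoef g a b) <= 2 * M.
Proof.
move=> mg gM; rewrite fcoefE; apply: normc_torus_int_le.
  by apply: cmeasurable2M => //; exact: cmeasurable2_fchar.
by move=> z; rewrite normcM normc_fchar mulr1.
Qed.

(** Composition moves a coefficient one step along its row: the change of variables turns the test
    character at [(a, b)] into the one at [(a - b, b)] up to a phase. *)
Lemma fcoef_skew_shift (al be : R) (g : R * R -> R[i]) a b :
  periodic2 g -> cint g -> fcoef (g \o skew_shift al be) a b =
    ex ((a - b)%:~R * al + b%:~R * be) * fcoef g (a - b) b.
Proof.
move=> pg ig; have [mg _ _] := ig.
set c := ex _; pose h z := c * (g z * fchar (- (a - b)) (- b) z).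
have mgh : cmeasurable2 (fun z => g z * fchar (- (a - b)) (- b) z).
  by apply: cmeasurable2M => //; exact: cmeasurable2_fchar.
rewrite !fcoefE -torus_intZ; last exact: (cintM ig (cbnd_fchar _ _)).
rewrite -[RHS](torus_int_skew_shift al be (g := h)); last 2 first.
- exact: cmeasurable2Z.
- move=> x y; rewrite /h; have [-> ->] := pg x y.
  by have [-> ->] := periodic2_fchar (- (a - b)) (- b) x y.
apply: eq_torus_int => z _; rewrite /h /= fchar_skew_shift mulrCA.
rewrite [c * _]mulrA (_ : c * _ = 1) ?mul1r; last first.
  by rewrite /c -exD -[RHS]ex0 !intrN; congr ex; ring.
by rewrite -opprD subrK.
Qed.

Lemma L2_inner_sqr (g : R * R -> R[i]) : cbnd g ->
  L2_inner g g = (E (fun z => normc (g z) ^+ 2))%:C.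
Proof.
move=> bg; rewrite /L2_inner torus_intE.
under [X in X +i* _]eq_E => z _ do rewrite mulcJ/=.
under [X in _ +i* X]eq_E => z _ do rewrite mulcJ/=.
by rewrite E_cst.
Qed.

(** The index type is separate from the frequencies, so that families can be indexed by pairs, by
    time lags or by positions in a chain. *)
Definition trigpoly (I : Type) (r : seq I) (key : I -> int * int) (c : I -> R[i]) z
    : R[i] :=
  \sum_(i <- r) c i * fchar (key i).1 (key i).2 z.

Lemma cbnd_trigpoly (I : Type) (r : seq I) key c : cbnd (@trigpoly I r key c).
Proof. by apply: cbnd_sum => i; apply: cbndZ; exact: cbnd_fchar. Qed.

Lemma periodic2_trigpoly (I : Type) (r : seq I) key c :
  periodic2 (@trigpoly I r key c).
Proof.
by move=> x y; rewrite /trigpoly; split; apply: eq_bigr => i _;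
  have [h1 h2] := periodic2_fchar (key i).1 (key i).2 x y; rewrite ?h1 ?h2.
Qed.

Lemma fcoef_trigpoly (I : Type) (r : seq I) key c a b :
  fcoef (@trigpoly I r key c) a b = \sum_(i <- r | key i == (a, b)) c i.
Proof.
rewrite fcoef_sum => [|i]; last by apply/cbnd_cint/cbndZ; exact: cbnd_fchar.
rewrite [RHS]big_mkcond; apply: eq_bigr => i _.
rewrite fcoefZ; last exact/cbnd_cint/cbnd_fchar.
rewrite fcoef_fchar -xpair_eqE -surjective_pairing.
by case: ifP => _; rewrite ?mulr1 ?mulr0.
Qed.

Lemma L2_inner_trigpolyr (I : Type) (r : seq I) key c (g : R * R -> R[i]) : cint g ->
  L2_inner g (@trigpoly I r key c) =
  \sum_(i <- r) conjc (c i) * fcoef g (key i).1 (key i).2.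
Proof.
move=> ig; under eq_bigr do rewrite fcoefE.
transitivity (torus_int (fun z => \sum_(i <- r) conjc (c i) *
    (g z * fchar (- (key i).1) (- (key i).2) z))).
  apply: eq_torus_int => z _; rewrite /trigpoly rmorph_sum mulr_sumr.
  by apply: eq_bigr => i _; rewrite mulrCA -fcharJ -rmorphM.
rewrite torus_int_sum => [|i]; last by apply: cintZ; exact: (cintM ig (cbnd_fchar _ _)).
by apply: eq_bigr => i _; rewrite torus_intZ//; exact: (cintM ig (cbnd_fchar _ _)).
Qed.

Lemma trigpoly_parseval (I : eqType) (r : seq I) key c : uniq r ->
  {in r &, injective key} ->
  E (fun z => normc (@trigpoly I r key c z) ^+ 2) = \sum_(i <- r) normc (c i) ^+ 2.
Proof.
move=> ur kinj; apply: (@complexI R); rewrite -L2_inner_sqr; last exact: cbnd_trigpoly.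
rewrite L2_inner_trigpolyr; last exact/cbnd_cint/cbnd_trigpoly.
rewrite rmorph_sum/= big_seq [RHS]big_seq; apply: eq_bigr => i ir.
rewrite fcoef_trigpoly -surjective_pairing -mulcJ mulrC; congr (_ * _).
rewrite big_mkcond (bigD1_seq i)//= eqxx big_seq_cond big1 ?addr0// => j.
case/andP => jr ji; case: (eqVneq (key j) (key i)) => // /kinj e.
by move: ji; rewrite e// eqxx.
Qed.

(** The defect is the squared distance from [g] to the trigonometric polynomial carrying the
    coefficients of [g]. *)
Lemma Bessel (I : eqType) (r : seq I) (key : I -> int * int) (g : R * R -> R[i]) :
  cbnd g -> uniq r -> {in r &, injective key} ->
  \sum_(i <- r) normc (fcoef g (key i).1 (key i).2) ^+ 2
    <= E (fun z => normc (g z) ^+ 2).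
Proof.
move=> bg ur kinj; pose c i := fcoef g (key i).1 (key i).2.
pose P := trigpoly r key c; have bP : cbnd P by exact: cbnd_trigpoly.
set S := \sum_(i <- r) _; set G := E _.
suff -> : S = G - E (fun z => normc (g z - P z) ^+ 2).
  by rewrite gerBl E_ge0// => z; exact: sqr_ge0.
have EP : E (fun z => normc (P z) ^+ 2) = S by rewrite /P trigpoly_parseval.
have cross : L2_inner g P = S%:C.
  rewrite /P L2_inner_trigpolyr; last exact: cbnd_cint.
  by rewrite rmorph_sum/=; apply: eq_bigr => i _; rewrite mulrC mulcJ.
have Ecross : E (fun z => complex.Re (g z * conjc (P z))) = S.
  by move: cross; rewrite /L2_inner torus_intE => -[].
have := bg => /cbndM/(_ (cbndJ bP))/cbnd_cint[_ rc _].
have -> : E (fun z => normc (g z - P z) ^+ 2) = G + S - 2 * S.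
  rewrite -{2}Ecross -EP -EZ// -ED; try exact: cbnd_rint_normX.
  rewrite -EB; last 2 first.
  - by apply: rintD; exact: cbnd_rint_normX.
  - exact: rintZ.
  apply: eq_E => z _; rewrite !sqr_normcE ReB ImB ReM ReJ ImJ; ring.
ring.
Qed.

End Characters.

Arguments conjc : simpl never.

(** * Fourth moments of Birkhoff sums of characters *)

Section FourthMoment.
Context {R : realType} (al be : R).
Implicit Types (z : R * R) (a n : int).

Local Notation f := (skew_shift al be).

(** Phase picked up by the character [(a, n)] after [j] iterates of the skew-shift; [j (j - 1) / 2]
    is the binomial coefficient in the distributions [D_(a,n)]. The index is an integer because
    chains are followed in both directions. *)
Definition theta a n (j : int) : R :=
  (a%:~R * al + n%:~R * be) * j%:~R + n%:~R * al * (j%:~R * (j%:~R - 1) / 2).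

Lemma theta0 a n : theta a n 0 = 0.
Proof. by rewrite /theta mulr0 mul0r mul0r mulr0 addr0. Qed.

Lemma thetaS a n j : theta a n (j + 1) =
  theta a n j + ((a + j * n)%:~R * al + n%:~R * be).
Proof. by rewrite /theta !intrD intrM; field. Qed.

Lemma thetaD a n j k : theta a n (j + k) = theta a n j + theta (a + j * n) n k.
Proof. by rewrite /theta !intrD intrM; field. Qed.

Lemma fchar_iter a n k z : fchar a n (iter k f z) =
  ex (theta a n k) * fchar (a + k%:Z * n) n z.
Proof.
elim: k z => [|k IH] z; first by rewrite theta0 ex0 mul1r mul0r addr0.
rewrite iterSr IH fchar_skew_shift mulrA -exD -thetaS.
by rewrite -addn1 PoszD; congr (_ * fchar _ _ _); ring.
Qed.

(** The square array is summed by diagonals, [h.+1] being the distance to the main one. *)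
Lemma sum_square_split (V : zmodType) (F : nat -> nat -> V) (N : nat) :
  \sum_(k < N) \sum_(l < N) F k l = \sum_(k < N) F k k +
    \sum_(h < N) \sum_(l < N - h.+1) (F (l + h.+1)%N l + F l (l + h.+1)%N).
Proof.
elim: N => [|N IH]; first by rewrite !big_ord0 addr0.
rewrite big_ord_recr/=.
under eq_bigr do rewrite big_ord_recr/=.
rewrite big_split/= IH [\sum_(k < N.+1) F k k]big_ord_recr/=.
rewrite [X in _ = _ + X]big_ord_recr/= subnn big_ord0 addr0.
have -> : \sum_(h < N) \sum_(l < N.+1 - h.+1) (F (l + h.+1)%N l + F l (l + h.+1)%N) =
    \sum_(h < N) \sum_(l < N - h.+1) (F (l + h.+1)%N l + F l (l + h.+1)%N) +
    \sum_(h < N) (F N (N - h.+1)%N + F (N - h.+1)%N N).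
  rewrite -big_split; apply: eq_bigr => h _ /=.
  by rewrite subSn// big_ord_recr/= subnK.
rewrite [X in _ = _ + (_ + X)](_ : _ = \sum_(l < N) (F N l + F l N)); last first.
  rewrite -(big_mkord xpredT (fun h => F N (N - h.+1)%N + F (N - h.+1)%N N)).
  by rewrite -(big_mkord xpredT (fun h => F N h + F h N)) [RHS]big_nat_rev.
rewrite big_split/= [\sum_(l < N.+1) F N l]big_ord_recr/=.
by rewrite [LHS](AC (3*2) ((1*5)*(2*(4*3)))).
Qed.

Lemma normc_expr4_le (z : R[i]) (x : R) (t : R[i]) : 0 <= x ->
  z * conjc z = x%:C + (t + conjc t) -> normc z ^+ 4 <= 2 * x ^+ 2 + 8 * normc t ^+ 2.
Proof.
move=> x0 /(congr1 (@complex.Re R)); rewrite mulcJ !ReD ReJ /= => h.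
rewrite (_ : 4 = 2 * 2)%N// exprM h.
have : (complex.Re t) ^+ 2 <= normc t ^+ 2 by rewrite sqr_normcE lerDl sqr_ge0.
have := sqr_ge0 (x - (complex.Re t + complex.Re t)); nra.
Qed.

(** Weyl differencing: in the product of one iterate with the conjugate of another the frequency in
    [y] cancels and the frequency in [x] depends only on the lag. The diagonal gives [N], and the
    rest is a trigonometric polynomial in [x] indexed by lags. *)
Lemma birkhoff_fchar_sqr a n (N : nat) z :
  let S := \sum_(k < N) fchar a n (iter k f z) in
  let C (h : nat) := \sum_(l < N - h.+1) ex (theta a n (l + h.+1)%N - theta a n l) in
  let T := \sum_(h < N) C h * fchar (h.+1%:Z * n) 0 z in
  S * conjc S = N%:R%:C + (T + conjc T).
Proof.
move=> S C T; rewrite /S.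
under eq_bigr do rewrite fchar_iter.
rewrite conjc_sum mulr_suml.
pose F (k l : nat) := ex (theta a n k - theta a n l) *
  fchar ((k%:Z - l%:Z) * n) 0 z : R[i].
under eq_bigr => k _.
  rewrite mulr_sumr.
  under eq_bigr => l _.
    rewrite conjcM fcharJ mulrACA -exB fcharM subrr.
    rewrite (_ : _ + _ = (k%:Z - l%:Z) * n); last by ring.
    rewrite -/(F k l); over.
  over.
rewrite sum_square_split; congr (_ + _).
  rewrite (eq_bigr (fun=> 1)) => [|k _]; last first.
    by rewrite /F !subrr mul0r ex0 fchar0 mulr1.
  by rewrite sumr_const card_ord rmorph_nat.
rewrite /T conjc_sum -big_split; apply: eq_bigr => h _ /=.
rewrite /C !mulr_suml conjc_sum -big_split; apply: eq_bigr => l _ /=.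
rewrite /F; congr (_ * fchar _ _ _ + _); first by rewrite PoszD; ring.
rewrite conjcM fcharJ -exN opprB oppr0 PoszD; congr (_ * fchar _ _ _); ring.
Qed.

(** The phase is quadratic in time, so its increment over a lag [h] is affine in [l] with slope
    [n h al]: the correlation is a geometric sum up to a phase. *)
Lemma normc_correlation a n (N h : nat) :
  normc (\sum_(l < N - h) ex (theta a n (l + h)%N - theta a n l)) =
  normc (Dk (N - h) (`|n|%:R * h%:R * al)).
Proof.
transitivity (normc (ex (theta a n h) * Dk (N - h) (n%:~R * h%:R * al))).
  congr normc; rewrite mulr_sumr; apply: eq_bigr => l _; rewrite -exD.
  by congr ex; rewrite /theta PoszD !intrD -!pmulrn; field.
rewrite normcM normc_ex mul1r.
have [n0|n0] := leP 0 n; first by rewrite -[in LHS](gez0_abs n0).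
rewrite -[in LHS]normc_DkN -!mulNr -intrN.
by rewrite -ltz0_abs.
Qed.

(** Parseval for the polynomial of lags, whose frequencies are distinct because [n != 0], turns the
    fourth moment into a sum of squared correlations. The 64 is 8 from [normc_expr4_le] times 8 from
    [Weyl_sum_bound]. *)
Lemma fourth_moment_le a n (N q : nat) (p : int) : n != 0 -> (0 < N)%N ->
  (2 * N <= q)%N -> coprimez p q -> `|q%:R * al - p%:~R| <= q%:R^-1 ->
  E (fun z => normc (\sum_(k < N) fchar a n (iter k f z)) ^+ 4) <=
    2 * N%:R ^+ 2 + 64 * `|n|%:R * Kd * q%:R ^+ 2.
Proof.
move=> n0 N0 Nq pq hal.
pose C (h : nat) := \sum_(l < N - h.+1) ex (theta a n (l + h.+1)%N - theta a n l).
pose T := trigpoly (index_enum 'I_N) (fun h : 'I_N => (h.+1%:Z * n, 0)) (fun h => C h).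
have bT : cbnd T by exact: cbnd_trigpoly.
pose S (z : R * R) := \sum_(k < N) ex (theta a n k) * fchar (a + k%:Z * n) n z.
have bS : cbnd S by apply: cbnd_sum => i; apply: cbndZ; exact: cbnd_fchar.
have -> : E (fun z => normc (\sum_(k < N) fchar a n (iter k f z)) ^+ 4) =
    E (fun z => normc (S z) ^+ 4).
  by apply: eq_E => z _; congr (normc _ ^+ 4); apply: eq_bigr => k _; rewrite fchar_iter.
apply: (@le_trans _ _ (E (fun z => 2 * N%:R ^+ 2 + 8 * normc (T z) ^+ 2))).
  apply: le_E; first exact: cbnd_rint_normX.
    by apply: rintD; [exact: rint_cst|apply: rintZ; exact: cbnd_rint_normX].
  move=> z; apply: normc_expr4_le; first exact: ler0n.
  rewrite -birkhoff_fchar_sqr /S; under eq_bigr do rewrite -fchar_iter.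
  by [].
rewrite ED ?EZ ?E_cst; try exact: rint_cst; try (by apply: cbnd_rint_normX);
  last by apply: rintZ; exact: cbnd_rint_normX.
rewrite lerD2l /T trigpoly_parseval; last 2 first.
- exact: index_enum_uniq.
- by move=> h h' _ _ [] /(mulIf n0)[]; exact: val_inj.
have := @Weyl_sum_bound R al p q N `|n|%N _ N0 Nq pq hal.
rewrite absz_gt0 => /(_ n0); set W := (X in X <= _) => hW.
suff : \sum_(h < N) normc (C h) ^+ 2 <= W by move: hW; lra.
under eq_bigr do rewrite normc_correlation.
(* Lags start at 1 while the Weyl sum starts at 0: its extra term at 0 is nonnegative, and the term
   at [N] is an empty kernel. *)
pose G (h : nat) := normc (Dk (N - h) (`|n|%:R * h%:R * al)) ^+ 2.
have : \sum_(h < N.+1) G h = W.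
  by rewrite big_ord_recr/= /G subnn /Dk big_ord0 normc0 expr0n addr0.
by rewrite big_ord_recl/= => <-; rewrite lerDr sqr_ge0.
Qed.

(** 576 is [64 * 9], the 9 coming from [q <= 3 N] for [N] the integer half of [q]. *)
Definition C4 : R := 2 + 576 * Kd.

(** The order of quantifiers matters: one arbitrarily large [N] serves all characters at once, with
    a bound linear in [|n|]. *)
Lemma fourth_moment (B : nat) : irrational al ->
  exists2 N, (B <= N)%N /\ (0 < N)%N & forall a n, n != 0 ->
  E (fun z => normc (\sum_(k < N) fchar a n (iter k f z)) ^+ 4) <=
    C4 * `|n|%:R * N%:R ^+ 2.
Proof.
move=> ial; have [q [p [Bq q0 pq hq]]] := Dirichlet_approximation (2 * B + 2)%N ial.
have hN := odd_double_half q; pose N := q./2.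
exists N; first by split; rewrite /N; lia.
move=> a n n0; have N0 : (0 < N)%N by rewrite /N; lia.
apply: le_trans (fourth_moment_le (p := p) (q := q) a n0 N0 _ pq hq) _.
  by rewrite /N; lia.
have n1 : 1 <= `|n|%:R :> R by rewrite ler1n absz_gt0.
have q3 : q%:R ^+ 2 <= 9 * N%:R ^+ 2 :> R.
  rewrite -!natrX -natrM ler_nat (_ : 9 * N ^ 2 = (3 * N) ^ 2)%N ?leq_sqr; last by ring.
  by rewrite /N; lia.
have K0 := @Kd_ge0 R.
have : `|n|%:R * Kd * q%:R ^+ 2 <= `|n|%:R * Kd * (9 * N%:R ^+ 2) :> R.
  by rewrite ler_wpM2l// mulr_ge0.
have : N%:R ^+ 2 <= `|n|%:R * N%:R ^+ 2 :> R.
  by rewrite ler_peMl// sqr_ge0.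
by rewrite /C4; set x := _ * N%:R ^+ 2; move=> h1 h2; nra.
Qed.

End FourthMoment.

(** * Uniqueness of Fourier coefficients *)

Section SignIteration.
Context {R : realType}.
Implicit Types x : R.

(** An odd cubic mapping [[-1, 1]] to itself whose iterates converge there to the sign function:
    discontinuous functions are reached from polynomials by bounded pointwise limits. *)
Definition sign_step x : R := x * (3 - x ^+ 2) / 2.

Lemma sign_step_bound x : `|x| <= 1 -> `|sign_step x| <= 1.
Proof.
rewrite !ler_norml /sign_step => /andP[x1 x2].
have h1 : 0 <= (1 - x) ^+ 2 * (2 + x) by rewrite mulr_ge0 ?sqr_ge0//; lra.
have h2 : 0 <= (1 + x) ^+ 2 * (2 - x) by rewrite mulr_ge0 ?sqr_ge0//; lra.
by apply/andP; split; nra.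
Qed.

Lemma iter_sign_step_bound n x : `|x| <= 1 -> `|iter n sign_step x| <= 1.
Proof. by move=> x1; elim: n => // n IH; rewrite iterS; exact: sign_step_bound. Qed.

Lemma iter_sign_stepN n x : iter n sign_step (- x) = - iter n sign_step x.
Proof. by elim: n => // n IH; rewrite !iterS IH /sign_step sqrrN; ring. Qed.

Lemma iter_sign_step_cvg x : `|x| <= 1 ->
  (iter n sign_step x) @[n --> \oo] --> Num.sg x.
Proof.
have pos (y : R) : 0 < y <= 1 -> (iter n sign_step y) @[n --> \oo] --> (1 : R).
  move=> /andP[y0 y1].
  (* The identity [1 - sign_step s = (1 - s) (1 - (s + s ^ 2) / 2)] gives a contraction towards 1 by
     the factor [1 - y / 2] as long as the iterates stay above [y]. *)
  have bd n : y <= iter n sign_step y <= 1 /\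
      1 - iter n sign_step y <= (1 - y / 2) ^+ n.
    elim: n => [|n [/andP[h1 h2] h3]]; first by rewrite /= lexx y1 expr0; split=> //; lra.
    rewrite iterS exprS; set s := iter n sign_step y in h1 h2 h3 *.
    have h4 : 1 - sign_step s <= (1 - y / 2) * (1 - s).
      have : 0 <= (1 - s) * ((s - y) + s ^+ 2).
        by rewrite mulr_ge0 ?subr_ge0// addr_ge0 ?sqr_ge0// subr_ge0.
      rewrite /sign_step; nra.
    split; last by rewrite (le_trans h4)// ler_wpM2l//; lra.
    apply/andP; split.
      apply: (le_trans h1).
      have : 0 <= s * ((1 - s) * (1 + s)) by rewrite !mulr_ge0 ?subr_ge0//; lra.
      by rewrite /sign_step; nra.
    have : `|s| <= 1 by rewrite ger0_norm//; lra.
    by move=> /sign_step_bound; rewrite ler_norml => /andP[].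
  apply: (@squeeze_cvgr _ _ _ _ (fun n => 1 - (1 - y / 2) ^+ n) (fun=> 1)).
  - by apply: nearW => n; have [/andP[_ ->] h] := bd n; rewrite andbT; lra.
  - rewrite -[X in _ --> X]subr0; apply: cvgB; first exact: cvg_cst.
    by apply: cvg_expr; rewrite ger0_norm; lra.
  - exact: cvg_cst.
move=> x1; have [x0|x0|x0] := ltgtP x 0.
- rewrite ltr0_sg// (_ : (fun n => _) = (fun n => - iter n sign_step (- x))).
    by apply: cvgN; apply: pos; rewrite oppr_gt0 x0/= (le_trans _ x1)// ltr0_norm.
  by apply/funext => n; rewrite iter_sign_stepN opprK.
- by rewrite gtr0_sg//; apply: pos; rewrite x0 (le_trans _ x1)// gtr0_norm.
- rewrite x0 sgr0; under eq_cvg => n.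
    rewrite (_ : iter n sign_step 0 = 0); last first.
      by elim: n => // n IH; rewrite iterS IH /sign_step mul0r mul0r.
    over.
  exact: cvg_cst.
Qed.

End SignIteration.

Section Uniqueness.
Context {R : realType}.
Local Notation T1 := (measurableTypeR R).
Local Notation T2 := (measurableTypeR R * measurableTypeR R)%type.
Implicit Types (g p : R * R -> R[i]) (r : R * R -> R).

Lemma E_dominated (h_ : nat -> R * R -> R) (h k : R * R -> R) :
  (forall n, rmeasurable (h_ n)) -> rmeasurable h -> rint k ->
  (forall n z, `|h_ n z| <= k z) -> (forall z, h_ n z @[n --> \oo] --> h z) ->
  E (h_ n) @[n --> \oo] --> E h.
Proof.
move=> mh_ mh ik hk hh.
have mE j : rmeasurable j ->
    measurable_fun (unit_square : set T2) (EFin \o j : T2 -> \bar R).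
  by move=> mj; apply/measurable_EFinP; apply: measurable_funS mj.
have F := @leb2_ae_filter R.
have [||ih _ cv] := @dominated_convergence _ _ _ (@leb2 R) unit_square
  (@measurable_unit_square R) (fun n => EFin \o h_ n) (EFin \o h) (EFin \o k)
  (fun n => mE _ (mh_ n)) (mE _ mh) _ ik.
- apply: (@filterE _ _ F) => z _; apply: cvg_EFin; first by apply: nearW.
  exact: hh.
- by apply: (@filterE _ _ F) => z n _ /=; rewrite lee_fin.
apply: fine_cvg; rewrite fineK; first exact: cv.
exact: integrable_fin_num.
Qed.

Definition orthall g : Prop := cint g /\ forall a b, fcoef g a b = 0.

(** Multipliers preserving the vanishing of all Fourier coefficients. They contain the characters
    and are stable under sums, products and bounded limits, hence reach the indicators of all Borel
    sets; this takes the place of a density theorem for trigonometric polynomials. *)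
Definition mult p : Prop := forall g, orthall g -> orthall (fun z => g z * p z).

Definition rmult r : Prop := mult (fun z => (r z)%:C).

Lemma mult_fchar a b : mult (fchar a b).
Proof.
move=> g [ig g0]; split; first exact: (cintM ig (cbnd_fchar _ _)).
by move=> c d; rewrite fcoef_fcharM.
Qed.

Lemma multD p q : mult p -> mult q -> mult (fun z => p z + q z).
Proof.
move=> mp mq g og; have [i1 z1] := mp g og; have [i2 z2] := mq g og.
have -> : (fun z => g z * (p z + q z)) = (fun z => g z * p z + g z * q z).
  by apply/funext => z; rewrite mulrDr.
by split; [exact: cintD|move=> a b; rewrite fcoefD// z1 z2 addr0].
Qed.

Lemma multM p q : mult p -> mult q -> mult (fun z => p z * q z).
Proof.
move=> mp mq g og; have := mq _ (mp _ og).
by congr orthall; apply/funext => z; rewrite mulrA.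
Qed.

Lemma mult_cst c : mult (fun=> c).
Proof.
move=> g [ig g0]; have -> : (fun z => g z * c) = (fun z => c * g z).
  by apply/funext => z; rewrite mulrC.
by split; [exact: cintZ|move=> a b; rewrite fcoefZ// g0 mulr0].
Qed.

Lemma rmultD r s : rmult r -> rmult s -> rmult (fun z => r z + s z).
Proof.
move=> mr ms; have := multD mr ms; congr mult; apply/funext => z.
by rewrite rmorphD.
Qed.

Lemma rmultM r s : rmult r -> rmult s -> rmult (fun z => r z * s z).
Proof.
move=> mr ms; have := multM mr ms; congr mult; apply/funext => z.
by rewrite rmorphM.
Qed.

Lemma rmult_cst (c : R) : rmult (fun=> c).
Proof. exact: mult_cst. Qed.

Lemma rmultZ (c : R) r : rmult r -> rmult (fun z => c * r z).
Proof. by apply: rmultM; exact: rmult_cst. Qed.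

Lemma rmultB r s : rmult r -> rmult s -> rmult (fun z => r z - s z).
Proof.
move=> mr /(rmultZ (-1)) ms; have := rmultD mr ms.
by congr rmult; apply/funext => z; rewrite mulN1r.
Qed.

Lemma rmult_eq r s : rmeasurable s -> (forall z, unit_square z -> r z = s z) ->
  rmult r -> rmult s.
Proof.
move=> ms rs mr g og; have [[m1 i1 i2] z1] := mr g og; have [[mg _ _] _] := og.
split.
  split.
  - apply: cmeasurable2M => //; split => //=; exact: measurable_cst.
  - by apply: eq_rint i1 => z zS; rewrite rs.
  - by apply: eq_rint i2 => z zS; rewrite rs.
move=> a b; rewrite -[RHS](z1 a b) !fcoefE.
by apply: eq_torus_int => z zS; rewrite rs.
Qed.

(** Dominated convergence, applied to the real and imaginary parts of [g] times a character. *)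
Lemma rmult_lim (r_ : nat -> R * R -> R) r (M : R) : (forall n, rmult (r_ n)) ->
  (forall n, rmeasurable (r_ n)) -> rmeasurable r ->
  (forall n z, `|r_ n z| <= M) -> (forall z, r_ n z @[n --> \oo] --> r z) ->
  rmult r.
Proof.
move=> mr_ mer_ mer rM rr g og; have [ig g0] := og.
have rM' z : `|r z| <= M.
  have c : `|r_ n z| @[n --> \oo] --> `|r z| by apply: cvg_norm; exact: rr.
  rewrite -(cvg_lim (@Rhausdorff R) c).
  by apply: limr_le; [apply: cvgP c|apply: nearW => n; exact: rM].
have br : cbnd (fun z => (r z)%:C).
  split; first by split => //=; exact: measurable_cst.
  by exists M => z; rewrite normc_real.
split; first exact: cintM.
move=> a b; rewrite fcoefE.
pose h z := g z * fchar (- a) (- b) z.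
have [mh i1 i2] : cint h by exact: (cintM ig (cbnd_fchar _ _)).
have [mh1 mh2] := mh.
have key (k : R * R -> R) : rmeasurable k -> rint k ->
    (forall n, E (fun z => k z * r_ n z) = 0) -> E (fun z => k z * r z) = 0.
  move=> mk ik k0.
  have : E (fun z => k z * r_ n z) @[n --> \oo] --> E (fun z => k z * r z).
    apply: (@E_dominated _ _ (fun z => M * `|k z|)).
    - by move=> n; exact: (measurable_funM mk (mer_ n)).
    - exact: (measurable_funM mk mer).
    - by apply: rintZ; exact: rint_norm.
    - by move=> n z; rewrite normrM mulrC ler_wpM2r.
    - by move=> z; apply: cvgM => //; exact: cvg_cst.
  under eq_cvg do rewrite k0.
  by move=> /(cvg_unique (@Rhausdorff R)) /(_ (cvg_cst 0)).
have zero n : torus_int (fun z => h z * (r_ n z)%:C) = 0.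
  have [_ /(_ a b)] := mr_ n g og; rewrite fcoefE => <-.
  by apply: eq_torus_int => z _; rewrite mulrAC.
transitivity (torus_int (fun z => h z * (r z)%:C)).
  by apply: eq_torus_int => z _; rewrite mulrAC.
rewrite torus_intE; apply: complex_ext => /=.
  transitivity (E (fun z => complex.Re (h z) * r z)).
    by apply: eq_E => z _; rewrite [complex.Re (h z * _)]ReM /= mulr0 subr0.
  apply: key => // n; have := zero n; rewrite torus_intE => -[e _]; rewrite -[RHS]e.
  by apply: eq_E => z _; rewrite [complex.Re (h z * _)]ReM /= mulr0 subr0.
transitivity (E (fun z => complex.Im (h z) * r z)).
  by apply: eq_E => z _; rewrite [complex.Im (h z * _)]ImM /= mulr0 add0r.
apply: key => // n; have := zero n; rewrite torus_intE => -[_ e]; rewrite -[RHS]e.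
by apply: eq_E => z _; rewrite [complex.Im (h z * _)]ImM /= mulr0 add0r.
Qed.

Lemma rmult_cos a b : rmult (fun z => cos (2 * pi * (a%:~R * z.1 + b%:~R * z.2))).
Proof.
have := multM (mult_cst 2^-1) (multD (mult_fchar a b) (mult_fchar (- a) (- b))).
congr mult; apply/funext => z; rewrite -fcharJ fcharE /ex.
by apply: complex_ext; rewrite /= ?ReM ?ImM /= ?ReD ?ImD /=; field.
Qed.

Lemma rmult_sin a b : rmult (fun z => sin (2 * pi * (a%:~R * z.1 + b%:~R * z.2))).
Proof.
have := multM (mult_cst (0 -i* 2^-1)) (multD (mult_fchar a b)
  (multM (mult_cst (-1)) (mult_fchar (- a) (- b)))).
congr mult; apply/funext => z; rewrite -fcharJ fcharE /ex mulN1r.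
by apply: complex_ext; rewrite /= ?ReM ?ImM /= ?ReD ?ImD /=; field.
Qed.

Lemma rmeasurable_sign_step n r : rmeasurable r ->
  rmeasurable (fun z => iter n sign_step (r z)).
Proof.
move=> mr; elim: n => // n IH; rewrite /rmeasurable /= /sign_step.
apply: measurable_funM; last exact: measurable_cst.
apply: measurable_funM => //; apply: measurable_funB; first exact: measurable_cst.
exact: measurable_funX.
Qed.

Lemma rmult_sign r : rmeasurable r -> (forall z, `|r z| <= 1) -> rmult r ->
  rmeasurable (fun z => Num.sg (r z)) /\ rmult (fun z => Num.sg (r z)).
Proof.
move=> mer r1 mr.
have mn n := rmeasurable_sign_step n mer.
have cv z := iter_sign_step_cvg (r1 z).
have ms : rmeasurable (fun z => Num.sg (r z)).
  exact: (measurable_fun_cvg mn (fun z _ => cv z)).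
split => //; apply: (rmult_lim (r_ := fun n z => iter n sign_step (r z)) (M := 1)) => //.
  elim=> [//|n IH]; have h := rmultZ 2^-1 (rmultM IH (rmultB (rmult_cst 3) (rmultM IH IH))).
  by move: h; congr rmult; apply/funext => z /=; rewrite /sign_step; field.
by move=> n z; exact: iter_sign_step_bound.
Qed.

(** These sets are shown to form a sigma-algebra containing the generators of the product one. *)
Definition mset (A : set T2) : Prop := measurable A /\ rmult (\1_A : T2 -> R).

Lemma rmeasurable_indic (A : set T2) : measurable A -> rmeasurable (\1_A : T2 -> R).
Proof. by move=> mA; exact: measurable_indic. Qed.

Lemma mset_eq (A B : set T2) : measurable B ->
  (forall z, unit_square z -> A z <-> B z) -> mset A -> mset B.
Proof.
move=> mB AB [mA rA]; split=> //; apply: rmult_eq rA; first exact: rmeasurable_indic.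
move=> z zS; rewrite !indicE (_ : (z \in A) = (z \in B))//.
by apply/idP/idP; rewrite !inE => /(AB z zS).
Qed.

Lemma msetC (A : set T2) : mset A -> mset (~` A).
Proof.
move=> [mA rA]; split; first exact: measurableC.
have := rmultB (rmult_cst 1) rA; congr rmult; apply/funext => z.
by rewrite !indicE in_setC; case: (z \in A); rewrite /= ?subrr ?subr0.
Qed.

Lemma msetT : mset setT.
Proof.
split; first exact: measurableT.
by have := rmult_cst 1; congr rmult; apply/funext => z; rewrite indicE in_setT.
Qed.

Lemma msetI (A B : set T2) : mset A -> mset B -> mset (A `&` B).
Proof.
move=> [mA rA] [mB rB]; split; first exact: measurableI.
have := rmultM rA rB; congr rmult; apply/funext => z.
by rewrite !indicE in_setI; case: (z \in A); case: (z \in B); rewrite /= ?mulr0 ?mul0r ?mulr1.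
Qed.

Lemma mset_bigcap (F : nat -> set T2) : (forall n, mset (F n)) -> mset (\bigcap_n F n).
Proof.
move=> mF; pose G n := \big[setI/setT]_(i < n) F i.
have mG n : mset (G n).
  by rewrite /G; elim/big_ind: _ => //; [exact: msetT|exact: msetI].
have mcap : measurable (\bigcap_n F n) by apply: bigcapT_measurable => n; case: (mF n).
split => //; apply: (rmult_lim (r_ := fun n => \1_(G n)) (M := 1)).
- by move=> n; case: (mG n).
- by move=> n; apply: rmeasurable_indic; case: (mG n).
- exact: rmeasurable_indic.
- by move=> n z; rewrite indicE; case: (_ \in _); rewrite ?normr1 ?normr0.
move=> z; rewrite indicE; have [/set_mem h|/negP h] := boolP (z \in \bigcap_n F n).
  under eq_cvg => n.
    rewrite indicE mem_set; first over.
    by rewrite /G -bigcap_mkord => i _; exact: h.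
  exact: cvg_cst.
have [n Fn] : exists n, ~ F n z.
  apply: contrapT => k; apply: h; rewrite inE => n _; apply: contrapT => Fn.
  by apply: k; exists n.
apply: cvg_near_cst; exists n.+1 => // m /= nm.
rewrite indicE memNset// /G => Gz; apply: Fn.
by move: Gz; rewrite (bigD1 (Ordinal nm))//= => -[].
Qed.

Lemma mset_sigma_algebra : sigma_algebra setT mset.
Proof.
split.
- by rewrite -setCT; apply: msetC; exact: msetT.
- by move=> A mA; rewrite setTD; exact: msetC.
- move=> F mF; rewrite -[X in mset X]setCK; apply: msetC.
  by rewrite setC_bigcup; apply: mset_bigcap => n; exact: msetC.
Qed.

Definition coordinate (i : bool) (z : R * R) : R := if i then z.2 else z.1.

Lemma rmeasurable_coordinate i : rmeasurable (coordinate i).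
Proof. by case: i; [exact: measurable_snd|exact: measurable_fst]. Qed.

(* On [0, 1), [sin (pi (x - c)) sin (pi x)] is positive exactly when [c < x]. *)
Lemma mset_ray i (c : R) : mset [set z | c < coordinate i z].
Proof.
have mi : measurable [set z : T2 | c < coordinate i z].
  have := rmeasurable_coordinate i measurableT (measurable_itv `]c, +oo[).
  by rewrite setTI; congr measurable; apply/seteqP; split => z /=; rewrite in_itv/= andbT.
have [c0|c0] := ltP c 0.
  apply: mset_eq msetT => // z [z1 z2]; split => // _ /=.
  move: z1 z2; rewrite /unit_interval/= !in_itv/= => /andP[z1 _] /andP[z2 _].
  by rewrite /coordinate; case: i {mi}; exact: lt_le_trans c0 _.
have [c1|c1] := leP 1 c.
  apply: mset_eq (msetC msetT) => // z [z1 z2]; split => //= h; exfalso.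
  move: z1 z2; rewrite /unit_interval/= !in_itv/= => /andP[_ z1] /andP[_ z2].
  by move: h; rewrite /coordinate; case: i {mi} => h; lra.
pose a : int := if i then 0 else 1; pose b : int := if i then 1 else 0.
have ab z : a%:~R * z.1 + b%:~R * z.2 = coordinate i z :> R.
  by rewrite /a /b /coordinate; case: i {mi a b}; rewrite mul0r mul1r ?addr0 ?add0r.
pose p z : R := sin (pi * (coordinate i z - c)) * sin (pi * coordinate i z).
(* Product-to-sum formula: each factor changes sign under a unit translation, but the product is a
   trigonometric polynomial of period 1, hence a multiplier. *)
have pE z : p z = 2^-1 * (cos (pi * c) - cos (pi * c) * cos (2 * pi * coordinate i z)
    - sin (pi * c) * sin (2 * pi * coordinate i z)).
  rewrite /p; set t := coordinate i z.
  rewrite (_ : 2 * pi * t = (pi * t) *+ 2); last by ring.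
  rewrite cos_mulr2n sin_mulr2n mulrBr sinB.
  have := cos2sin2 (pi * t); set C := cos (pi * t); set S := sin (pi * t) => h.
  by rewrite h; field.
have mp : rmeasurable p.
  have ms := continuous_measurable_fun (@continuous_sin R).
  apply: measurable_funM; apply: (measurableT_comp ms).
    apply: (measurable_funM (measurable_cst _)).
    exact: (measurable_funB (rmeasurable_coordinate i) (measurable_cst _)).
  exact: (measurable_funM (measurable_cst _) (rmeasurable_coordinate i)).
have rp : rmult p.
  have := rmultZ 2^-1 (rmultB (rmultB (rmult_cst (cos (pi * c)))
    (rmultZ (cos (pi * c)) (rmult_cos a b))) (rmultZ (sin (pi * c)) (rmult_sin a b))).
  by congr rmult; apply/funext => z; rewrite pE ab.
have p1 z : `|p z| <= 1.
  rewrite normrM -[leRHS]mulr1 ler_pM//; exact: sin_max.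
have [msg rsg] := rmult_sign mp p1 rp.
(* On [-1], [0], [1] the polynomial [(t + t ^ 2) / 2] is 1 only at [t = 1], which turns the sign of
   [p] into the indicator. *)
split => //; apply: rmult_eq (rmultZ 2^-1 (rmultD rsg (rmultM rsg rsg))).
  exact: rmeasurable_indic.
move=> z zS; rewrite indicE.
have /andP[t0 t1] : 0 <= coordinate i z < 1.
  by move: zS => -[]; rewrite /unit_interval/= !in_itv/= /coordinate; case: i {mi a b ab p pE mp rp p1 msg rsg}.
have pi0 := pi_gt0 R.
set t := coordinate i z in t0 t1 *.
have [ct|tc] := ltP c t.
  rewrite mem_set//= mulr1n gtr0_sg; first by field.
  have tpos : 0 < t by exact: le_lt_trans ct.
  rewrite /p -/t mulr_gt0// sin_gt0_pi//.
    by rewrite mulr_gt0 ?subr_gt0//= -[ltRHS]mulr1 ltr_pM2l//; lra.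
  by rewrite mulr_gt0//= -[ltRHS]mulr1 ltr_pM2l.
rewrite memNset /=; last by apply/negP; rewrite -leNgt.
have : p z <= 0.
  rewrite /p -/t -opprB mulrN sinN mulNr oppr_le0 mulr_ge0// sin_ge0_pi//.
    by apply/andP; split; [rewrite mulr_ge0 ?subr_ge0// ltW|rewrite ler_piMr ?(ltW pi0)//; lra].
  by apply/andP; split; [rewrite mulr_ge0// ltW|rewrite ler_piMr ?(ltW pi0)//; lra].
rewrite le_eqVlt => /orP[/eqP ->|p0]; first by rewrite sgr0 mul0r addr0 mulr0.
by rewrite ltr0_sg// mulrNN mulr1 addNr mulr0.
Qed.

Lemma mset_coordinate i (A : set T1) : measurable A -> mset (coordinate i @^-1` A).
Proof.
rewrite [X in X A](_ : _ = <<s @RGenOInfty.G R >>); last exact: RGenOInfty.measurableE.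
have [S0 SC SU] := mset_sigma_algebra.
have sa : sigma_algebra setT [set A : set T1 | mset (coordinate i @^-1` A)].
  split => /=.
  - by rewrite preimage_set0.
  - by move=> B /SC; rewrite !setTD preimage_setC.
  - by move=> F /SU; rewrite preimage_bigcup.
move: A; apply: smallest_sub => // _ [c ->] /=.
have := mset_ray i c; congr mset; apply/seteqP.
by split => z /=; rewrite in_itv/= andbT.
Qed.

Lemma mset_measurable (A : set T2) : measurable A -> mset A.
Proof.
move: A; apply: smallest_sub; first exact: mset_sigma_algebra.
move=> A [] [B mB <-]; rewrite setTI.
  exact: (mset_coordinate false mB).
exact: (mset_coordinate true mB).
Qed.

Lemma E_abs_ae0 (h : R * R -> R) : rmeasurable h -> rint h ->
  E (fun z => `|h z|) = 0 -> aet (fun z => h z = 0).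
Proof.
move=> mh ih habs.
have mhE : measurable_fun (unit_square : set T2) (EFin \o h : T2 -> \bar R).
  by apply/measurable_EFinP; apply: measurable_funS mh.
have /(ae_eq_integral_abs leb2 measurable_unit_square mhE) :
    (\int[leb2]_(z in unit_square) `|(EFin \o h) z| = 0)%E.
  rewrite -[LHS]fineK; first by congr (_%:E); exact: habs.
  exact: (integrable_fin_num measurable_unit_square (rint_norm ih)).
by apply: (@filterS _ _ (@leb2_ae_filter R)) => z hz /hz [].
Qed.

(** Testing on [A = {h > 0}] and on the whole space gives the integral of [|h| = 2 h 1_A - h]. *)
Lemma E_indic_ae0 (h : R * R -> R) : rmeasurable h -> rint h ->
  (forall A : set T2, measurable A -> E (fun z => h z * \1_A z) = 0) ->
  aet (fun z => h z = 0).
Proof.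
move=> mh ih h0; pose A := [set z : T2 | 0 < h z].
have mA : measurable A.
  have := mh measurableT _ (measurable_itv `]0, +oo[).
  by rewrite setTI; congr measurable; apply/seteqP; split => z /=; rewrite in_itv/= andbT.
have habs : E (fun z => `|h z|) = 0.
  have e : E (fun z => h z) = 0.
    rewrite -[RHS](h0 setT measurableT); apply: eq_E => z _.
    by rewrite indicE in_setT mulr1.
  have i2 : rint (fun z => h z * \1_A z).
    apply: (@rintM_bounded _ _ _ 1) => //; first exact: rmeasurable_indic.
    by move=> z; rewrite indicE; case: (_ \in _); rewrite ?normr1 ?normr0.
  transitivity (E (fun z => 2 * (h z * \1_A z) - h z)).
    apply: eq_E => z _; rewrite indicE; have [hz|hz] := ltP 0 (h z).
      by rewrite mem_set//= mulr1n gtr0_norm//; ring.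
    by rewrite memNset ?ler0_norm//= ?mulr0 ?sub0r//; apply/negP; rewrite -leNgt.
  by rewrite EB ?EZ ?h0 ?e ?mulr0 ?subr0//; exact: rintZ.
exact: E_abs_ae0.
Qed.

(** Every indicator is a multiplier, so the coefficient of index [(0, 0)] of [g 1_A], which is the
    integral of [g] over [A], vanishes. *)
Theorem fourier_uniqueness g : orthall g -> aet (fun z => g z = 0).
Proof.
move=> og; have [[[m1 m2] r1 i1] _] := og.
have key (A : set T2) : measurable A -> torus_int (fun z => g z * (\1_A z)%:C) = 0.
  move=> /mset_measurable[_ /(_ g og)[_ /(_ 0 0)]] <-.
  by rewrite fcoefE; apply: eq_torus_int => z _; rewrite oppr0 fchar0 mulr1.
have hr : aet (fun z => complex.Re (g z) = 0).
  apply: E_indic_ae0 => // A mA.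
  have := key A mA; rewrite torus_intE => -[e _]; rewrite -[RHS]e.
  by apply: eq_E => z _; rewrite ReM /= mulr0 subr0.
have hi : aet (fun z => complex.Im (g z) = 0).
  apply: E_indic_ae0 => // A mA.
  have := key A mA; rewrite torus_intE => -[_ e]; rewrite -[RHS]e.
  by apply: eq_E => z _; rewrite ImM /= mulr0 add0r.
apply: aetS (aetI hr hi) => z [h1 h2].
exact: complex_ext.
Qed.

End Uniqueness.

(** * Absolutely convergent Fourier series *)

Section UnorderedSums.
Context {R : realType}.

Lemma ler_sum_uniq_sub (I : eqType) (h : I -> R) (r s : seq I) :
  (forall i, 0 <= h i) -> uniq r -> {subset r <= s} ->
  \sum_(i <- r) h i <= \sum_(i <- s) h i.
Proof.
move=> h0; elim: r s => [|x r IH] s /=; first by rewrite big_nil sumr_ge0.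
move=> /andP[xr ur] rs; rewrite big_cons.
have xs : x \in s by apply: rs; exact: mem_head.
rewrite [leRHS](big_rem x)//= lerD2l; apply: IH => // y yr.
have ys : y \in s by apply: rs; rewrite in_cons yr orbT.
have : y \in x :: rem x s by rewrite -(perm_mem (perm_to_rem xs)).
by rewrite in_cons => /orP[/eqP yx|//]; rewrite -yx yr in xr.
Qed.

(* For nonnegative [h], unordered summability with sum at most [A]. *)
Definition sumle (I : eqType) (h : I -> R) (A : R) : Prop :=
  forall r : seq I, uniq r -> \sum_(i <- r) h i <= A.

Lemma sumle_ge0 (I : eqType) (h : I -> R) A : sumle h A -> 0 <= A.
Proof. by move=> /(_ [::] isT); rewrite big_nil. Qed.

Lemma sumle_le (I : eqType) (h k : I -> R) A : (forall i, h i <= k i) ->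
  sumle k A -> sumle h A.
Proof. by move=> hk kA r /kA; apply: le_trans; exact: ler_sum. Qed.

Lemma sumleD (I : eqType) (h k : I -> R) A B : sumle h A -> sumle k B ->
  sumle (fun i => h i + k i) (A + B).
Proof. by move=> hA kB r ur; rewrite big_split lerD//; [exact: hA|exact: kB]. Qed.

Lemma sumleZ (I : eqType) (h : I -> R) A c : 0 <= c -> sumle h A ->
  sumle (fun i => c * h i) (c * A).
Proof. by move=> c0 hA r ur; rewrite -mulr_sumr ler_wpM2l//; exact: hA. Qed.

Lemma sumle_inj (I J : eqType) (h : I -> R) A (k : J -> I) : injective k ->
  sumle h A -> sumle (h \o k) A.
Proof.
move=> kinj hA r ur; have := hA (map k r); rewrite map_inj_uniq// => /(_ ur).
by rewrite big_map.
Qed.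

(** [r0] is a finite family whose sum is within [e] of the supremum; a disjoint family can add at
    most [e]. *)
Lemma sumle_tail (I : eqType) (h : I -> R) A : (forall i, 0 <= h i) -> sumle h A ->
  forall e, 0 < e -> exists2 r0, uniq r0 &
    forall r, uniq r -> (forall i, i \in r -> i \notin r0) -> \sum_(i <- r) h i <= e.
Proof.
move=> h0 hA e e0; pose S := [set x | exists2 r, uniq r & x = \sum_(i <- r) h i].
have hS : has_sup S.
  split; first by exists 0, [::]; rewrite ?big_nil.
  by exists A => _ [r ur ->]; exact: hA.
have [_ [r0 ur0 ->] hr0] := sup_adherent e0 hS.
exists r0 => // r ur rr0.
have : \sum_(i <- r0 ++ r) h i <= sup S.
  apply: ub_le_sup; first by case: hS.
  exists (r0 ++ r) => //; rewrite cat_uniq ur0 ur andbT/=.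
  by apply/hasPn => i ir; exact: rr0.
by rewrite big_cat/=; lra.
Qed.

Lemma sumle_nat (h : nat -> R) A : (forall n, 0 <= h n) ->
  (forall N, \sum_(n < N) h n <= A) -> sumle h A.
Proof.
move=> h0 hA r ur; apply: le_trans (hA (\max_(i <- r) i).+1).
rewrite -(big_mkord xpredT h); apply: ler_sum_uniq_sub => // i ir.
by rewrite mem_index_iota/= ltnS (leq_bigmax_seq (F := id)).
Qed.

Lemma sumle_int (h : int -> R) A B : (forall n, 0 <= h n) ->
  sumle (fun n : nat => h n) A -> sumle (fun n => h (Negz n)) B -> sumle h (A + B).
Proof.
move=> h0 hA hB r ur.
rewrite (bigID (fun a : int => 0 <= a))/= -big_filter -[X in _ + X]big_filter.
apply: lerD.
  set s := [seq a <- r | _]; have us : uniq s by rewrite filter_uniq.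
  have sE a : a \in s -> a = `|a|%N by rewrite mem_filter => /andP[a0 _]; rewrite gez0_abs.
  have := hA (map absz s); rewrite big_map.
  have -> : \sum_(a <- s) h a = \sum_(a <- s) h `|a|%N.
    by apply: eq_big_seq => a /sE {1}->.
  apply; rewrite map_inj_in_uniq// => a b /sE aE /sE bE ab.
  by rewrite aE bE ab.
set s := [seq a <- r | _]; have us : uniq s by rewrite filter_uniq.
have sE a : a \in s -> a = Negz `|a|.-1.
  rewrite mem_filter => /andP[a0 _]; rewrite NegzE prednK ?absz_gt0; last by lia.
  by rewrite ltz0_abs ?opprK// ltNge.
have := hB (map (fun a => `|a|.-1) s); rewrite big_map.
have -> : \sum_(a <- s) h a = \sum_(a <- s) h (Negz `|a|.-1).
  by apply: eq_big_seq => a /sE {1}->.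
apply; rewrite map_inj_in_uniq// => a b /sE aE /sE bE ab.
by rewrite aE bE ab.
Qed.

Lemma sumle_prod (I J : eqType) (h : I -> R) (k : J -> R) A B :
  (forall i, 0 <= h i) -> (forall j, 0 <= k j) -> sumle h A -> sumle k B ->
  sumle (fun ij : I * J => h ij.1 * k ij.2) (A * B).
Proof.
move=> h0 k0 hA kB r ur.
pose s := [seq (i, j) | i <- undup (map fst r), j <- undup (map snd r)].
apply: (@le_trans _ _ (\sum_(ij <- s) h ij.1 * k ij.2)).
  apply: ler_sum_uniq_sub => // [i|[i j] ijr]; first by rewrite mulr_ge0.
  by apply/allpairsP; exists (i, j); rewrite !mem_undup; split => //;
    [apply/mapP; exists (i, j)|apply/mapP; exists (i, j)].
rewrite /s big_allpairs/=.
under eq_bigr do rewrite -mulr_sumr.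
rewrite -mulr_suml ler_pM ?sumr_ge0//; first exact/hA/undup_uniq.
exact/kB/undup_uniq.
Qed.

Lemma esum_sumle (I : choiceType) (h : I -> R) A : (forall i, 0 <= h i) ->
  sumle h A -> (\esum_(i in [set: I]) (h i)%:E <= A%:E)%E.
Proof.
move=> h0 hA; apply: ge_ereal_sup => _ [F [finF _] <-].
have /finite_seqP[r0 Fr0] := finF; pose r := undup r0.
have -> : F = [set` r] by rewrite Fr0; apply/seteqP; split => i /=; rewrite mem_undup.
by rewrite -fsbig_seq ?undup_uniq// sumEFin lee_fin hA// undup_uniq.
Qed.

Lemma sumle_esum (I : choiceType) (h : I -> R) : (forall i, 0 <= h i) ->
  (\esum_(i in [set: I]) (h i)%:E < +oo)%E ->
  sumle h (fine (\esum_(i in [set: I]) (h i)%:E)%E).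
Proof.
move=> h0 hfin r ur; rewrite -lee_fin fineK; last first.
  by rewrite ge0_fin_numE// esum_ge0// => i _; rewrite lee_fin.
rewrite -sumEFin fsbig_seq//; apply: ereal_sup_ubound.
by exists [set` r] => //; split => //; exact: finite_seq.
Qed.

(** Comparison with the telescoping differences of [n ^ (- q)], where [q = 2 p - 1 > 0]. *)
Lemma sumle_powR (p : R) : 2^-1 < p ->
  exists A, sumle (fun a : int => (1 + a%:~R ^+ 2) `^ (- p)) A.
Proof.
move=> p2; pose q := 2 * p - 1; have q0 : 0 < q by rewrite /q; lra.
pose h (n : nat) : R := (1 + n%:R ^+ 2) `^ (- p).
have h0 n : 0 <= h n by exact: powR_ge0.
pose T (n : nat) : R := n%:R `^ (- q).
(* With [y = x - 1] this rests on [x ^ (- q - 1) <= (y ^ (- q) - x ^ (- q)) / q], which comes from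
   [(1 - 1 / x) ^ (- q) >= 1 + q / x]. The first two terms are set apart so that [y] is positive. *)
have step n : h n.+2 <= q^-1 * (T n.+1 - T n.+2).
  rewrite /h /T; set x : R := n.+2%:R; set y : R := n.+1%:R.
  have y0 : 0 < y by rewrite /y ltr0n.
  have x0 : 0 < x by rewrite /x ltr0n.
  have yx : y / x = 1 + - x^-1.
    have -> : y = x - 1 by rewrite /x /y -[n.+2%:R]natr1 addrK.
    by rewrite mulrBl mulfV ?gt_eqF// mul1r.
  apply: (@le_trans _ _ (x `^ (- q) * x^-1)).
    have e : x `^ q * x = (x ^+ 2) `^ p.
      rewrite -{2}(powRr1 (ltW x0)) -powRD; last by rewrite (gt_eqF x0) implybT.
      by rewrite -powR_mulrn ?ltW// -powRrM; congr powR; rewrite /q; ring.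
    rewrite !powRN -invfM e lef_pV2 ?posrE ?powR_gt0 ?exprn_gt0//; last first.
      by rewrite ltr_wpDr// sqr_ge0.
    by rewrite ge0_ler_powR ?nnegrE ?addr_ge0 ?sqr_ge0 ?lerDr//; lra.
  rewrite ler_pdivlMl//.
  have -> : y `^ (- q) = x `^ (- q) * (y / x) `^ (- q).
    by rewrite -powRM ?divr_ge0 ?ltW// mulrC divfK// gt_eqF.
  rewrite -[X in _ <= _ - X]mulr1 -mulrBr mulrCA ler_wpM2l ?powR_ge0//.
  rewrite lerBrDl /powR gt_eqF ?divr_gt0//.
  apply: le_trans (expR_ge1Dx _); rewrite lerD2l mulNr -mulrN (ler_wpM2l (ltW q0))//.
  rewrite yx lerNr; apply: le_ln1Dx; by rewrite ltrN2 invf_lt1// /x ltr1n.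
have bd N : \sum_(n < N) h n <= h 0 + h 1 + q^-1.
  have T0 n : 0 <= T n by exact: powR_ge0.
  have q1 : 0 <= q^-1 by rewrite invr_ge0 ltW.
  have : \sum_(n < N.+2) h n <= h 0 + h 1 + q^-1 * (T 1 - T N.+1).
    elim: N => [|N IH].
      by rewrite 2!big_ord_recr big_ord0/= add0r subrr mulr0 addr0.
    rewrite big_ord_recr/=; have := step N; move: IH.
    rewrite !mulrBr; set a := q^-1 * T N.+1; set b := q^-1 * T N.+2; lra.
  have -> : T 1 = 1 by rewrite /T powR1.
  have := mulr_ge0 q1 (T0 N.+1).
  have : \sum_(n < N) h n <= \sum_(n < N.+2) h n.
    by apply: ler_sum_widen => //; lia.
  rewrite mulrBr mulr1; lra.
exists (h 0 + h 1 + q^-1 + (h 0 + h 1 + q^-1)); apply: sumle_int.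
- by move=> n; exact: powR_ge0.
- exact: sumle_nat.
- have := sumle_inj succn_inj (sumle_nat h0 bd); apply: sumle_le => n /=.
  by rewrite /h NegzE intrN sqrrN.
Qed.

End UnorderedSums.

Section ComplexLimits.
Context {R : realType}.
Implicit Types (u v : nat -> R[i]) (L M : R[i]).

(** Phrased with the real modulus [normc], so that real estimates apply without passing through the
    norm of [R[i]]. *)
Definition cto u L : Prop := forall e : R, 0 < e ->
  exists n0, forall n, (n0 <= n)%N -> normc (u n - L) <= e.

Lemma cvgr_dist (u : nat -> R) (l : R) : (forall e : R, 0 < e ->
  exists n0, forall n, (n0 <= n)%N -> `|u n - l| <= e) -> u n @[n --> \oo] --> l.
Proof.
move=> h; apply/cvgrPdist_le => e e0; have [n0 hn] := h e e0.
by exists n0 => // n /= nn; rewrite distrC hn.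
Qed.

Lemma real_cauchy (u : nat -> R) : (forall e : R, 0 < e ->
  exists n0, forall n, (n0 <= n)%N -> `|u n - u n0| <= e) -> cvgn u.
Proof.
move=> h; apply: cauchy_cvg; apply: cauchy_exP => e e0.
have [n0 hn] := h (e / 2) (divr_gt0 e0 (ltr0n _ 2)).
exists (u n0), n0 => // n /= nn; rewrite /ball/= distrC.
by rewrite (le_lt_trans (hn n nn))//; lra.
Qed.

Lemma cto_Re u L : cto u L -> complex.Re (u n) @[n --> \oo] --> complex.Re L.
Proof.
move=> uL; apply: cvgr_dist => e /uL[n0 h]; exists n0 => n /h.
by apply: le_trans; rewrite -ReB normr_Re_le.
Qed.

Lemma cto_Im u L : cto u L -> complex.Im (u n) @[n --> \oo] --> complex.Im L.
Proof.
move=> uL; apply: cvgr_dist => e /uL[n0 h]; exists n0 => n /h.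
by apply: le_trans; rewrite -ImB normr_Im_le.
Qed.

Lemma cto_normc u L : cto u L -> normc (u n) @[n --> \oo] --> normc L.
Proof.
move=> uL; apply: cvgr_dist => e /uL[n0 h]; exists n0 => n /h.
apply: le_trans; rewrite ler_norml lerNl opprB le_normc_sub andbT.
by rewrite normc_distC le_normc_sub.
Qed.

Lemma cto_cauchy u : (forall e : R, 0 < e ->
  exists n0, forall n, (n0 <= n)%N -> normc (u n - u n0) <= e) -> exists L, cto u L.
Proof.
move=> h.
have cr : cvgn (fun n => complex.Re (u n)).
  apply: real_cauchy => e /h[n0 hn]; exists n0 => n /hn; apply: le_trans.
  by rewrite -ReB normr_Re_le.
have ci : cvgn (fun n => complex.Im (u n)).
  apply: real_cauchy => e /h[n0 hn]; exists n0 => n /hn; apply: le_trans.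
  by rewrite -ImB normr_Im_le.
exists (limn (fun n => complex.Re (u n)) +i* limn (fun n => complex.Im (u n))).
move=> e e0; have e2 : 0 < e / 2 by lra.
have /cvgrPdist_le/(_ _ e2)[n1 _ h1] := cr.
have /cvgrPdist_le/(_ _ e2)[n2 _ h2] := ci.
exists (maxn n1 n2) => n; rewrite geq_max => /andP[/h1 + /h2] /=.
rewrite distrC => k1; rewrite distrC => k2.
by rewrite (le_trans (normc_le_ReIm _))// ReB ImB /=; lra.
Qed.

Lemma cto_unique u L M : cto u L -> cto u M -> L = M.
Proof.
move=> uL uM; apply: complex_ext.
  exact: (cvg_unique (@Rhausdorff R) (cto_Re uL) (cto_Re uM)).
exact: (cvg_unique (@Rhausdorff R) (cto_Im uL) (cto_Im uM)).
Qed.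

Lemma cto_cst L : cto (fun=> L) L.
Proof. by move=> e e0; exists 0%N => n _; rewrite subrr normc0 ltW. Qed.

Lemma ctoD u v L M : cto u L -> cto v M -> cto (fun n => u n + v n) (L + M).
Proof.
move=> uL vM e e0; have e2 : 0 < e / 2 by lra.
have [n1 h1] := uL _ e2; have [n2 h2] := vM _ e2.
exists (maxn n1 n2) => n; rewrite geq_max => /andP[/h1 k1 /h2 k2].
by rewrite opprD addrACA (le_trans (le_normcD _ _))//; lra.
Qed.

Lemma ctoZ c u L : cto u L -> cto (fun n => c * u n) (c * L).
Proof.
move=> uL e e0; have c0 := normc_ge0 c.
have ec : 0 < e / (normc c + 1) by rewrite divr_gt0//; lra.
have [n0 h] := uL _ ec.
exists n0 => n /h; rewrite ler_pdivlMr; last by lra.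
by rewrite -mulrBr normcM => k; have := normc_ge0 (u n - L); nra.
Qed.

Lemma cto_shift u L (k : nat) : cto u L -> cto (fun n => u (n + k)%N) L.
Proof.
by move=> uL e /uL[n0 h]; exists n0 => n nn; apply: h; lia.
Qed.

Lemma cto_eq u v L : u =1 v -> cto u L -> cto v L.
Proof. by move=> uv uL e /uL[n0 h]; exists n0 => n /h; rewrite uv. Qed.

Lemma cto_normc_le u L (A : R) : cto u L -> (forall n, normc (u n) <= A) -> normc L <= A.
Proof.
move=> /cto_normc uL h; apply: (ler_cvg_to uL (cvg_cst A)).
by apply: nearW.
Qed.

Lemma csum_cvg (c : nat -> R[i]) (A : R) : sumle (fun k => normc (c k)) A ->
  exists L, cto (fun n => \sum_(k < n) c k) L.
Proof.
move=> cA; apply: cto_cauchy => e e0.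
have [r0 _ hr] := sumle_tail (fun k => normc_ge0 (c k)) cA e0.
exists (\max_(i <- r0) i).+1 => n nn.
set m := (\max_(i <- r0) i).+1 in nn *.
have -> : \sum_(k < n) c k = \sum_(k < m) c k + \sum_(m <= k < n) c k.
  by rewrite -(big_mkord xpredT c) -(big_mkord xpredT c) [LHS](@big_cat_nat _ _ _ m).
rewrite addrC addKr.
apply: le_trans (le_normc_sum _ _ _) _; apply: hr; first exact: iota_uniq.
move=> i; rewrite mem_index_iota => /andP[h _]; apply/negP => ir; move: h.
by rewrite ltnNge (leq_bigmax_seq (F := id)).
Qed.

End ComplexLimits.

Section Boxes.

Definition zr (n : nat) : seq int := [seq i%:Z - n%:Z | i <- iota 0 (2 * n).+1].

Lemma mem_zr n a : (a \in zr n) = (`|a| <= n)%N.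
Proof.
apply/mapP/idP => [[i + ->]|an]; first by rewrite mem_iota; lia.
by exists (absz (a + n%:Z)%R); rewrite ?mem_iota; lia.
Qed.

Lemma zr_uniq n : uniq (zr n).
Proof. by rewrite map_inj_uniq ?iota_uniq// => i j; lia. Qed.

Definition bx (n m : nat) : seq (int * int) := [seq (a, b) | a <- zr n, b <- zr m].

Lemma mem_bx n m k : (k \in bx n m) = ((`|k.1| <= n) && (`|k.2| <= m))%N.
Proof.
case: k => a b /=; rewrite -!mem_zr.
by apply/allpairsP/andP => [[[c d] [/= h1 h2 [-> ->]]]|[h1 h2]]; last exists (a, b).
Qed.

Lemma bx_uniq n m : uniq (bx n m).
Proof. by apply: allpairs_uniq; rewrite ?zr_uniq// => -[? ?] [? ?] _ _ [-> ->]. Qed.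

Lemma sub_bx (r : seq (int * int)) : exists n, {subset r <= bx n n}.
Proof.
elim: r => [|k r [n IH]]; first by exists 0%N.
exists (maxn n (maxn `|k.1| `|k.2|)) => j; rewrite inE => /orP[/eqP ->|/IH].
  by rewrite mem_bx !leq_max !leqnn !orbT.
by rewrite !mem_bx !leq_max => /andP[-> ->].
Qed.

Lemma bx_sub n m n' m' : (n <= n')%N -> (m <= m')%N -> {subset bx n m <= bx n' m'}.
Proof. by move=> h1 h2 k; rewrite !mem_bx; lia. Qed.

Lemma sum_uniq_split (V : zmodType) (I : eqType) (F : I -> V) (r s : seq I) :
  uniq r -> uniq s -> {subset r <= s} ->
  \sum_(i <- s) F i = \sum_(i <- r) F i + \sum_(i <- [seq i <- s | i \notin r]) F i.
Proof.
move=> ur us rs; rewrite -big_cat; apply: perm_big; apply: uniq_perm => //.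
  rewrite cat_uniq ur filter_uniq// andbT; apply/hasPn => i.
  by rewrite mem_filter => /andP[].
move=> i; rewrite mem_cat mem_filter.
by case: (boolP (i \in r)) => //= /rs ->.
Qed.

End Boxes.

Section FourierSeries.
Context {R : realType}.
Implicit Types c : int * int -> R[i].

Definition psum c n : R * R -> R[i] := trigpoly (bx n n) id c.

Lemma fcoef_psum c n a b : (a, b) \in bx n n -> fcoef (psum c n) a b = c (a, b).
Proof.
move=> ab; rewrite fcoef_trigpoly -big_filter (perm_big [:: (a, b)]) ?big_seq1//.
apply: uniq_perm; rewrite ?filter_uniq ?bx_uniq// => k.
by rewrite mem_filter mem_seq1; case: eqP => // ->.
Qed.

(** Weierstrass test over squares of frequencies. Uniformity yields the coefficients of the limit
    and, later, the replacement of [phi] by a partial sum inside Birkhoff sums. *)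
Theorem fourier_series c A : sumle (fun k => normc (c k)) A ->
  exists G : R * R -> R[i], [/\ cbnd G, periodic2 G,
    forall e, 0 < e -> exists n0, forall n z, (n0 <= n)%N -> normc (G z - psum c n z) <= e &
    forall a b, fcoef G a b = c (a, b)].
Proof.
move=> cA.
have unif e : 0 < e -> exists n0, forall m n z, (n0 <= n)%N -> (n <= m)%N ->
    normc (psum c m z - psum c n z) <= e.
  move=> e0; have [r0 _ hr] := sumle_tail (fun k => normc_ge0 (c k)) cA e0.
  have [n0 hn0] := sub_bx r0; exists n0 => m n z nn nm.
  rewrite /psum /trigpoly (sum_uniq_split _ (bx_uniq n n) (bx_uniq m m) (bx_sub nm nm)).
  rewrite addrC addKr (le_trans (le_normc_sum _ _ _))//.
  under eq_bigr do rewrite normcM normc_fchar mulr1.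
  apply: hr; first by rewrite filter_uniq// bx_uniq.
  move=> k; rewrite mem_filter => /andP[+ _]; apply: contra => /hn0.
  exact: bx_sub.
have /choice[G hG] : forall z, exists L, cto (fun n => psum c n z) L.
  move=> z; apply: cto_cauchy => e /unif[n0 h]; exists n0 => n nn.
  exact: h.
have unifG e : 0 < e -> exists n0, forall n z, (n0 <= n)%N -> normc (G z - psum c n z) <= e.
  move=> /unif[n0 h]; exists n0 => n z nn.
  have := ctoD (cto_shift n (hG z)) (cto_cst (- psum c n z)).
  move=> /cto_normc_le; apply => k; apply: h => //; lia.
have mG : cmeasurable2 G.
  split.
    apply: (measurable_fun_cvg (h := fun n z => complex.Re (psum c n z))).
      by move=> n; have [[]] := cbnd_trigpoly (bx n n) id c.
    by move=> z _; exact: cto_Re.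
  apply: (measurable_fun_cvg (h := fun n z => complex.Im (psum c n z))).
    by move=> n; have [[]] := cbnd_trigpoly (bx n n) id c.
  by move=> z _; exact: cto_Im.
have bG : cbnd G.
  split => //; have [n0 h] := unifG 1 ltr01.
  have [_ [M hM]] := cbnd_trigpoly (bx n0 n0) id c.
  exists (1 + M) => z; rewrite -(subrK (psum c n0 z) (G z)).
  by rewrite (le_trans (le_normcD _ _))//; apply: lerD; [exact: h|exact: hM].
exists G; split => //.
  move=> x y; have p n := periodic2_trigpoly (bx n n) id c x y; split.
    apply: cto_unique (hG _); apply: cto_eq (hG _) => n; exact: (p n).1.
  apply: cto_unique (hG _); apply: cto_eq (hG _) => n; exact: (p n).2.
move=> a b; apply/eqP; rewrite -subr_eq0; apply/eqP.
apply: normc_eq0_small => e e0; have e2 : 0 < e / 2 by lra.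
have [n0 h] := unifG _ e2; have [n1 h1] := sub_bx [:: (a, b)].
pose n := maxn n0 n1.
have <- : fcoef (psum c n) a b = c (a, b).
  apply: fcoef_psum; apply: (@bx_sub n1 n1); rewrite ?leq_maxr//.
  by apply: h1; rewrite inE.
have bP := cbnd_trigpoly (bx n n) id c.
rewrite -fcoefB; try exact: cbnd_cint.
rewrite (le_trans (@normc_fcoef_le _ _ (e / 2) _ _ _ _))//; last by lra.
  by case: (cbndB bG bP).
by move=> z; apply: h; rewrite leq_maxl.
Qed.

End FourierSeries.

(** * Weighted Cauchy-Schwarz inequalities and the Sobolev weight *)

Section WeightedSums.
Context {R : realType}.

Lemma weighted_sqr_sum (I : Type) (r : seq I) (p g : I -> R) : (forall i, 0 <= p i) ->
  (\sum_(i <- r) p i * g i) ^+ 2 <= (\sum_(i <- r) p i) * \sum_(i <- r) p i * g i ^+ 2.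
Proof.
move=> p0; have : 0 <= \sum_(i <- r) \sum_(j <- r) p i * p j * (g i - g j) ^+ 2.
  by apply: sumr_ge0 => i _; apply: sumr_ge0 => j _; exact: mulr_ge0 (mulr_ge0 (p0 i) (p0 j)) (sqr_ge0 _).
have -> : \sum_(i <- r) \sum_(j <- r) p i * p j * (g i - g j) ^+ 2 =
    2 * ((\sum_(i <- r) p i) * (\sum_(i <- r) p i * g i ^+ 2) -
         (\sum_(i <- r) p i * g i) ^+ 2).
  set P := \sum_(i <- r) p i; set Q := \sum_(i <- r) p i * g i ^+ 2.
  set T := \sum_(i <- r) p i * g i.
  transitivity (\sum_(i <- r) (p i * g i ^+ 2 * P + p i * Q - 2 * (p i * g i * T))).
    apply: eq_bigr => i _; rewrite /P /Q /T !mulr_sumr -big_split -sumrB.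
    by apply: eq_bigr => j _ /=; ring.
  rewrite sumrB big_split/= -mulr_suml -mulr_suml -mulr_sumr -mulr_suml -/P -/Q -/T.
  by ring.
by lra.
Qed.

(** Weighted Cauchy-Schwarz applied twice. *)
Lemma power_mean4 (I : Type) (r : seq I) (p g : I -> R) : (forall i, 0 <= p i) ->
  (\sum_(i <- r) p i * g i) ^+ 4 <=
  (\sum_(i <- r) p i) ^+ 3 * \sum_(i <- r) p i * g i ^+ 4.
Proof.
move=> p0; set P := \sum_(i <- r) p i.
have P0 : 0 <= P by exact: sumr_ge0.
have h1 := weighted_sqr_sum r g p0.
have h2 := weighted_sqr_sum r (fun i => g i ^+ 2) p0.
rewrite -/P in h1 h2.
have Q0 : 0 <= \sum_(i <- r) p i * g i ^+ 2.
  by apply: sumr_ge0 => i _; rewrite mulr_ge0// sqr_ge0.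
rewrite (_ : 4 = 2 * 2)%N// exprM.
apply: (@le_trans _ _ ((P * \sum_(i <- r) p i * g i ^+ 2) ^+ 2)).
  by rewrite ler_pXn2r ?nnegrE ?sqr_ge0// mulr_ge0.
rewrite exprMn [P ^+ 3]exprSr -mulrA ler_wpM2l ?sqr_ge0//.
by apply: (le_trans h2); under eq_bigr do rewrite -exprM.
Qed.

Definition wt (k : int * int) : R := 1 + k.1%:~R ^+ 2 + k.2%:~R ^+ 2.

Lemma wt_ge1 k : 1 <= wt k.
Proof. by rewrite /wt -addrA lerDl addr_ge0// sqr_ge0. Qed.

Lemma wt_gt0 k : 0 < wt k. Proof. exact: lt_le_trans (wt_ge1 k). Qed.

(** From [(1 + a ^ 2) (1 + b ^ 2) <= wt (a, b) ^ 2]. *)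
Lemma sumle_wt2 : exists A, sumle (fun k => wt k `^ (- 2)) A.
Proof.
have [A hA] := @sumle_powR R 1 ltac:(lra).
exists (A * A); apply: sumle_le (sumle_prod _ _ hA hA) => [[a b]|a|b];
  try exact: powR_ge0.
have a0 : 0 <= a%:~R ^+ 2 :> R by exact: sqr_ge0.
have b0 : 0 <= b%:~R ^+ 2 :> R by exact: sqr_ge0.
rewrite /= -powRM ?addr_ge0// !powRN.
rewrite lef_pV2 ?posrE ?powR_gt0 ?wt_gt0//; last by rewrite mulr_gt0//; lra.
rewrite powRr1; last by rewrite mulr_ge0// addr_ge0.
by rewrite powR_mulrn ?(ltW (wt_gt0 _))// /wt/=; nra.
Qed.

(** By AM-GM [2 x (1 + n) <= w ^ 3 x ^ 2 + (1 + n) ^ 2 / w ^ 3], where [(1 + n) ^ 2 <= 2 w] leaves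
    the summable [2 / w ^ 2]. The factor [1 + |n|] is the one required by the fourth moment
    bound. *)
Lemma sumle_normc_weight (c : int * int -> R[i]) (s A : R) : 3 <= s ->
  sumle (fun k => wt k `^ s * normc (c k) ^+ 2) A ->
  exists B, sumle (fun k => normc (c k) * (1 + `|k.2|%:R)) B.
Proof.
move=> s3 cA; have [B hB] := sumle_wt2.
exists (A + 2 * B); apply: sumle_le (sumleD cA (sumleZ (ler0n R 2) hB)) => k /=.
set x := normc (c k); set n : R := `|k.2|%:R; have w1 := wt_ge1 k.
have w0 := wt_gt0 k; have x0 : 0 <= x by exact: normc_ge0.
have n0 : 0 <= n by exact: ler0n.
have hn : (1 + n) ^+ 2 <= 2 * wt k.
  have -> : wt k = 1 + k.1%:~R ^+ 2 + n ^+ 2.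
    rewrite /wt /n; congr (_ + _); case: (k.2) => m //.
    by rewrite NegzE intrN sqrrN abszN.
  have := sqr_ge0 (k.1%:~R : R); have := sqr_ge0 (1 - n); nra.
have ws : wt k `^ 3 <= wt k `^ s by exact: ler_powR.
rewrite powRN (powR_mulrn 2 (ltW w0)); rewrite (powR_mulrn 3 (ltW w0)) in ws.
set w := wt k in w0 w1 hn ws *.
have h1 : w ^+ 3 * x ^+ 2 <= w `^ s * x ^+ 2 by rewrite ler_wpM2r ?sqr_ge0.
apply: le_trans (lerD h1 (lexx _)).
have h2 : (1 + n) ^+ 2 * w ^- 3 <= 2 * w ^- 2.
  rewrite ler_pdivrMr ?exprn_gt0// (_ : 2 * w ^- 2 * w ^+ 3 = 2 * w)//.
  by field; rewrite gt_eqF.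
apply: le_trans (lerD (lexx _) h2).
have h3 : 0 <= w ^- 3 * (w ^+ 3 * x - (1 + n)) ^+ 2.
  by rewrite mulr_ge0 ?sqr_ge0// invr_ge0 exprn_ge0// ltW.
have e : w ^- 3 * (w ^+ 3 * x - (1 + n)) ^+ 2 =
    w ^+ 3 * x ^+ 2 + (1 + n) ^+ 2 * w ^- 3 - 2 * (x * (1 + n)).
  by field; rewrite gt_eqF.
rewrite e in h3; have : 0 <= x * (1 + n) by rewrite mulr_ge0// addr_ge0.
by lra.
Qed.

Lemma sumle_normc (c : int * int -> R[i]) (A : R) :
  sumle (fun k => wt k `^ 2 * normc (c k) ^+ 2) A ->
  exists B, sumle (fun k => normc (c k)) B.
Proof.
move=> cA; have [B hB] := sumle_wt2.
exists (A + B); apply: sumle_le (sumleD cA hB) => k /=.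
have w0 := wt_gt0 k; set x := normc (c k); have x0 : 0 <= x by exact: normc_ge0.
rewrite powRN (powR_mulrn 2 (ltW w0)); set w := wt k in w0 *.
have h3 : 0 <= w ^- 2 * (w ^+ 2 * x - 1) ^+ 2.
  by rewrite mulr_ge0 ?sqr_ge0// invr_ge0 exprn_ge0// ltW.
have e : w ^- 2 * (w ^+ 2 * x - 1) ^+ 2 = w ^+ 2 * x ^+ 2 + w ^- 2 - 2 * x.
  by field; rewrite gt_eqF.
by rewrite e in h3; lra.
Qed.

End WeightedSums.

(** * Vanishing of the obstructions *)

Section Tightness.
Context {R : realType} (al be : R).
Local Notation T2 := (measurableTypeR R * measurableTypeR R)%type.
Local Notation f := (skew_shift al be).
Implicit Types (g u G : R * R -> R[i]).

Definition rperiodic (h : R * R -> R) : Prop :=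
  forall x y, h (x + 1, y) = h (x, y) /\ h (x, y + 1) = h (x, y).

Lemma rmeasurable_iter (h : R * R -> R) k : rmeasurable h ->
  rmeasurable (fun z => h (iter k f z)).
Proof.
move=> mh; elim: k => // k IH.
have := measurableT_comp IH (measurable_skew_shift al be).
by congr measurable_fun; apply/funext => z; rewrite /= -iterS iterSr.
Qed.

Lemma periodic_iter (T : Type) (h : R * R -> T) k :
  (forall x y, h (x + 1, y) = h (x, y) /\ h (x, y + 1) = h (x, y)) ->
  forall x y, h (iter k f (x + 1, y)) = h (iter k f (x, y)) /\
    h (iter k f (x, y + 1)) = h (iter k f (x, y)).
Proof.
move=> hp; elim: k => // k IH x y.
have [h1 h2] := periodic2_skew_shift al be (g := fun z => h (iter k f z)) IH x y.
by rewrite !iterSr.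
Qed.

Lemma E_iter (h : R * R -> R) k : rmeasurable h -> rperiodic h ->
  E (fun z => h (iter k f z)) = E h.
Proof.
move=> mh hp; elim: k => // k <-.
rewrite -(E_skew_shift al be (rmeasurable_iter k mh) (periodic_iter k hp)).
by apply: eq_E => z _; rewrite iterSr.
Qed.

Definition level (K x : R) : R := if K < x then 1 else 0.

Lemma level_ge0 K x : 0 <= level K x.
Proof. by rewrite /level; case: ifP. Qed.

Lemma level_norm K x : `|level K x| <= 1.
Proof. by rewrite /level; case: ifP; rewrite ?normr1 ?normr0. Qed.

Lemma rmeasurable_level (g : R * R -> R) (K : R) : rmeasurable g ->
  rmeasurable (fun z => level K (g z)).
Proof.
move=> mg; have mA : measurable [set z : T2 | K < g z].
  have := mg measurableT _ (measurable_itv `]K, +oo[).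
  by rewrite setTI; congr measurable; apply/seteqP; split => z /=; rewrite in_itv/= andbT.
have := rmeasurable_indic mA; congr rmeasurable; apply/funext => z.
rewrite indicE /level; case: ifPn => h; first by rewrite mem_set.
by rewrite memNset//=; exact/negP.
Qed.

Lemma rint_level (g : R * R -> R) (K : R) : rmeasurable g ->
  rint (fun z => level K (g z)).
Proof.
move=> mg; apply: (@rint_bounded _ _ 1); first exact: rmeasurable_level.
by move=> z; exact: level_norm.
Qed.

(** Iterates leave the fundamental square, so the null set is transported through the integral of a
    periodic indicator, which the skew-shift preserves. *)
Lemma aet_iter (h : R * R -> R[i]) k : cmeasurable2 h -> periodic2 h ->
  aet (fun z => h z = 0) -> aet (fun z => h (iter k f z) = 0).
Proof.
move=> mh hp h0; have mn := rmeasurable_normc mh.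
pose r z : R := level 0 (normc (h z)).
have mr : rmeasurable r by exact: rmeasurable_level.
have rp : rperiodic r by move=> x y; rewrite /r; have [-> ->] := hp x y.
have Er : E r = 0.
  rewrite -[RHS](@E_cst R 0); apply: ae_eq_E => //; first exact: measurable_cst.
  by apply: aetS h0 => z; rewrite /r /level => ->; rewrite normc0 ltxx.
have : aet (fun z => r (iter k f z) = 0).
  apply: E_abs_ae0; first exact: rmeasurable_iter.
    apply: (@rint_bounded _ _ 1); first exact: rmeasurable_iter.
    by move=> z; exact: level_norm.
  rewrite -Er -(E_iter k mr rp); apply: eq_E => z _.
  by rewrite ger0_norm// level_ge0.
apply: aetS => z; rewrite /r /level; case: ltP => [_ /eqP|hz _]; first by rewrite oner_eq0.
by apply: eq0_normc; apply/eqP; rewrite eq_le hz normc_ge0.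
Qed.

Lemma aet_forall (P : nat -> R * R -> Prop) N : (forall k, aet (P k)) ->
  aet (fun z => forall k, (k < N)%N -> P k z).
Proof.
move=> aP; elim: N => [|N IH].
  by apply: (aetS _ (aP 0%N)).
apply: aetS (aetI IH (aP N)) => z [h1 h2] k.
by rewrite ltnS leq_eqVlt => /orP[/eqP ->//|/h1].
Qed.

Lemma birkhoff_coboundary G u N : cmeasurable2 G -> periodic2 G ->
  cmeasurable2 u -> periodic2 u -> aet (fun z => G z = u (f z) - u z) ->
  aet (fun z => \sum_(k < N) G (iter k f z) = u (iter N f z) - u z).
Proof.
move=> mG pG mu pu Gu; pose h z := G z - (u (f z) - u z).
have muf : cmeasurable2 (u \o f) by exact: cmeasurable2_skew_shift.
have mh : cmeasurable2 h by apply: cmeasurable2B => //; exact: cmeasurable2B.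
have ph : periodic2 h.
  move=> x y; rewrite /h; have [-> ->] := pG x y; have [-> ->] := pu x y.
  by have /= [-> ->] := periodic2_skew_shift al be pu x y.
have h0 : aet (fun z => h z = 0) by apply: aetS Gu => z e; rewrite /h e subrr.
have := aet_forall N (fun k => aet_iter k mh ph h0).
apply: aetS => z; elim: N => [_|N IH hz]; first by rewrite big_ord0 subrr.
rewrite big_ord_recr/= IH => [|k kN]; last by apply: hz; rewrite ltnS ltnW.
have /eqP := hz N (ltnSn N); rewrite /h subr_eq0 => /eqP ->.
by rewrite addrC subrKA.
Qed.

(** A finite-valued function exceeds [n] on sets of measure tending to 0; this is the only
    quantitative information extracted from [u]. *)
Lemma tight u e : cmeasurable2 u -> 0 < e ->
  exists2 K : R, 0 <= K & E (fun z => level K (normc (u z))) <= e.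
Proof.
move=> mu e0; have mn := rmeasurable_normc mu.
have : E (fun z => level n%:R (normc (u z))) @[n --> \oo] --> E (fun=> 0 : R).
  apply: (@E_dominated _ _ _ (fun=> 1)).
  - by move=> n; exact: rmeasurable_level.
  - exact: measurable_cst.
  - exact: rint_cst.
  - by move=> n z; exact: level_norm.
  move=> z; apply: cvg_near_cst; exists (Num.truncn (normc (u z))).+1 => // n /= hn.
  rewrite /level ltNge ltW// (lt_le_trans (truncnS_gt _))//.
  by rewrite ler_nat.
rewrite E_cst => /cvgrPdist_le/(_ e e0)[n _ /(_ n (leqnn n))].
rewrite /= sub0r normrN => h; exists n%:R => //.
by rewrite (le_trans (ler_norm _)).
Qed.

End Tightness.

(** * Moments of Birkhoff sums against the obstruction along a chain *)

Section Obstruction.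
Context {R : realType} (al be : R).
Local Notation T2 := (measurableTypeR R * measurableTypeR R)%type.
Local Notation f := (skew_shift al be).
Implicit Types (g u G : R * R -> R[i]) (c : int * int -> R[i]).

Definition gauged c a n (j : int) : R[i] := ex (- theta al be a n j) * c (a + j * n, n).

Lemma cbnd_iter g k : cbnd g -> cbnd (fun z => g (iter k f z)).
Proof.
move=> [[g1 g2] [M gM]]; split; last by exists M => z; exact: gM.
split; first exact: (rmeasurable_iter al be k (h := fun z => complex.Re (g z)) g1).
exact: (rmeasurable_iter al be k (h := fun z => complex.Im (g z)) g2).
Qed.

Lemma fcoef_iter g a n j (k : nat) : cbnd g -> periodic2 g ->
  fcoef (fun z => g (iter k f z)) (a + j * n) n =
  ex (theta al be a n j - theta al be a n (j - k%:Z)) *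
    fcoef g (a + (j - k%:Z) * n) n.
Proof.
move=> bg pg; elim: k j => [|k IH] j; first by rewrite subr0 subrr ex0 mul1r.
transitivity (fcoef ((fun z => g (iter k f z)) \o f) (a + j * n) n).
  by congr fcoef; apply/funext => z; rewrite iterSr.
rewrite fcoef_skew_shift; last 2 first.
- exact: periodic_iter.
- exact/cbnd_cint/cbnd_iter.
have e : a + j * n - n = a + (j - 1) * n by ring.
rewrite e IH mulrA -exD.
have -> : j - 1 - k%:Z = j - k.+1%:Z by lia.
congr (ex _ * _); rewrite -[in theta al be a n j](subrK 1 j) thetaS; ring.
Qed.

(** At position [j] of the chain the Birkhoff sum collects, up to a common phase, the gauged
    coefficients over the window from [j - N + 1] to [j]. *)
Lemma fcoef_birkhoff g a n (j N : nat) : cbnd g -> periodic2 g ->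
  fcoef (fun z => \sum_(k < N) g (iter k f z)) (a + j%:Z * n) n =
  ex (theta al be a n j) *
    \sum_(k < N) gauged (fun k => fcoef g k.1 k.2) a n (j%:Z - k%:Z).
Proof.
move=> bg pg; rewrite fcoef_sum => [|k]; last exact/cbnd_cint/cbnd_iter.
rewrite mulr_sumr; apply: eq_bigr => k _.
by rewrite fcoef_iter// /gauged mulrA -exD.
Qed.

(** The window is cut at index 0 so that its halves are partial sums of the two one-sided series. *)
Lemma sum_window (V : zmodType) (d : int -> V) (j N : nat) : (j < N)%N ->
  \sum_(k < N) d (j%:Z - k%:Z) =
  \sum_(k < j.+1) d k%:Z + \sum_(k < N - j.+1) d (- (k.+1%:Z)).
Proof.
move=> jN; rewrite -(big_mkord xpredT (fun k => d (j%:Z - k%:Z))).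
rewrite (@big_cat_nat _ _ _ j.+1)//=; congr (_ + _).
  rewrite big_nat_rev -(big_mkord xpredT (fun k : nat => d k%:Z)) /=.
  apply: eq_big_nat => i ij; congr d; lia.
rewrite -{1}(add0n j.+1) big_addn big_mkord; apply: eq_bigr => i _.
by congr d; lia.
Qed.

(** Convexity with weights [|c i|] passes from characters to their combinations at the price of the
    cube of the sum of the [|c i|]; the growth in [|n|] is absorbed by the weighted sum, and the row
    0 by its vanishing coefficients. *)
Lemma fourth_moment_trigpoly c (r : seq (int * int)) (N : nat) (B : R) :
  (forall a n, n != 0 ->
    E (fun z => normc (\sum_(k < N) fchar a n (iter k f z)) ^+ 4) <=
    C4 * `|n|%:R * N%:R ^+ 2) ->
  (forall a, c (a, 0) = 0) -> uniq r ->
  sumle (fun k => normc (c k) * (1 + `|k.2|%:R)) B ->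
  E (fun z => normc (\sum_(k < N) trigpoly r id c (iter k f z)) ^+ 4) <=
    B ^+ 4 * C4 * N%:R ^+ 2.
Proof.
move=> hN c0 ur cB; have B0 := sumle_ge0 cB.
have C40 : 0 <= C4 :> R by rewrite /C4; have := @Kd_ge0 R; lra.
pose g (i : int * int) z := \sum_(k < N) fchar i.1 i.2 (iter k f z) : R[i].
have bg i : cbnd (g i) by apply: cbnd_sum => k; exact: cbnd_iter (cbnd_fchar _ _).
pose P3 := (\sum_(i <- r) normc (c i)) ^+ 3.
have S0 : 0 <= \sum_(i <- r) normc (c i) by apply: sumr_ge0 => i _; exact: normc_ge0.
have P30 : 0 <= P3 by rewrite exprn_ge0.
have ig i : rint (fun z => normc (c i) * normc (g i z) ^+ 4).
  by apply: rintZ; exact: cbnd_rint_normX.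
apply: (@le_trans _ _ (E (fun z => P3 * \sum_(i <- r) normc (c i) * normc (g i z) ^+ 4))).
  apply: le_E.
  - apply: cbnd_rint_normX; apply: cbnd_sum => k; apply: cbnd_iter.
    exact: cbnd_trigpoly.
  - by apply: rintZ; exact: rint_sum.
  move=> z; apply: le_trans (power_mean4 _ (fun i => normc (g i z)) (fun i => normc_ge0 (c i))).
  rewrite lerXn2r ?nnegrE ?normc_ge0 ?sumr_ge0// => [i _|].
    by rewrite mulr_ge0 ?normc_ge0.
  rewrite /trigpoly exchange_big/= (le_trans (le_normc_sum _ _ _))//.
  by apply: ler_sum => i _; rewrite -mulr_sumr normcM.
rewrite EZ ?E_sum//; last exact: rint_sum.
have hS : \sum_(i <- r) E (fun z => normc (c i) * normc (g i z) ^+ 4) <=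
    B * (C4 * N%:R ^+ 2).
  apply: (@le_trans _ _ ((\sum_(i <- r) normc (c i) * (1 + `|i.2|%:R)) * (C4 * N%:R ^+ 2))).
    rewrite mulr_suml; apply: ler_sum => -[a n] _ /=.
    rewrite EZ; last exact: cbnd_rint_normX.
    have [->|n0] := eqVneq n 0; first by rewrite c0 normc0 !mul0r.
    rewrite -mulrA ler_wpM2l ?normc_ge0// (le_trans (hN a n n0))//.
    rewrite (_ : C4 * _ * _ = `|n|%:R * (C4 * N%:R ^+ 2)); last by ring.
    by rewrite ler_wpM2r ?mulr_ge0 ?sqr_ge0// lerDr.
  by rewrite ler_wpM2r ?mulr_ge0 ?sqr_ge0// cB.
have hP : P3 <= B ^+ 3.
  rewrite lerXn2r ?nnegrE// (le_trans _ (cB r ur))//.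
  by apply: ler_sum => i _; rewrite ler_peMr ?normc_ge0// lerDl.
apply: (@le_trans _ _ (B ^+ 3 * (B * (C4 * N%:R ^+ 2)))).
  by rewrite ler_pM// sumr_ge0// => i _; apply: E_ge0 => z; rewrite mulr_ge0 ?normc_ge0 ?exprn_ge0 ?normc_ge0.
by rewrite le_eqVlt; apply/orP; left; apply/eqP; ring.
Qed.

(** For the [N - 2 J] positions from [J] to [N - J - 1] both halves of the window have at least [J]
    terms, so these coefficients have modulus at least [kap] and Bessel sums their squares. The
    condition on [M] makes the partial sum carry the coefficients [c] on all these windows. *)
Lemma second_moment_lower c (M N J : nat) a n (kap : R) : n != 0 -> (2 * J <= N)%N ->
  0 <= kap ->
  (forall i : int, (`|i| <= N)%N -> (a + i * n, n) \in bx M M) ->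
  (forall A B, (J <= A)%N -> (J <= B)%N -> kap <=
     normc (\sum_(k < A) gauged c a n k%:Z + \sum_(k < B) gauged c a n (- (k.+1%:Z)))) ->
  (N%:R - 2 * J%:R) * kap ^+ 2 <=
  E (fun z => normc (\sum_(k < N) psum c M (iter k f z)) ^+ 2).
Proof.
move=> n0 JN kap0 hM hJ; pose P := psum c M.
have bP : cbnd P by exact: cbnd_trigpoly.
have pP : periodic2 P by exact: periodic2_trigpoly.
have bS : cbnd (fun z => \sum_(k < N) P (iter k f z)).
  by apply: cbnd_sum => k; exact: cbnd_iter.
pose key (j : nat) : int * int := (a + j%:Z * n, n).
have kinj : {in iota J (N - 2 * J) &, injective key}.
  by move=> i j _ _ [] /addrI/(mulIf n0)[].
apply: le_trans (Bessel bS (iota_uniq J (N - 2 * J)) kinj).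
have -> : (N%:R - 2 * J%:R) * kap ^+ 2 = \sum_(j <- iota J (N - 2 * J)) kap ^+ 2.
  by rewrite big_const_seq count_predT size_iota iter_addr_0 -[RHS]mulr_natl natrB// natrM.
rewrite big_seq [leRHS]big_seq; apply: ler_sum => j; rewrite mem_iota => /andP[j1 j2].
rewrite ler_pXn2r ?nnegrE ?normc_ge0//.
have -> : key j = (a + j%:Z * n, n) by [].
rewrite fcoef_birkhoff// normcM normc_ex mul1r.
rewrite (sum_window _ (j := j) (N := N)); last by lia.
rewrite (_ : _ + _ = \sum_(k < j.+1) gauged c a n k%:Z +
    \sum_(k < N - j.+1) gauged c a n (- (k.+1%:Z))); first by apply: hJ; lia.
congr (_ + _); apply: eq_bigr => k _; rewrite /gauged /= fcoef_psum//; apply: hM.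
  by have := ltn_ord k; lia.
by have := ltn_ord k; lia.
Qed.

Lemma obstruction_vanishes c G u (B : R) : irrational al ->
  cbnd G -> periodic2 G -> cmeasurable2 u -> periodic2 u ->
  aet (fun z => G z = u (f z) - u z) ->
  (forall e, 0 < e -> exists n0, forall n z, (n0 <= n)%N ->
     normc (G z - psum c n z) <= e) ->
  (forall a, c (a, 0) = 0) ->
  sumle (fun k => normc (c k) * (1 + `|k.2|%:R)) B ->
  forall a n L1 L2, n != 0 ->
  cto (fun N => \sum_(k < N) gauged c a n k%:Z) L1 ->
  cto (fun N => \sum_(k < N) gauged c a n (- (k.+1%:Z))) L2 -> L1 + L2 = 0.
Proof.
move=> ial bG pG mu pu Gu unif c0 cB a n L1 L2 n0 cL1 cL2.
apply/eqP/negPn/negP => L0; have := normc_gt0 L0; set ell := normc _ => ell0.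
have e4 : 0 < ell / 4 by lra.
have [J1 hJ1] := cL1 _ e4; have [J2 hJ2] := cL2 _ e4; pose J := maxn J1 J2.
(* Beyond [J] each one-sided partial sum is within [ell / 4] of its limit, which leaves half of
   [ell]. *)
pose kap := ell / 2; have kap0 : 0 < kap by rewrite /kap; lra.
have hJ A A' : (J <= A)%N -> (J <= A')%N -> kap <=
    normc (\sum_(k < A) gauged c a n k%:Z + \sum_(k < A') gauged c a n (- (k.+1%:Z))).
  rewrite !geq_max => /andP[/hJ1 h1 _] /andP[_ /hJ2 h2].
  set S := _ + _; have : normc (L1 + L2) - normc S <= normc (L1 + L2 - S).
    exact: le_normc_sub.
  rewrite [normc (_ - S)]normc_distC /S opprD addrACA.
  have := le_normcD (\sum_(k < A) gauged c a n k%:Z - L1)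
    (\sum_(k < A') gauged c a n (- (k.+1%:Z)) - L2).
  by rewrite -/ell /kap; lra.
have B0 := sumle_ge0 cB.
have C40 : 0 <= C4 :> R by rewrite /C4; have := @Kd_ge0 R; lra.
pose D := B ^+ 4 * C4 : R; have D0 : 0 <= D by rewrite mulr_ge0// exprn_ge0.
pose K2 := kap ^+ 2; have K20 : 0 < K2 by rewrite exprn_gt0.
(* [lam] and [eta] are tuned so that the fourth-moment term and the tail term of [Y] below
   contribute at most [K2 / 8] and [K2 / 16] times [N]; [D + 1] keeps the denominator positive. *)
pose lam := K2 / (8 * (D + 1)); have lam0 : 0 < lam by rewrite divr_gt0//; lra.
have lamD : lam * D <= K2 / 8.
  have : lam * (8 * (D + 1)) = K2 by rewrite /lam divfK// gt_eqF//; lra.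
  by move: lam0; clearbody lam K2 D; lra.
pose eta := K2 * lam / 32; have eta0 : 0 < eta by rewrite divr_gt0// mulr_gt0.
have [K K0 hK] := tight mu eta0.
(* [2 K] bounds [u o f^N - u] off the exceptional set, and 1 covers the replacement of [G] by a
   partial sum in [N] terms, each with error at most [1 / N]. *)
pose K3 := 2 * K + 1.
have [Nb hNb] : exists Nb : nat, (K3 ^+ 2 + 2 * J%:R * K2) * 2 / K2 < Nb%:R.
  exists (Num.truncn ((K3 ^+ 2 + 2 * J%:R * K2) * 2 / K2)).+1.
  exact: truncnS_gt.
have [N [NB N0] hN] := fourth_moment be (maxn Nb (2 * J)) ial.
have N0' : 0 < N%:R :> R by rewrite ltr0n.
have eN : 0 < N%:R^-1 :> R by rewrite invr_gt0.
have [M0 hM0] := unif _ eN.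
have [M1 hM1] := sub_bx [seq (a + i * n, n) | i <- zr N].
pose M := maxn M0 M1; pose P := psum c M.
have GP z : normc (G z - P z) <= N%:R^-1 by apply: hM0; rewrite leq_maxl.
have lower := @second_moment_lower c M N J a n kap n0 _ (ltW kap0) _ hJ.
pose X z := normc (\sum_(k < N) P (iter k f z)).
have bS : cbnd (fun z => \sum_(k < N) P (iter k f z)).
  by apply: cbnd_sum => k; apply: cbnd_iter; exact: cbnd_trigpoly.
have upper : E (fun z => X z ^+ 4) <= D * N%:R ^+ 2.
  exact: fourth_moment_trigpoly hN c0 (bx_uniq M M) cB.
have {}lower : (N%:R - 2 * J%:R) * K2 <= E (fun z => X z ^+ 2).
  apply: lower; first by move: NB; rewrite geq_max => /andP[].
  move=> i iN; apply: (@bx_sub M1 M1); rewrite ?leq_maxr//; apply: hM1.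
  by apply/mapP; exists i; rewrite ?mem_zr.
pose U z := level K (normc (u z)).
have mn := rmeasurable_normc mu.
have mU : rmeasurable U by exact: rmeasurable_level.
have pU : rperiodic U by move=> x y; rewrite /U; have [-> ->] := pu x y.
have iU : rint U by exact: rint_level.
have iUN : rint (fun z => U (iter N f z)).
  apply: (@rint_bounded _ _ 1); first exact: rmeasurable_iter.
  by move=> z; exact: level_norm.
have EU : E (fun z => U z + U (iter N f z)) <= 2 * eta.
  rewrite ED// E_iter//; have : E U <= eta by exact: hK.
  by lra.
have Gae := birkhoff_coboundary N (proj1 bG) pG mu pu Gu.
have iX k : rint (fun z => X z ^+ k) by exact: cbnd_rint_normX.
have mX k : rmeasurable (fun z => X z ^+ k).
  by apply: measurable_funX; apply: rmeasurable_normc; case: bS.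
(* Paley-Zygmund through Young's inequality. Where [X > K3], one of [|u|], [|u o f^N|] exceeds [K],
   so [U + U o f^N >= 1] and [2 X ^ 2 <= (lam / N) X ^ 4 + N / lam] gives [X ^ 2 <= Y]; elsewhere
   [K3 ^ 2] suffices. *)
pose Y z := K3 ^+ 2 + (lam / N%:R * X z ^+ 4 + N%:R / lam * (U z + U (iter N f z))).
have iY1 : rint (fun z => lam / N%:R * X z ^+ 4) by exact: rintZ.
have iY2 : rint (fun z => N%:R / lam * (U z + U (iter N f z))).
  by apply: rintZ; exact: rintD.
have iY3 : rint (fun z => lam / N%:R * X z ^+ 4 + N%:R / lam * (U z + U (iter N f z))).
  exact: rintD.
have iY : rint Y by apply: rintD => //; exact: rint_cst.
have mY : rmeasurable Y.
  apply: (measurable_funD (measurable_cst _)).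
  apply: measurable_funD.
    exact: (measurable_funM (measurable_cst _) (mX 4%N)).
  apply: (measurable_funM (measurable_cst _)).
  exact: (measurable_funD mU (rmeasurable_iter al be N mU)).
have lN0 : 0 < lam / N%:R by rewrite divr_gt0.
have Nl0 : 0 < N%:R / lam by rewrite divr_gt0.
have XY : aet (fun z => X z ^+ 2 <= Y z).
  apply: aetS Gae => z Gz.
  have X0 : 0 <= X z by exact: normc_ge0.
  have U0 : 0 <= U z by exact: level_ge0.
  have UN0 : 0 <= U (iter N f z) by exact: level_ge0.
  have XG : X z <= normc (u z) + normc (u (iter N f z)) + 1.
    have -> : X z = normc (u (iter N f z) - u z -
        \sum_(k < N) (G (iter k f z) - P (iter k f z))).
      by rewrite -Gz -sumrB /X; congr normc; apply: eq_bigr => k _; rewrite subKr.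
    rewrite (le_trans (le_normcB _ _))//.
    have h1 := le_normcB (u (iter N f z)) (u z).
    have h2 : normc (\sum_(k < N) (G (iter k f z) - P (iter k f z))) <= 1.
      rewrite (le_trans (le_normc_sum _ _ _))//.
      apply: (@le_trans _ _ (\sum_(k < N) N%:R^-1)); first by apply: ler_sum => k _.
      by rewrite sumr_const card_ord -[_ *+ N]mulr_natr mulVf// gt_eqF.
    by lra.
  have [XK|XK] := leP (X z) K3.
    have : X z ^+ 2 <= K3 ^+ 2 by rewrite lerXn2r ?nnegrE//; exact: le_trans XK.
    move=> h; apply: (le_trans h); rewrite /Y lerDl addr_ge0//.
      by rewrite mulr_ge0 ?exprn_ge0// ltW.
    by rewrite mulr_ge0 ?addr_ge0// ltW.
  have U1 : 1 <= U z + U (iter N f z).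
    have [uz|uz] := ltP K (normc (u z)).
      by rewrite {1}/U /level uz lerDl.
    have uN : K < normc (u (iter N f z)) by rewrite /K3 in XK; lra.
    by rewrite {2}/U /level uN lerDr.
  have : 0 <= lam / N%:R * (X z ^+ 2 - N%:R / lam) ^+ 2.
    by rewrite mulr_ge0 ?sqr_ge0// ltW.
  have -> : lam / N%:R * (X z ^+ 2 - N%:R / lam) ^+ 2 =
      lam / N%:R * X z ^+ 4 + N%:R / lam - 2 * X z ^+ 2.
    by field; rewrite !gt_eqF.
  have : N%:R / lam <= N%:R / lam * (U z + U (iter N f z)).
    by rewrite ler_peMr// ltW.
  have : 0 <= X z ^+ 2 by exact: sqr_ge0.
  have : 0 <= K3 ^+ 2 by exact: sqr_ge0.
  by rewrite /Y; lra.
(* Integration gives [N K2 - 2 J K2 <= K3 ^ 2 + (3 / 16) N K2], against the choice of [N]. *)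
have := ae_le_E (iX 2%N) iY (mX 2%N) mY XY.
rewrite /Y ED//; last exact: rint_cst.
rewrite E_cst ED// !EZ//; last exact: rintD.
have t1 : lam / N%:R * E (fun z => X z ^+ 4) <= K2 / 8 * N%:R.
  apply: (@le_trans _ _ (lam / N%:R * (D * N%:R ^+ 2))); first by rewrite ler_wpM2l// ltW.
  rewrite (_ : _ * _ = lam * D * N%:R); first by rewrite ler_wpM2r// ltW.
  by field; rewrite gt_eqF.
have t2 : N%:R / lam * E (fun z => U z + U (iter N f z)) <= K2 / 16 * N%:R.
  apply: (@le_trans _ _ (N%:R / lam * (2 * eta))); first by rewrite ler_wpM2l// ltW.
  rewrite le_eqVlt; apply/orP; left; apply/eqP; rewrite /eta.
  by field; rewrite gt_eqF.
have NB' : (K3 ^+ 2 + 2 * J%:R * K2) * 2 < N%:R * K2.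
  rewrite -ltr_pdivrMr// (lt_le_trans hNb)// ler_nat.
  by move: NB; rewrite geq_max => /andP[].
move=> t3; move: lower t1 t2 t3 NB'; rewrite mulrBl.
have : 0 < N%:R * K2 by rewrite mulr_gt0.
have -> : K2 / 8 * N%:R = N%:R * K2 / 8 by ring.
have -> : K2 / 16 * N%:R = N%:R * K2 / 16 by ring.
set x := N%:R * K2; set y := 2 * J%:R * K2; set w := K3 ^+ 2.
set p := lam / N%:R * _; set q := N%:R / lam * _; set X2 := E _.
by lra.
Qed.

End Obstruction.

(** * Ergodicity and the transfer coefficients *)

Section Ergodicity.
Context {R : realType} (al be : R).
Local Notation f := (skew_shift al be).

Lemma irrational_intmul (a n : int) : irrational al -> a != 0 -> a%:~R * al <> n%:~R.
Proof.
move=> ial; case: a => a; first by move=> a0; apply: irrational_natmul => //; lia.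
move=> _; rewrite NegzE intrN mulNr => h.
apply: (irrational_natmul (q := a.+1) (p := - n) ial) => //.
by rewrite intrN -h opprK.
Qed.

(** Invariance makes the modulus constant along the chain of [(a, b)]. For [b != 0] the chain is
    infinite and Bessel forces the constant to be 0; for [b = 0] the coefficient is multiplied by
    [ex (a al)], which is not 1. *)
Lemma invariant_fcoef (g : R * R -> R[i]) a b : irrational al ->
  cbnd g -> periodic2 g -> aet (fun z => g (f z) = g z) ->
  (a, b) != (0, 0) -> fcoef g a b = 0.
Proof.
move=> ial bg pg gf ab; have [mg _] := bg.
have inv a' b' : fcoef g a' b' = ex ((a' - b')%:~R * al + b'%:~R * be) * fcoef g (a' - b') b'.
  rewrite -fcoef_skew_shift//; last exact: cbnd_cint.
  apply: ae_eq_fcoef => //; first exact: cmeasurable2_skew_shift.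
  by apply: aetS gf => z /= ->.
have [b0|b0] := eqVneq b 0.
  move: ab; rewrite b0 xpair_eqE eqxx andbT => a0.
  have := inv a 0; rewrite subr0 mul0r addr0 => /eqP.
  rewrite -subr_eq0 -{1}[fcoef g a 0]mul1r -mulrBl mulf_eq0 => /orP[|/eqP//].
  rewrite subr_eq0 eq_sym => /eqP/ex_eq1[n] e.
  by case: (irrational_intmul ial a0 e).
pose key (j : nat) : int * int := (a - j%:Z * b, b).
have modulus j : normc (fcoef g (key j).1 (key j).2) = normc (fcoef g a b).
  rewrite /key; elim: j => [|j <-]; rewrite [_.1]/= [_.2]/=; first by rewrite mul0r subr0.
  rewrite [in RHS]inv normcM normc_ex mul1r -addn1 PoszD.
  by rewrite /= mulrDl mul1r opprD addrA.
have kinj N : {in iota 0 N &, injective key}.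
  by move=> i j _ _ [] /addrI/oppr_inj/(mulIf b0)[].
set x := normc (fcoef g a b) in modulus; set C := E (fun z => normc (g z) ^+ 2).
have bd N : N%:R * x ^+ 2 <= C.
  apply: le_trans (Bessel bg (iota_uniq 0 N) (kinj N)).
  under eq_bigr do rewrite modulus.
  by rewrite big_const_seq count_predT size_iota iter_addr_0 -[leRHS]mulr_natl.
apply/eqP; rewrite -normc_eq0 -/x; apply/negPn/negP => x0.
have x2 : 0 < x ^+ 2 by rewrite exprn_gt0// lt0r x0 normc_ge0.
have := bd (Num.truncn (C / x ^+ 2)).+1.
by rewrite -ler_pdivlMr// leNgt truncnS_gt.
Qed.

Lemma invariant_cbnd_cst (g : R * R -> R[i]) : irrational al ->
  cbnd g -> periodic2 g -> aet (fun z => g (f z) = g z) ->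
  aet (fun z => g z = fcoef g 0 0).
Proof.
move=> ial bg pg gf; set C := fcoef g 0 0.
suff : aet (fun z => g z - C = 0) by apply: aetS => z /eqP; rewrite subr_eq0 => /eqP.
apply: fourier_uniqueness; split; first exact/cbnd_cint/cbndB/cbnd_cst.
move=> a b; rewrite fcoefB; try exact: cbnd_cint; last exact/cbnd_cint/cbnd_cst.
rewrite fcoef_cst.
have [[-> ->]|ab] := eqVneq (a, b) (0, 0); first by rewrite subrr.
by rewrite subr0 invariant_fcoef.
Qed.

(** The bounded injective function [atan] reduces to the case where Fourier coefficients exist. *)
Lemma ergodic_real (h : R * R -> R) : irrational al -> rmeasurable h -> rperiodic h ->
  aet (fun z => h (f z) = h z) -> exists C, aet (fun z => h z = C).
Proof.
move=> ial mh ph hf; pose g z : R[i] := (atan (h z))%:C.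
have bg : cbnd g.
  split.
    split; last exact: measurable_cst.
    have ma : measurable_fun setT (@atan R).
      by apply: continuous_measurable_fun => x; exact: continuous_atan.
    exact: (measurableT_comp ma mh).
  exists (pi / 2) => z; rewrite normc_real ler_norml.
  by rewrite (ltW (atan_gtNpi2 _)) (ltW (atan_ltpi2 _)).
have pg : periodic2 g by move=> x y; rewrite /g; have [-> ->] := ph x y.
have gf : aet (fun z => g (f z) = g z) by apply: aetS hf => z; rewrite /g => ->.
exists (tan (complex.Re (fcoef g 0 0))).
apply: aetS (invariant_cbnd_cst ial bg pg gf) => z <-.
by rewrite /g /= atanK.
Qed.

Lemma ergodic (h : R * R -> R[i]) : irrational al -> cmeasurable2 h -> periodic2 h ->
  aet (fun z => h (f z) = h z) -> exists C, aet (fun z => h z = C).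
Proof.
move=> ial [m1 m2] ph hf.
have p1 : rperiodic (fun z => complex.Re (h z)) by move=> x y; have [-> ->] := ph x y.
have p2 : rperiodic (fun z => complex.Im (h z)) by move=> x y; have [-> ->] := ph x y.
have f1 : aet (fun z => complex.Re (h (f z)) = complex.Re (h z)) by apply: aetS hf => z ->.
have f2 : aet (fun z => complex.Im (h (f z)) = complex.Im (h z)) by apply: aetS hf => z ->.
have [C1 h1] := ergodic_real ial m1 p1 f1.
have [C2 h2] := ergodic_real ial m2 p2 f2.
exists (C1 +i* C2); apply: aetS (aetI h1 h2) => z [e1 e2].
exact: complex_ext.
Qed.

End Ergodicity.

(** * The cohomological equation on coefficients and its Sobolev estimate *)

Section TransferCoefficients.
Context {R : realType} (al be : R).
Implicit Types (c w : int * int -> R[i]).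
Local Notation gd := (gauged al be).

Definition transfer_eq c w : Prop := forall a b,
  ex ((a - b)%:~R * al + b%:~R * be) * w (a - b, b) - w (a, b) = c (a, b).

(* The indices [a + sg k n] run away from 0, which makes the weights at them at
   least the weight at [a]. *)
Definition outgoing c (a n : int) (w : R[i]) (sg : int) (v : nat -> R[i]) : Prop :=
  [/\ forall k : nat, absz (a + sg * k%:Z * n) = (absz a + k * absz n)%N, cto v w &
      forall K, normc (v K) <= \sum_(k < K.+1) normc (c (a + sg * k%:Z * n, n))].

Lemma gauged_shift c a n (k : nat) : gd c (a - n) n k.+1%:Z =
  ex (- ((a - n)%:~R * al + n%:~R * be)) * gd c a n k%:Z.
Proof.
rewrite /gauged mulrA -exD (_ : k.+1%:Z = 1 + k%:Z); last by lia.
rewrite thetaD mul1r subrK; congr (ex _ * c (_, _)); last by ring.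
by rewrite -[in X in theta _ _ _ _ X + _](add0r 1) thetaS theta0 mul0r addr0; ring.
Qed.

Lemma normc_gauged c a n j : normc (gd c a n j) = normc (c (a + j * n, n)).
Proof. by rewrite /gauged normcM normc_ex mul1r. Qed.

(** [w] is the forward tail [Lp - c] of the gauged chain re-based at each point, for which the
    equation is immediate. Where the forward direction runs towards 0, that is for [a n < 0], the
    vanishing obstruction rewrites it as [- c - Lm]. *)
Lemma transfer_exists c B : sumle (fun k => normc (c k)) B ->
  (forall a, c (a, 0) = 0) ->
  (forall a n L1 L2, n != 0 ->
    cto (fun N => \sum_(k < N) gd c a n k%:Z) L1 ->
    cto (fun N => \sum_(k < N) gd c a n (- (k.+1%:Z))) L2 -> L1 + L2 = 0) ->
  exists w, [/\ transfer_eq c w, forall a, w (a, 0) = 0 &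
    forall a n, n != 0 -> exists sg v, outgoing c a n (w (a, n)) sg v].
Proof.
move=> cB c0 obs.
have inj1 a n (e : nat -> int) : n != 0 -> injective e ->
    injective (fun k : nat => (a + e k * n, n)).
  by move=> n0 ei i j [] /addrI/(mulIf n0)/ei.
have sumg a n e : n != 0 -> injective e ->
    sumle (fun k : nat => normc (gd c a n (e k))) B.
  move=> n0 ei; have := sumle_inj (inj1 a n e n0 ei) cB.
  by apply: sumle_le => k /=; rewrite normc_gauged.
have ip : injective (fun k : nat => k%:Z) by move=> i j [].
have im : injective (fun k : nat => - k.+1%:Z) by move=> i j; lia.
have /choice[Lp hLp] : forall an : int * int, exists L, an.2 != 0 ->
    cto (fun N => \sum_(k < N) gd c an.1 an.2 k%:Z) L.
  move=> [a n] /=; have [->|n0] := eqVneq n 0; first by exists 0.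
  by have [L hL] := csum_cvg (sumg a n _ n0 ip); exists L.
pose w (an : int * int) := if an.2 == 0 then 0 else Lp an - c an.
have g0 a n : gd c a n 0 = c (a, n).
  by rewrite /gauged theta0 oppr0 ex0 mul1r mul0r addr0.
have wlim a n : n != 0 -> cto (fun N => \sum_(k < N) gd c a n k.+1%:Z) (w (a, n)).
  move=> n0; rewrite /w /= (negPf n0) addrC.
  have := ctoD (cto_cst (- c (a, n))) (cto_shift 1 (hLp (a, n) n0)).
  apply: cto_eq => N /=; rewrite addn1 big_ord_recl /= g0 addKr.
  by apply: eq_bigr => k _; rewrite /bump.
exists w; split.
- move=> a b; have [->|b0] := eqVneq b 0.
    by rewrite /w eqxx mulr0 subr0 c0.
  rewrite (_ : ex _ * _ = Lp (a, b)); first by rewrite /w /= (negPf b0) subKr.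
  apply: cto_unique (hLp (a, b) b0).
  have := ctoZ (ex ((a - b)%:~R * al + b%:~R * be)) (wlim (a - b) b b0).
  apply: cto_eq => N; rewrite mulr_sumr; apply: eq_bigr => k _.
  by rewrite gauged_shift mulrA -exD subrr ex0 mul1r.
- by move=> a; rewrite /w eqxx.
move=> a n n0; have [an|an] := leP 0 (a * n).
  exists 1, (fun K => \sum_(k < K) gd c a n k.+1%:Z); split.
  - by move=> k; nia.
  - exact: wlim.
  (* The forward tail starts at [k = 1]; the bound in [outgoing] also counts [k = 0] because the
     backward sum includes it. *)
  - move=> K; rewrite big_ord_recl; apply: ler_wpDl; first exact: normc_ge0.
    rewrite (le_trans (le_normc_sum _ _ _))//; apply: ler_sum => k _.
    by rewrite normc_gauged mul1r.
have [Lm hLm] := csum_cvg (sumg a n _ n0 im).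
have Lpm := obs a n _ _ n0 (hLp (a, n) n0) hLm.
exists (-1), (fun K => - c (a, n) + (-1) * \sum_(k < K) gd c a n (- k.+1%:Z)); split.
- by move=> k; nia.
- have -> : w (a, n) = - c (a, n) + (-1) * Lm.
    rewrite /w /= (negPf n0) mulN1r; move/eqP: Lpm; rewrite addr_eq0 => /eqP ->.
    by rewrite addrC.
  by apply: ctoD; [exact: cto_cst|exact: ctoZ].
move=> K; rewrite big_ord_recl /= mulr0 mul0r addr0 mulN1r.
rewrite (le_trans (le_normcB _ _))// normcN lerD2l.
rewrite (le_trans (le_normc_sum _ _ _))//; apply: ler_sum => k _.
by rewrite normc_gauged /bump /= mulN1r.
Qed.

Lemma cvg_sum_seq (I : Type) (r : seq I) (F : I -> nat -> R) (l : I -> R) :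
  (forall i, F i n @[n --> \oo] --> l i) ->
  \sum_(i <- r) F i n @[n --> \oo] --> \sum_(i <- r) l i.
Proof.
move=> h; elim: r => [|i r IH].
  by under eq_cvg do rewrite big_nil; rewrite big_nil; exact: cvg_cst.
by under eq_cvg do rewrite big_cons; rewrite big_cons; exact: cvgD.
Qed.

(** Cauchy-Schwarz with weights [wt ^ (- s)]. Along an outgoing chain the weight is at least
    [wt (a, n)] and at least [1 + k ^ 2], so the splitting [- s = - p + (p - s)] leaves one factor
    to sum over [k] and one for decay in [(a, n)]. *)
Lemma outgoing_term (s p : R) c (a n : int) (w : R[i]) sg v (A : R) K : 0 <= p <= s -> n != 0 ->
  outgoing c a n w sg v -> sumle (fun k : int => (1 + k%:~R ^+ 2) `^ (- p)) A ->
  normc (v K) ^+ 2 <= A * wt (a, n) `^ (p - s) *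
    \sum_(k < K.+1) wt (a + sg * k%:Z * n, n) `^ s *
       normc (c (a + sg * k%:Z * n, n)) ^+ 2.
Proof.
move=> /andP[p0 ps] n0 [hsg _ vK] hA.
pose x (k : nat) : int * int := (a + sg * k%:Z * n, n).
have wx k : 0 < wt (x k) :> R by exact: wt_gt0.
have sqz (i : int) : i%:~R ^+ 2 = `|i|%:R ^+ 2 :> R.
  by case: i => m //; rewrite NegzE intrN sqrrN abszN.
have wx1 k : wt (a, n) <= wt (x k) :> R.
  rewrite /wt /x /= lerD2r lerD2l !sqz hsg -!natrX ler_nat leq_sqr; lia.
have wx2 (k : nat) : 1 + k%:R ^+ 2 <= wt (x k) :> R.
  rewrite /wt /x /= !sqz hsg -addrA lerD2l; apply: ler_wpDr; first exact: sqr_ge0.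
  rewrite -!natrX ler_nat leq_sqr; have : (0 < `|n|)%N by rewrite absz_gt0.
  by nia.
have h1 := weighted_sqr_sum (index_enum 'I_K.+1)
  (fun k : 'I_K.+1 => wt (x k) `^ s * normc (c (x k)))
  (fun k => powR_ge0 (wt (x k) : R) (- s)).
have e0 k : wt (x k) `^ (- s) * wt (x k) `^ s = 1 :> R.
  by rewrite -powRD ?addNr ?powRr0// (gt_eqF (wx k)) implybT.
have h2 : \sum_(k < K.+1) wt (x k) `^ (- s) <= A * wt (a, n) `^ (p - s) :> R.
  apply: (@le_trans _ _ (\sum_(k < K.+1) (1 + k%:~R ^+ 2) `^ (- p) * wt (a, n) `^ (p - s))).
    apply: ler_sum => k _.
    have -> : wt (x k) `^ (- s) = wt (x k) `^ (- p) * wt (x k) `^ (p - s).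
      rewrite -powRD; last by rewrite (gt_eqF (wx k)) implybT.
      by congr (_ `^ _); ring.
    rewrite ler_pM ?powR_ge0//.
      rewrite !powRN lef_pV2 ?posrE ?powR_gt0// ?ltr_wpDr ?sqr_ge0//.
      have k1 : 0 <= 1 + (k%:Z)%:~R ^+ 2 :> R by rewrite addr_ge0 ?sqr_ge0.
      have w1 : 0 <= wt (x k) :> R by exact: ltW (wx k).
      by apply: ge0_ler_powR; rewrite ?nnegrE//; exact: wx2.
    rewrite -(opprB s p) !powRN lef_pV2 ?posrE ?powR_gt0 ?wt_gt0//.
    by rewrite ge0_ler_powR ?nnegrE ?subr_ge0// ltW// wt_gt0.
  rewrite -mulr_suml ler_wpM2r ?powR_ge0//.
  have := sumle_inj (fun i j : nat => _) hA.
  have ip : injective (fun k : nat => k%:Z) by move=> i j [].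
  move=> _; have := sumle_inj ip hA (iota_uniq 0 K.+1).
  by rewrite -(big_mkord xpredT (fun k : nat => (1 + k%:~R ^+ 2) `^ (- p))).
apply: (@le_trans _ _ ((\sum_(k < K.+1) normc (c (x k))) ^+ 2)).
  rewrite lerXn2r ?nnegrE ?normc_ge0 ?sumr_ge0// => k _.
  exact: normc_ge0.
have -> : \sum_(k < K.+1) normc (c (x k)) =
    \sum_(k < K.+1) wt (x k) `^ (- s) * (wt (x k) `^ s * normc (c (x k))).
  by apply: eq_bigr => k _; rewrite mulrA e0 mul1r.
apply: (le_trans h1).
have -> : \sum_(k < K.+1) wt (x k) `^ (- s) * (wt (x k) `^ s * normc (c (x k))) ^+ 2 =
    \sum_(k < K.+1) wt (x k) `^ s * normc (c (x k)) ^+ 2.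
  by apply: eq_bigr => k _; rewrite exprMn expr2 !mulrA e0 mul1r.
apply: ler_wpM2r => //; apply: sumr_ge0 => k _.
by rewrite mulr_ge0 ?powR_ge0 ?sqr_ge0.
Qed.

(** With [p = (s - t) / 2] the exponents [t] and [p - s] add up to [- p]. The exponent [p] is thus
    spent twice, on the sum along a chain and on the sum over [a]; each converges for [p > 1/2],
    which is [t < s - 1]. *)
Theorem transfer_sobolev (s t A : R) c w : 0 <= t -> t < s - 1 ->
  sumle (fun k => wt k `^ s * normc (c k) ^+ 2) A ->
  (forall a, w (a, 0) = 0) ->
  (forall a n, n != 0 -> exists sg v, outgoing c a n (w (a, n)) sg v) ->
  exists C, sumle (fun k => wt k `^ t * normc (w k) ^+ 2) C.
Proof.
move=> t0 ts cA w0 hout; pose p := (s - t) / 2.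
have p2 : 2^-1 < p by rewrite /p; lra.
have [Rp hRp] := sumle_powR p2.
have Rp0 := sumle_ge0 hRp.
have ps : 0 <= p <= s by rewrite /p; apply/andP; split; lra.
have /choice[sg hsg] : forall k : int * int, exists sg, exists v, k.2 != 0 ->
    outgoing c k.1 k.2 (w k) sg v.
  move=> [a n]; have [n0|n0] := eqVneq n 0; first by exists 0, (fun=> 0); rewrite n0.
  by have [sg [v h]] := hout a n n0; exists sg, v.
have /choice[v hv] := hsg.
pose H (k : int * int) := wt k `^ s * normc (c k) ^+ 2.
have H0 k : 0 <= H k by rewrite mulr_ge0 ?powR_ge0 ?sqr_ge0.
pose V k K := if k.2 == 0 then 0 else v k K.
pose q (a : int) : R := (1 + a%:~R ^+ 2) `^ (- p).
have q0 a : 0 <= q a by exact: powR_ge0.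
pose S k K : R := if k.2 == 0 then 0 else \sum_(j < K.+1) H (k.1 + sg k * j%:Z * k.2, k.2).
have term k K : wt k `^ t * normc (V k K) ^+ 2 <= Rp * (q k.1 * S k K).
  rewrite /V /S; case: k => a n /=; have [->|n0] := eqVneq n 0.
    by rewrite normc0 expr0n/= !mulr0.
  have h := outgoing_term K ps n0 (hv (a, n) n0) hRp.
  have S0 : 0 <= \sum_(j < K.+1) H (a + sg (a, n) * j%:Z * n, n) by exact: sumr_ge0.
  apply: (@le_trans _ _ (wt (a, n) `^ t * (Rp * wt (a, n) `^ (p - s) *
      \sum_(j < K.+1) H (a + sg (a, n) * j%:Z * n, n)))).
    by rewrite ler_wpM2l ?powR_ge0.
  rewrite mulrA mulrCA -!mulrA ler_wpM2l// !mulrA ler_wpM2r//.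
  rewrite -powRD; last by rewrite (gt_eqF (wt_gt0 _)) implybT.
  rewrite (_ : t + (p - s) = - p); last by rewrite /p; field.
  rewrite /q !powRN lef_pV2 ?posrE ?powR_gt0 ?wt_gt0// ?ltr_wpDr ?sqr_ge0//.
  have /andP[p0 _] := ps.
  have w1 : 0 <= wt (a, n) :> R by exact/ltW/wt_gt0.
  have a1 : 0 <= 1 + a%:~R ^+ 2 :> R by rewrite addr_ge0 ?sqr_ge0.
  have a2 : 1 + a%:~R ^+ 2 <= wt (a, n) :> R by rewrite /wt /= lerDl sqr_ge0.
  by apply: ge0_ler_powR; rewrite ?nnegrE.
have finite r K : uniq r -> \sum_(k <- r) wt k `^ t * normc (V k K) ^+ 2 <= Rp * (Rp * A).
  move=> ur; apply: (@le_trans _ _ (\sum_(k <- r) Rp * (q k.1 * S k K))).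
    by apply: ler_sum => k _; exact: term.
  rewrite -mulr_sumr ler_wpM2l//.
  pose ra := undup (map fst r); pose rn := undup (map snd r).
  have S0 k : 0 <= S k K by rewrite /S; case: ifP => // _; exact: sumr_ge0.
  apply: (@le_trans _ _ (\sum_(k <- [seq (a, n) | a <- ra, n <- rn]) q k.1 * S k K)).
    apply: ler_sum_uniq_sub => // [k|[a n] kr]; first by rewrite mulr_ge0.
    by apply/allpairsP; exists (a, n); rewrite !mem_undup; split => //;
      apply/mapP; exists (a, n).
  rewrite big_allpairs/=.
  apply: (@le_trans _ _ (\sum_(a <- ra) q a * A)).
    apply: ler_sum => a _; rewrite -mulr_sumr ler_wpM2l//.
    pose rn' := [seq n <- rn | n != 0].
    have -> : \sum_(n <- rn) S (a, n) K = \sum_(n <- rn') \sum_(j <- iota 0 K.+1)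
        H (a + sg (a, n) * j%:Z * n, n).
      rewrite big_filter [RHS]big_mkcond; apply: eq_bigr => n _; rewrite /S /=.
      case: eqP => //= _; rewrite -(big_mkord xpredT
        (fun j : nat => H (a + sg (a, n) * j%:Z * n, n))).
      by rewrite /index_iota subn0.
    (* For fixed [a] the points of the outgoing chains of all [n] are pairwise distinct, so they
       contribute at most [A] together. *)
    pose key (nj : int * nat) : int * int := (a + sg (a, nj.1) * nj.2%:Z * nj.1, nj.1).
    have -> : \sum_(n <- rn') \sum_(j <- iota 0 K.+1) H (a + sg (a, n) * j%:Z * n, n) =
        \sum_(k <- map key [seq (n, j) | n <- rn', j <- iota 0 K.+1]) H k.
      by rewrite big_map big_allpairs.
    apply: cA; rewrite map_inj_in_uniq.
      apply: allpairs_uniq; rewrite ?filter_uniq ?undup_uniq ?iota_uniq//.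
      by move=> [? ?] [? ?] _ _ [-> ->].
    move=> [n j] [n' j'] /allpairsP[[m i] [mr _ [-> ->]]].
    move=> /allpairsP[[m' i'] [_ _ [-> ->]]]; rewrite /= in mr *; move=> [] + e; rewrite -e => ej.
    have m0 : m != 0 by move: mr; rewrite mem_filter => /andP[].
    have [hs _ _] := hv (a, m) m0; congr (_, _).
    have := hs i; rewrite /= ej hs => /addnI/eqP.
    by rewrite eqn_pmul2r ?absz_gt0// => /eqP.
  rewrite -mulr_suml ler_wpM2r//; first exact: sumle_ge0 cA.
  exact/hRp/undup_uniq.
exists (Rp * (Rp * A)) => r ur.
(* The bound is uniform in [K]; with the finite family fixed, the limit in [K] passes from [V] to
   [w]. *)
have cv : \sum_(k <- r) wt k `^ t * normc (V k K) ^+ 2 @[K --> \oo] -->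
    \sum_(k <- r) wt k `^ t * normc (w k) ^+ 2.
  apply: cvg_sum_seq => k; apply: cvgM; first exact: cvg_cst.
  have : normc (V k K) @[K --> \oo] --> normc (w k).
    apply: cto_normc; rewrite /V; case: k => a n /=.
    have [->|n0] := eqVneq n 0; first by rewrite w0; exact: cto_cst.
    by have [_ h _] := hv (a, n) n0.
  by move=> h; rewrite expr2; under eq_cvg do rewrite expr2; exact: cvgM.
apply: (ler_cvg_to cv (cvg_cst (Rp * (Rp * A)))).
by apply: nearW => K; exact: finite.
Qed.

End TransferCoefficients.

(** * Invariant distributions *)

Section Smoothness.
Context {R : realType}.

Definition lform (p q : R) (z : R * R) : R := p * z.1 + q * z.2.

(** For a fixed linear form these combinations are stable under partial derivatives, which carries
    the induction for smoothness. *)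
Definition wave (p q A B : R) (z : R * R) : R :=
  A * cos (lform p q z) + B * sin (lform p q z).

Lemma is_diff_lform p q z : is_diff z (lform p q) (lform p q).
Proof.
have lin : linear (lform p q).
  by move=> a x y; rewrite /lform /= /GRing.scale /=; ring.
pose M := GRing.isLinear.Build _ _ _ _ _ lin.
pose L : {linear _ -> _} := HB.pack (lform p q) M.
have cL : continuous L.
  move=> x; rewrite /= /lform; apply: cvgD; apply: cvgM; try exact: cvg_cst.
    exact: cvg_fst.
  exact: cvg_snd.
have -> : lform p q = L by [].
apply: DiffDef; first exact: linear_differentiable.
exact: diff_lin.
Qed.

Lemma is_diff_wave p q A B z : is_diff z (wave p q A B)
  (fun h => (B * cos (lform p q z) - A * sin (lform p q z)) * lform p q h).
Proof.
have dL := is_diff_lform p q z.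
have dc : is_diff (lform p q z) cos (fun h => h * - sin (lform p q z)).
  have d : derivable cos (lform p q z) 1 by exact: derivable_cos.
  apply: DiffDef; first exact/derivable1_diffP.
  by rewrite deriv1E// derive1E derive_val.
have ds : is_diff (lform p q z) sin (fun h => h * cos (lform p q z)).
  have d : derivable sin (lform p q z) 1 by exact: derivable_sin.
  apply: DiffDef; first exact/derivable1_diffP.
  by rewrite deriv1E// derive1E derive_val.
have -> : wave p q A B = A *: (cos \o lform p q) + B *: (sin \o lform p q).
  by [].
have d1 := is_diffZ A (is_diff_comp dL dc).
have d2 := is_diffZ B (is_diff_comp dL ds).
apply: is_diff_eq (is_diffD d1 d2) _; apply/funext => h.
rewrite !fctE /= -![_ *: _]/(_ * _).
set x := cos _; set y := sin _; set l := lform p q h.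
ring.
Qed.

Lemma partial_wave i p q A B : partial i (wave p q A B) =
  wave p q ((if i then q else p) * B) (- (if i then q else p) * A).
Proof.
apply/funext => z; rewrite /partial.
have d := is_diff_wave p q A B z.
rewrite deriveE; last exact: ex_diff.
by rewrite diff_val /wave /lform; case: i => /=; ring.
Qed.

Lemma smooth_real_wave p q A B : smooth_real (wave p q A B).
Proof.
move=> l z; suff [A' [B' ->]] : exists A' B', foldr partial (wave p q A B) l = wave p q A' B'.
  by have d := is_diff_wave p q A' B' z; exact: ex_diff.
elim: l => [|i l [A' [B' IH]]]; first by exists A, B.
by rewrite /= IH partial_wave; do 2 eexists.
Qed.

(** Invariance of a distribution is tested on smooth functions only; the characters are the ones
    used. *)
Lemma smooth_fchar a b : smooth_torus (fchar a b : R * R -> R[i]).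
Proof.
split; first exact: periodic2_fchar.
  rewrite (_ : (fun _ => _) = wave (2 * pi * a%:~R) (2 * pi * b%:~R) 1 0).
    exact: smooth_real_wave.
  by apply/funext => z; rewrite /wave /lform /= mul1r mul0r addr0; congr cos; ring.
rewrite (_ : (fun _ => _) = wave (2 * pi * a%:~R) (2 * pi * b%:~R) 0 1).
  exact: smooth_real_wave.
by apply/funext => z; rewrite /wave /lform /= mul1r mul0r add0r; congr sin; ring.
Qed.

End Smoothness.

(** * Sobolev functions and bounded functionals on them *)

Section SobolevDual.
Context {R : realType}.
Implicit Types (g h : R * R -> R[i]) (c : int * int -> R[i]).

Lemma wt_powR_ge0 (s : R) g k : 0 <= wt k `^ s * normc (fcoef g k.1 k.2) ^+ 2.
Proof. by rewrite mulr_ge0 ?powR_ge0 ?sqr_ge0. Qed.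

Lemma sobolev_sumle (s : R) g : sobolev s g ->
  sumle (fun k => wt k `^ s * normc (fcoef g k.1 k.2) ^+ 2) (fine (sobolev_sqnorm s g)).
Proof. by move=> [_ h]; apply: sumle_esum => // k; exact: wt_powR_ge0. Qed.

Lemma sumle_sqnorm (s A : R) g :
  sumle (fun k => wt k `^ s * normc (fcoef g k.1 k.2) ^+ 2) A ->
  (sobolev_sqnorm s g <= A%:E)%E.
Proof. by apply: esum_sumle => k; exact: wt_powR_ge0. Qed.

Lemma sumle_sobolev (s A : R) g : L2T2 g ->
  sumle (fun k => wt k `^ s * normc (fcoef g k.1 k.2) ^+ 2) A -> sobolev s g.
Proof. by move=> h /sumle_sqnorm/le_lt_trans hA; split; rewrite ?hA ?ltry. Qed.

Lemma sumle_sobolev_norm (s A : R) g :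
  sumle (fun k => wt k `^ s * normc (fcoef g k.1 k.2) ^+ 2) A ->
  sobolev_norm s g <= Num.sqrt A.
Proof.
move=> hA; have A0 := sumle_ge0 hA; have := sumle_sqnorm hA.
have : (0 <= sobolev_sqnorm s g)%E.
  by apply: esum_ge0 => k _; rewrite lee_fin; exact: (wt_powR_ge0 s g k).
rewrite /sobolev_norm; case: sobolev_sqnorm => //= r _.
by rewrite lee_fin ler_sqrt.
Qed.

Lemma L2T2_rint g : periodic2 g -> cmeasurable2 g -> rint (fun z => normc (g z) ^+ 2) ->
  L2T2 g.
Proof.
move=> pg mg /integrableP[_ h]; split => //.
apply: le_lt_trans h; apply: ge0_le_integral => //.
- by move=> z _; rewrite lee_fin sqr_ge0.
- apply/measurable_EFinP/measurable_funTS; exact: rmeasurable_sqr_normc.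
- by apply: measurableT_comp => //; apply/measurable_EFinP/measurable_funTS;
    exact: rmeasurable_sqr_normc.
- by move=> z _; rewrite /= lee_fin ler_norm.
Qed.

Lemma rint_L2T2 g : L2T2 g -> rint (fun z => normc (g z) ^+ 2).
Proof.
move=> [_ mg gfin]; apply/integrableP; split.
  by apply/measurable_EFinP/measurable_funTS; exact: rmeasurable_sqr_normc.
by under eq_integral => z _ do rewrite gee0_abs ?lee_fin ?sqr_ge0//.
Qed.

Lemma L2T2_cbnd g : cbnd g -> periodic2 g -> L2T2 g.
Proof. by move=> bg pg; apply: L2T2_rint; [|case: bg|exact: (cbnd_rint_normX 2 bg)]. Qed.

Lemma L2T2B g h : L2T2 g -> L2T2 h -> L2T2 (fun z => g z - h z).
Proof.
move=> Lg Lh; have [pg mg _] := Lg; have [ph mh _] := Lh.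
apply: L2T2_rint.
- by move=> x y; have [-> ->] := pg x y; have [-> ->] := ph x y.
- exact: cmeasurable2B.
apply: (@rint_dom _ _ (fun z => 2 * normc (g z) ^+ 2 + 2 * normc (h z) ^+ 2)).
- have mgh := cmeasurable2B mg mh.
  exact: rmeasurable_sqr_normc mgh.
- move=> z; rewrite ger0_norm ?sqr_ge0//.
  apply: le_trans (_ : (normc (g z) + normc (h z)) ^+ 2 <= _).
    by rewrite lerXn2r ?nnegrE ?addr_ge0 ?normc_ge0// le_normcB.
  by have := sqr_ge0 (normc (g z) - normc (h z)); nra.
- by apply: rintD; apply: rintZ; exact: rint_L2T2.
Qed.

Lemma sumle_support (I : eqType) (h : I -> R) (r : seq I) : (forall i, 0 <= h i) ->
  (forall i, i \notin r -> h i = 0) -> sumle h (\sum_(i <- undup r) h i).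
Proof.
move=> h0 hr t ut; rewrite (bigID (mem r)) /= [X in _ + X]big1//.
rewrite addr0 -big_filter; apply: ler_sum_uniq_sub => //; rewrite ?filter_uniq ?undup_uniq//.
by move=> i; rewrite mem_filter mem_undup => /andP[].
Qed.

Lemma sobolev_trigpoly (s : R) r c : sobolev s (trigpoly r id c).
Proof.
apply: (sumle_sobolev (L2T2_cbnd (cbnd_trigpoly _ _ _) (periodic2_trigpoly _ _ _))).
apply: (@sumle_support _ _ r) => [k|k kr]; first exact: wt_powR_ge0.
rewrite fcoef_trigpoly big1_seq ?normc0 ?expr0n ?mulr0// => i /andP[/eqP ->].
by rewrite -surjective_pairing (negPf kr).
Qed.

Lemma fchar_trigpoly a b :
  (fchar a b : R * R -> R[i]) = trigpoly [:: (a, b)] id (fun=> 1).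
Proof. by apply/funext => z; rewrite /trigpoly big_seq1 mul1r. Qed.

Lemma sobolev_fchar (s : R) a b : sobolev s (fchar a b : R * R -> R[i]).
Proof. by rewrite fchar_trigpoly; exact: sobolev_trigpoly. Qed.

Lemma dual_trigpoly (s : R) D r c : sobolev_dual s D ->
  D (trigpoly r id c) = \sum_(k <- r) c k * D (fchar k.1 k.2).
Proof.
move=> [lin _]; elim: r => [|k r IH].
  (* [D 0 = 0] comes from linearity at [0 = 1 * 0 + 0]. *)
  have e : trigpoly [::] id c = fun z => 1 * trigpoly [::] id c z + trigpoly [::] id c z.
    by apply/funext => z; rewrite /trigpoly !big_nil mulr0 addr0.
  rewrite big_nil; apply: (@addrI _ (D (trigpoly [::] id c))).
  rewrite addr0 [in RHS]e lin; try exact: sobolev_trigpoly.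
  by rewrite mul1r.
rewrite big_cons -IH -lin; [|exact: sobolev_fchar|exact: sobolev_trigpoly].
by congr D; apply/funext => z; rewrite /trigpoly big_cons.
Qed.

(* The tail of the Sobolev series dominates the distance from [phi] to its
   rectangular partial sums, so [D phi] is the limit of the partial pairings. *)
Lemma dual_approx (s : R) D phi : sobolev_dual s D -> sobolev s phi ->
  forall e, 0 < e -> exists n0, forall n m, (n0 <= n)%N -> (n0 <= m)%N ->
    normc (D phi - \sum_(k <- bx n m) fcoef phi k.1 k.2 * D (fchar k.1 k.2)) <= e.
Proof.
move=> dD sphi e e0; have [lin [M hM]] := dD; have [Lphi _] := sphi.
pose c k := fcoef phi k.1 k.2.
(* [D] sends a tail of norm at most [d] to modulus at most [|M| d <= e]; the absolute value and the
   [+ 1] guard against a nonpositive [M]. *)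
pose d := e / (`|M| + 1).
have M0 : 0 < `|M| + 1 by rewrite ltr_wpDl.
have d0 : 0 < d by rewrite divr_gt0.
have [r0 _ hr0] := sumle_tail (wt_powR_ge0 s phi) (sobolev_sumle sphi) (exprn_gt0 2 d0).
have [n0 sub0] := sub_bx r0; exists n0 => n m nn nm.
pose r := bx n m; pose P := trigpoly r id c.
have LP : L2T2 P := L2T2_cbnd (cbnd_trigpoly _ _ _) (periodic2_trigpoly _ _ _).
have L1 := L2T2B Lphi LP.
have cf k : fcoef (fun z => phi z - P z) k.1 k.2 = if k \in r then 0 else c k.
  rewrite fcoefB; try exact: cint_L2.
  rewrite fcoef_trigpoly -big_filter.
  case: ifP => kr.
    rewrite (perm_big [:: k]) ?big_seq1 ?subrr//.
    apply: uniq_perm; rewrite ?filter_uniq ?bx_uniq// => i.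
    rewrite mem_filter mem_seq1 -surjective_pairing.
    by case: eqP => // ->.
  rewrite big1_seq ?subr0// => i; rewrite mem_filter -surjective_pairing.
  by move=> /andP[_ /andP[/eqP -> ]]; rewrite kr.
have tail : sumle (fun k => wt k `^ s * normc (fcoef (fun z => phi z - P z) k.1 k.2) ^+ 2)
    (d ^+ 2).
  move=> t ut; apply: (@le_trans _ _ (\sum_(k <- [seq k <- t | k \notin r])
      wt k `^ s * normc (c k) ^+ 2)).
    rewrite big_filter [leRHS]big_mkcond; apply: ler_sum => k _; rewrite cf.
    by case: (k \in r); rewrite ?normc0 ?expr0n ?mulr0.
  apply: hr0; first by rewrite filter_uniq.
  move=> k; rewrite mem_filter => /andP[kr _]; apply: contra kr => /sub0.
  exact: bx_sub.
have s1 := sumle_sobolev L1 tail.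
have -> : D phi = D (fun z => phi z - P z) + D P.
  have := lin 1 _ _ s1 (sobolev_trigpoly s r c); rewrite mul1r => <-.
  by congr D; apply/funext => z; rewrite mul1r subrK.
rewrite (dual_trigpoly _ _ dD) addrK (le_trans (hM _ s1))//.
have := sumle_sobolev_norm tail; rewrite sqrtr_sqr ger0_norm ?(ltW d0)// => hn.
have n1 : 0 <= sobolev_norm s (fun z => phi z - P z) by exact: sqrtr_ge0.
apply: (@le_trans _ _ (`|M| * d)).
  apply: (le_trans (ler_wpM2r n1 (ler_norm M))).
  by rewrite ler_wpM2l.
rewrite /d mulrCA ger_pMr// ler_pdivrMr// mul1r.
by rewrite lerDl.
Qed.

End SobolevDual.

(** * Telescoping of an invariant distribution along rows *)

Section InvariantDistributions.
Context {R : realType} (al be : R).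
Local Notation f := (skew_shift al be).
Implicit Types (c w : int * int -> R[i]).

Lemma cto_sum (I : Type) (r : seq I) (F : I -> nat -> R[i]) :
  (forall i, cto (F i) 0) -> cto (fun n => \sum_(i <- r) F i n) 0.
Proof.
move=> h; elim: r => [|i r IH].
  by apply: cto_eq (cto_cst 0) => n; rewrite big_nil.
rewrite -[X in cto _ X](addr0 0); apply: cto_eq (ctoD (h i) IH) => n.
by rewrite big_cons.
Qed.

(** For large [n] the window and its translate both contain a finite set outside of which sums are
    at most [e / 2], so only two small remainders survive. *)
Lemma telescope_zr (g : int -> R[i]) (b : int) A : sumle (fun a => normc (g a)) A ->
  cto (fun n => \sum_(a <- zr n) (g (a - b) - g a)) 0.
Proof.
move=> gA e e0; have e2 : 0 < e / 2 by rewrite divr_gt0.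
have [r0 u0 hr0] := sumle_tail (fun a => normc_ge0 (g a)) gA e2.
pose n0 := \sum_(a <- r0) absz a.
have sub0 n : (n0 + absz b <= n)%N -> {subset r0 <= zr n} /\
    {subset r0 <= map (fun a => a - b) (zr n)}.
  move=> nn.
  have le a : a \in r0 -> (absz a <= n0)%N.
    by move=> ar; rewrite /n0 (bigD1_seq a)//= leq_addr.
  split=> a ar; first by rewrite mem_zr; have := le a ar; lia.
  apply/mapP; exists (a + b); last by rewrite addrK.
  by rewrite mem_zr; have := le a ar; lia.
exists (n0 + absz b)%N => n nn; rewrite subr0 sumrB.
have [s1 s2] := sub0 n nn.
have us : uniq (map (fun a => a - b) (zr n)).
  by rewrite map_inj_uniq ?zr_uniq//; exact: addIr.
rewrite -(big_map (fun a => a - b) xpredT g) (sum_uniq_split _ u0 us s2).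
rewrite (sum_uniq_split _ u0 (zr_uniq n) s1) opprD addrACA subrr add0r.
rewrite (le_trans (le_normcB _ _))// [e]splitr lerD//.
  rewrite (le_trans (le_normc_sum _ _ _))// hr0 ?filter_uniq// => a.
  by rewrite mem_filter => /andP[].
rewrite (le_trans (le_normc_sum _ _ _))// hr0 ?filter_uniq ?zr_uniq// => a.
by rewrite mem_filter => /andP[].
Qed.

Lemma invariant_distribution_fchar (s : R) D a b : sobolev_dual s D ->
  invariant_distribution f D ->
  ex (a%:~R * al + b%:~R * be) * D (fchar (a + b) b) = D (fchar a b).
Proof.
move=> dD iD; rewrite -(iD _ (smooth_fchar a b)).
have -> : fchar a b \o f =
    trigpoly [:: (a + b, b)] id (fun=> ex (a%:~R * al + b%:~R * be)).
  by apply/funext => z; rewrite /trigpoly big_seq1 /= fchar_skew_shift.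
by rewrite (dual_trigpoly _ _ dD) big_seq1.
Qed.

(** The modulus is unchanged under [a -> a + b], so [|b|] residues determine all its values. The
    bound depends on [b]. *)
Lemma invariant_distribution_bounded (s : R) D b : sobolev_dual s D ->
  invariant_distribution f D -> b != 0 ->
  exists K, forall a, normc (D (fchar a b)) <= K.
Proof.
move=> dD iD b0.
have per a : normc (D (fchar (a + b) b)) = normc (D (fchar a b)).
  by rewrite -(invariant_distribution_fchar a b dD iD) normcM normc_ex mul1r.
have pern a (n : nat) : normc (D (fchar (a + n%:Z * b) b)) = normc (D (fchar a b)).
  elim: n => [|n IH]; first by rewrite mul0r addr0.
  by rewrite -IH -[RHS]per -addrA; congr (normc (D (fchar _ _))); rewrite -addn1 PoszD mulrDl mul1r.
have perz a (n : int) : normc (D (fchar (a + n * b) b)) = normc (D (fchar a b)).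
  case: n => n; first exact: pern.
  by rewrite -(pern _ n.+1) NegzE mulNr subrK.
exists (\sum_(r < absz b) normc (D (fchar r%:Z b))) => a.
rewrite (divz_eq a b) addrC perz.
have m0 : 0 <= (a %% b)%Z by exact: modz_ge0.
have mb : (absz (a %% b)%Z < absz b)%N.
  by rewrite -ltz_nat gez0_abs// ltz_mod.
rewrite (bigD1 (Ordinal mb))//= gez0_abs// lerDl.
by apply: sumr_ge0 => r _; exact: normc_ge0.
Qed.

(** On a row, invariance of [D] makes each term the difference of [w D] at consecutive points of a
    chain, and [w D] is summable because [D] is bounded on that row. *)
Theorem invariant_distribution_vanishes (s W : R) D phi w : sobolev_dual s D ->
  invariant_distribution f D -> sobolev s phi ->
  (forall a, fcoef phi a 0 = 0) ->
  transfer_eq al be (fun k => fcoef phi k.1 k.2) w ->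
  sumle (fun k => normc (w k)) W -> D phi = 0.
Proof.
move=> dD iD sphi phi0 tw wW; apply: normc_eq0_small => e e0.
have e2 : 0 < e / 2 by rewrite divr_gt0.
have [n0 hn0] := dual_approx dD sphi e2.
have rows b : cto (fun n => \sum_(a <- zr n) fcoef phi a b * D (fchar a b)) 0.
  have [->|b0] := eqVneq b 0.
    apply: cto_eq (cto_cst 0) => n; rewrite big1// => a _.
    by rewrite phi0 mul0r.
  have [K hK] := invariant_distribution_bounded dD iD b0.
  have K0 : 0 <= K by exact: le_trans (normc_ge0 _) (hK 0).
  pose g a := w (a, b) * D (fchar a b).
  have gW : sumle (fun a => normc (g a)) (K * W).
    have inj : injective (fun a : int => (a, b)) by move=> x y [].
    apply: sumle_le (sumleZ K0 (sumle_inj inj wW)) => a /=.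
    by rewrite /g normcM mulrC ler_wpM2r ?normc_ge0.
  apply: cto_eq (telescope_zr b gW) => n; apply: eq_bigr => a _.
  have := tw a b; rewrite /= => <-.
  rewrite mulrBl /g; congr (_ - _).
  rewrite -(invariant_distribution_fchar (a - b) b dD iD) subrK.
  by rewrite mulrA [w _ * _]mulrC.
have [n1 hn1] := cto_sum (zr n0) rows e2.
(* The rows are limited by [n0] before the width [n] is enlarged, since the convergence to 0 is
   known only row by row; hence the rectangles in [dual_approx]. *)
pose n := maxn n0 n1.
have := hn1 n (leq_maxr _ _); rewrite subr0 exchange_big/= => h1.
have := hn0 n n0 (leq_maxl _ _) (leqnn _); rewrite /bx big_allpairs /= => h2.
rewrite [e]splitr; apply: le_trans (lerD h2 h1).
by rewrite -[X in normc X <= _](subrK (\sum_(a <- zr n) \sum_(b <- zr n0)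
  fcoef phi a b * D (fchar a b))) le_normcD.
Qed.

End InvariantDistributions.

(** * Rigidity *)

Section Rigidity.
Context {R : realType} (al be : R).
Local Notation f := (skew_shift al be).
Local Notation T2 := (measurableTypeR R * measurableTypeR R)%type.

(** The character of frequency [(a, 0)] depends on [x] alone, hence is a pullback. *)
Lemma orth_pullback_fcoef0 (phi : R * R -> R[i]) a : orth_pullback phi -> fcoef phi a 0 = 0.
Proof.
move=> [_ h]; pose psi x : R[i] := fchar a 0 (x, 0).
have -> : fcoef phi a 0 = L2_inner phi (psi \o fst).
  congr L2_inner; apply/funext => z.
  by rewrite /psi /= !fcharE /= !mul0r.
apply: h; split.
- by move=> x; have [] := periodic2_fchar a 0 (x : R) 0.
- have [m1 m2] := cmeasurable2_fchar (R := R) a 0.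
  have mp : measurable_fun [set: measurableTypeR R] (fun x : measurableTypeR R => (x, 0) : T2).
    by apply: measurable_fun_pair => //; exact: measurable_cst.
  by split; [exact: (measurableT_comp m1 mp)|exact: (measurableT_comp m2 mp)].
- under eq_integral => x _ do rewrite normc_fchar expr1n.
  rewrite integral_cst; last exact: measurable_itv.
  have -> : leb1 (@unit_interval R) = 1%E.
    rewrite /leb1 /unit_interval.
    by rewrite [LHS]lebesgue_measure_itv/= lte_fin ltr01 oppr0 adde0.
  by rewrite mule1 ltry.
Qed.

Lemma ae_eq_L2T2 (g h : R * R -> R[i]) : L2T2 h -> periodic2 g -> cmeasurable2 g ->
  aet (fun z => g z = h z) -> L2T2 g.
Proof.
move=> [ph mh hfin] pg mg gh; split=> //.
have e : (\int[leb2]_(z in unit_square) (normc (g z) ^+ 2)%:E =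
    \int[leb2]_(z in unit_square) (normc (h z) ^+ 2)%:E)%E; last by rewrite e.
apply: ae_eq_integral; first exact: measurable_unit_square.
- by apply/measurable_EFinP/measurable_funTS; exact: rmeasurable_sqr_normc.
- by apply/measurable_EFinP/measurable_funTS; exact: rmeasurable_sqr_normc.
- by apply: aetS gh => z ->.
Qed.

(** Both sides are bounded and have the same Fourier coefficients. *)
Lemma cohomologous_solution (w : int * int -> R[i]) G v W :
  cbnd G -> periodic2 v -> cbnd v ->
  (forall a b, fcoef v a b = w (a, b)) ->
  transfer_eq al be (fun k => fcoef G k.1 k.2) w ->
  sumle (fun k => normc (w k)) W ->
  aet (fun z => v (f z) - v z = G z).
Proof.
move=> bG pv bv vw tw wW.
have bvf : cbnd (v \o f).
  have [mv [M vM]] := bv; split; first exact: cmeasurable2_skew_shift.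
  by exists M => z; exact: vM.
suff : aet (fun z => ((v \o f) z - v z) - G z = 0).
  by apply: aetS => z /eqP; rewrite subr_eq0 => /eqP.
apply: fourier_uniqueness; split; first by apply: cintB; [apply: cintB|]; exact: cbnd_cint.
move=> a b; rewrite fcoefB; try exact: cbnd_cint; last first.
  by apply: cintB; exact: cbnd_cint.
rewrite fcoefB; try exact: cbnd_cint.
rewrite fcoef_skew_shift//; last exact: cbnd_cint.
by rewrite !vw tw subrr.
Qed.

Lemma solution_unique (u v : R * R -> R[i]) : irrational al ->
  cmeasurable2 u -> periodic2 u -> cmeasurable2 v -> periodic2 v ->
  aet (fun z => u (f z) - u z = v (f z) - v z) ->
  exists C, aet (fun z => u z = v z + C).
Proof.
move=> ial mu pu mv pv uv.
have [C hC] : exists C, aet (fun z => u z - v z = C).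
  apply: (@ergodic _ al be) => //.
  - exact: cmeasurable2B.
  - by move=> x y; have [-> ->] := pu x y; have [-> ->] := pv x y.
  - apply: aetS uv => z e; apply/eqP; rewrite -subr_eq0; apply/eqP.
    by rewrite -(subrr (v (f z) - v z)) -[X in _ = X - _]e; ring.
by exists C; apply: aetS hC => z <-; rewrite addrC subrK.
Qed.

(** The constant affects only the coefficient of index [(0, 0)]; the factor 2 below is that of
    [(x + y) ^ 2 <= 2 (x ^ 2 + y ^ 2)]. *)
Lemma sobolev_addC (t A : R) (u v : R * R -> R[i]) C (w : int * int -> R[i]) :
  periodic2 u -> cmeasurable2 u -> cbnd v -> periodic2 v ->
  aet (fun z => u z = v z + C) -> (forall a b, fcoef v a b = w (a, b)) ->
  sumle (fun k => wt k `^ t * normc (w k) ^+ 2) A -> sobolev t u.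
Proof.
move=> pu mu bv pv uv vw wA.
have bC : cbnd (fun _ : R * R => C) by exact: cbnd_cst.
have bvC : cbnd (fun z => v z + C) by exact: cbndD.
have pvC : periodic2 (fun z => v z + C) by move=> x y; have [-> ->] := pv x y.
have Lu := ae_eq_L2T2 (L2T2_cbnd bvC pvC) pu mu uv.
have uw a b : fcoef u a b = w (a, b) + fcoef (fun=> C) a b.
  rewrite (ae_eq_fcoef _ _ mu (proj1 bvC) uv) fcoefD ?vw//; exact: cbnd_cint.
pose h (k : int * int) : R := wt k `^ t * normc (fcoef (fun=> C) k.1 k.2) ^+ 2.
have h0 k : 0 <= h k by exact: wt_powR_ge0.
have hs : sumle h (\sum_(k <- undup [:: (0, 0)]) h k).
  apply: sumle_support => // k; rewrite mem_seq1 => k0.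
  by rewrite /h fcoef_cst -surjective_pairing (negPf k0) normc0 expr0n mulr0.
have hA := sumleZ (ler0n R 2) (sumleD wA hs).
apply: (sumle_sobolev Lu (sumle_le _ hA)) => k.
rewrite uw -surjective_pairing /h; set x := w k; set y := fcoef _ _ _.
have -> : 2 * (wt k `^ t * normc x ^+ 2 + wt k `^ t * normc y ^+ 2) =
    wt k `^ t * (2 * (normc x ^+ 2 + normc y ^+ 2)) by ring.
apply: ler_wpM2l; first exact: powR_ge0.
apply: le_trans (_ : (normc x + normc y) ^+ 2 <= _).
  by rewrite lerXn2r ?nnegrE ?addr_ge0 ?normc_ge0// le_normcD.
by have := sqr_ge0 (normc x - normc y); nra.
Qed.

End Rigidity.

Local Close Scope complex_scope.

Theorem theorem7 (R : realType) (alpha beta s : R) (phi : R * R -> R[i])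
  (halpha : @irrational R alpha) (hs : 3 < s)
  (hperp : orth_pullback phi) (hphi : sobolev s phi) :
  forall u : R * R -> R[i],
    measurable_transfer (skew_shift alpha beta) phi u ->
    (forall D : (R * R -> R[i]) -> R[i],
        sobolev_dual s D ->
        invariant_distribution (skew_shift alpha beta) D ->
        D phi = 0) /\
    (forall t : R, t < s - 1 -> sobolev t u).
Proof.
move=> u [pu mu hu].
have hu' : aet (fun z => phi z = u (skew_shift alpha beta z) - u z) by [].
pose c k := fcoef phi k.1 k.2.
have [Lphi _] := hphi; have [pphi mphi _] := Lphi.
have cA := sobolev_sumle hphi.
have c0 a : c (a, 0) = 0 by exact: orth_pullback_fcoef0.
have [B hB] := sumle_normc_weight (ltW hs) cA.
have cB : sumle (fun k => Normc.normc (c k)) B.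
  apply: sumle_le hB => k; rewrite ler_peMr ?normc_ge0//.
  by rewrite lerDl.
(* [phi] is replaced by the bounded sum [G] of its Fourier series, uniformly approximated by partial
   sums; the two agree almost everywhere by uniqueness of coefficients. *)
have [G [bG pG unif fG]] := fourier_series cB.
have phiG : aet (fun z => phi z = G z).
  suff : aet (fun z => phi z - G z = 0).
    by apply: aetS => z /eqP; rewrite subr_eq0 => /eqP.
  apply: fourier_uniqueness; split; first by apply: cintB; [exact: cint_L2|exact: cbnd_cint].
  move=> a b; rewrite fcoefB ?fG ?subrr//; [exact: cint_L2|exact: cbnd_cint].
have Gu : aet (fun z => G z = u (skew_shift alpha beta z) - u z).
  by apply: aetS (aetI phiG hu') => z [<-].
have obs := obstruction_vanishes halpha bG pG mu pu Gu unif c0 hB.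
have [w [tw w0 wout]] := transfer_exists cB c0 obs.
have wt_sum t : 0 <= t -> t < s - 1 ->
    exists C, sumle (fun k => powR (wt k) t * Normc.normc (w k) ^+ 2) C.
  by move=> t0 ts; exact: (transfer_sobolev t0 ts cA w0 wout).
(* The exponent 2 is below [s - 1] because [s > 3], and large enough to make [w] absolutely
   summable. *)
have [C2 hC2] : exists C, sumle (fun k => powR (wt k) 2 * Normc.normc (w k) ^+ 2) C.
  by apply: wt_sum; lra.
have [W hW] := sumle_normc hC2.
split=> [D dD iD|t ts].
  by apply: (invariant_distribution_vanishes dD iD hphi _ tw hW) => a; exact: c0.
have [v [bv pv _ fv]] := fourier_series hW.
have twG : transfer_eq alpha beta (fun k => fcoef G k.1 k.2) w.
  by move=> a b; rewrite tw fG.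
have vG := cohomologous_solution bG pv bv fv twG hW.
have [C hC] : exists C, aet (fun z => u z = v z + C).
  apply: (@solution_unique _ alpha beta) => //; first by case: bv.
  by apply: aetS (aetI Gu vG) => z [<- ->].
(* [transfer_sobolev] concerns [0 <= t]; a negative [t] is dominated by the exponent 0 because the
   weight is at least 1. *)
have [A hA] : exists A, sumle (fun k => powR (wt k) (Num.max t 0) * Normc.normc (w k) ^+ 2) A.
  by apply: wt_sum; rewrite ?le_max ?lexx ?orbT// gt_max ts/=; lra.
have hAt : sumle (fun k => powR (wt k) t * Normc.normc (w k) ^+ 2) A.
  apply: sumle_le hA => k; rewrite ler_wpM2r ?sqr_ge0// ler_powR ?wt_ge1//.
  by rewrite le_max lexx.
exact: (sobolev_addC pu mu bv pv hC fv hAt).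
Qed.
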